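(* Suppose there exists a locally universal $\mathrm{C}^*$-algebra $B$ which has a computable presentation $B^\dagger$. Then every computably weakly stable presentation $A^\dagger$ of a $\mathrm{C}^*$-algebra $A$ is computable.
   Context: All $\mathrm{C}^*$-algebras are unital and all $*$-homomorphisms are unital. A presentation of a $\mathrm{C}^*$-algebra $C$ is a pair $C^\dagger=(C,(a_n)_{n\in\mathbb N})$ where $\{a_n\}$ generates $C$ as a $\mathrm{C}^*$-algebra; its rational points are the elements $p(a_{i_1},\ldots,a_{i_k})$ with $p$ a $*$-polynomial with coefficients in $\mathbb Q(i)$ (a rational polynomial). $C^\dagger$ is computable if there is an algorithm which, on input a rational point $p$ of $C^\dagger$ and $k\in\mathbb N$, returns a rational $q$ with $|\|p\|-q|<2^{-k}$. Given generators $\bar x$ and a set $\mathcal R$ of relations $\|p(x_1,\ldots,x_n)\|\le a$ ($p$ a $*$-polynomial without constant term, $a\ge 0$; with a relation $\|x\|\le M$ for every generator, and a distinguished generator with relations making it the unit), $C^*\langle\bar x\mid\mathcal R\rangle$ denotes the universal $\mathrm{C}^*$-algebra of these generators and relations, and its standard presentation has the generators $\bar x$ as special points. A relation is rational if $p$ is a rational polynomial and $a$ a nonnegative dyadic rational; ''$p=0$'' means $\|p\|\le 0$. A presentation is finitely c.e. if it is the standard presentation of $C^*\langle\bar x\mid\mathcal R\rangle$ for finite $\bar x$ and a finite set $\mathcal R$ of rational relations. A finitely c.e. presentation $A^\dagger=C^*\langle x_1,\ldots,x_j\mid p_i(\bar x)=0\ (i=1,\ldots,r),\ \|x_k\|\le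 C_k\ (k=1,\ldots,j)\rangle$ is computably weakly stable if there is an algorithm which, given $n\in\mathbb N$, returns $m\in\mathbb N$ such that for every $\mathrm{C}^*$-algebra $D$ and every $\bar z\in D$ with $\|p_i(\bar z)\|\le 2^{-m}$ for all $i$ and $\|z_k\|\le C_k+2^{-m}$ for all $k$, there is a $*$-homomorphism $\varphi:A\to D$ with $\|\varphi(x_k)-z_k\|<2^{-n}$ for all $k$. A $\mathrm{C}^*$-algebra $B$ is locally universal if every $\mathrm{C}^*$-algebra embeds into an ultrapower $B^{\mathcal U}$ of $B$ with respect to a nonprincipal ultrafilter $\mathcal U$ on $\mathbb N$. *)

(* Defs.v *)
From HB Require Import structures.
From mathcomp Require Import all_boot all_order all_algebra.
From mathcomp Require Import all_classical all_reals topology normedtype.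
From mathcomp Require Import complex.

Set Implicit Arguments.
Unset Strict Implicit.
Unset Printing Implicit Defensive.

Import Order.TTheory GRing.Theory Num.Theory.
Import numFieldNormedType.Exports.

Local Open Scope classical_set_scope.
Local Open Scope quotient_scope.
Local Open Scope ring_scope.

Reserved Notation "x ** y" (at level 40, left associativity).

(* R[i] as a numFieldType. Writing R[i] in the structures below would make HB
   record a reverse coercion, which blocks rewriting. *)
Notation cplx R := (complex_complex__canonical__Num_NumField R).

(* The multiplication is not a GRing one: Hierarchy Builder does not allow a
   structure to inherit from both a ring and a normed module, since
   Num.NumDomain is already a ring with a norm.
   cone_neq0: the zero algebra is excluded. It admits no unital
   *-homomorphism to a nonzero algebra, so if it were allowed, no algebra
   would be locally universal. *)
HB.mixin Record isCstarAlgebra (R : realType) A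
    & CompleteNormedModule (cplx R) A := {
  cmul : A -> A -> A;
  cone : A;
  star : A -> A;
  cmulA : associative cmul;
  cmul1x : left_id cone cmul;
  cmulx1 : right_id cone cmul;
  cmulDl : left_distributive cmul +%R;
  cmulDr : right_distributive cmul +%R;
  cmulZl : forall (c : R[i]) (x y : A), cmul (c *: x) y = c *: cmul x y;
  cmulZr : forall (c : R[i]) (x y : A), cmul x (c *: y) = c *: cmul x y;
  cone_neq0 : cone <> 0;
  starD : {morph star : x y / x + y};
  starZ : forall (c : R[i]) (x : A), star (c *: x) = conjc c *: star x;
  starM : forall x y : A, star (cmul x y) = cmul (star y) (star x);
  starK : involutive star;
  cmul_norm : forall x y : A, `|cmul x y| <= `|x| * `|y|;
  cstar_identity : forall x : A, `|cmul (star x) x| = `|x| ^+ 2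
}.

#[short(type="cstarType")]
HB.structure Definition CstarAlgebra (R : realType) :=
  { A of CompleteNormedModule (cplx R) A & isCstarAlgebra R A }.

Notation "x ** y" := (cmul x y) : ring_scope.

Definition star_hom (R : realType) (A D : cstarType R) (phi : A -> D) : Prop :=
  [/\ linear phi,
      (forall x y, phi (x ** y) = phi x ** phi y),
      phi cone = cone
    & forall x, phi (star x) = star (phi x)].

(* A *-homomorphism between C*-algebras is injective if and only if it is
   isometric; this is the usual embedding of metric structures. *)
Definition star_embedding (R : realType) (A D : cstarType R) (phi : A -> D) :
    Prop :=
  star_hom phi /\ forall x, `|phi x| = `|x|.

Definition separable (T : topologicalType) : Prop :=
  exists S : set T, countable S /\ dense S.

Definition cstar_subalgebra (R : realType) (C : cstarType R) (S : set C) :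
    Prop :=
  [/\ closed S, S cone,
      (forall (c : R[i]) x y, S x -> S y -> S (c *: x + y)),
      (forall x y, S x -> S y -> S (x ** y))
    & forall x, S x -> S (star x)].

Definition generates (R : realType) (C : cstarType R) (I : Type) (a : I -> C) :
    Prop :=
  forall S : set C, cstar_subalgebra S -> (forall i, S (a i)) -> S = setT.

Record ultrafilterN := UltrafilterN {
  ufilter :> set_system nat;
  ufilter_ultra : UltraFilter ufilter;
  ufilter_nonprincipal : forall n, ~ ufilter [set n]
}.

Section Ultrapower.
Variables (R : realType) (B : cstarType R).

(* l^oo(B) *)
Record bseq := BSeq {
  bseq_val :> nat -> B;
  bseq_bounded : exists M : R, forall n, `|bseq_val n| <= M%:C%C
}.

HB.instance Definition _ := gen_eqMixin bseq.
HB.instance Definition _ := gen_choiceMixin bseq.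

Let nr (x : B) : R := complex.Re `|x|.

Let nrE x : (nr x)%:C%C = `|x|.
Proof. by apply: RRe_real; rewrite normr_real. Qed.

Let ReN (c : R[i]) : (complex.Re `|c|)%:C%C = `|c|.
Proof. by apply: RRe_real; rewrite normr_real. Qed.

Let nr_ge0 x : 0 <= nr x.
Proof. by rewrite -lecR nrE normr_ge0. Qed.

Let nrD x y : nr (x + y) <= nr x + nr y.
Proof. by rewrite -lecR rmorphD/= !nrE ler_normD. Qed.

Let nrB x y : nr (x - y) = nr (y - x).
Proof. by rewrite /nr distrC. Qed.

Let nr0 : nr 0 = 0.
Proof. by rewrite /nr normr0. Qed.

Let nrM x y : nr (x ** y) <= nr x * nr y.
Proof. by rewrite -lecR rmorphM/= !nrE cmul_norm. Qed.

Let nrZ c x : nr (c *: x) = complex.Re `|c| * nr x.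
Proof.
apply: (@complexI R); rewrite rmorphM/= !nrE normrZ.
by congr (_ * _); rewrite ReN.
Qed.

Let nr_cstar x : nr (star x ** x) = nr x ^+ 2.
Proof. by apply: (@complexI R); rewrite rmorphXn/= !nrE cstar_identity. Qed.

Let bmx (f : nat -> B) : (exists M : R, forall n, nr (f n) <= M) ->
  exists M : R, forall n, `|f n| <= M%:C%C.
Proof. by move=> [M fM]; exists M => n; rewrite -nrE lecR. Qed.

Let bseqM (b : bseq) : exists M : R, forall n, nr (b n) <= M.
Proof.
by have [M bM] := bseq_bounded b; exists M => n; rewrite -lecR nrE.
Qed.

Fact bseq_add_subproof (b c : bseq) :
  exists M : R, forall n, `|b n + c n| <= M%:C%C.
Proof.
apply: bmx; have [M bM] := bseqM b; have [N cN] := bseqM c.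
by exists (M + N) => n; rewrite (le_trans (nrD _ _))// lerD.
Qed.
Definition bseq_add (b c : bseq) := BSeq (bseq_add_subproof b c).

Fact bseq_scale_subproof (k : R[i]) (b : bseq) :
  exists M : R, forall n, `|k *: b n| <= M%:C%C.
Proof.
apply: bmx; have [M bM] := bseqM b; exists (complex.Re `|k| * M) => n.
by rewrite nrZ ler_wpM2l// -lecR ReN normr_ge0.
Qed.
Definition bseq_scale k (b : bseq) := BSeq (bseq_scale_subproof k b).

Fact bseq_mul_subproof (b c : bseq) :
  exists M : R, forall n, `|b n ** c n| <= M%:C%C.
Proof.
apply: bmx; have [M bM] := bseqM b; have [N cN] := bseqM c.
by exists (M * N) => n; rewrite (le_trans (nrM _ _))// ler_pM.
Qed.
Definition bseq_mul (b c : bseq) := BSeq (bseq_mul_subproof b c).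

Let nr_star x : nr (star x) = nr x.
Proof.
suff le z : nr z <= nr (star z).
  by apply/eqP; rewrite eq_le le andbT -{2}(starK x) le.
have [->|z0] := eqVneq (nr z) 0; first exact: nr_ge0.
have zp : 0 < nr z by rewrite lt_neqAle eq_sym z0 nr_ge0.
by rewrite -(ler_pM2r zp) -expr2 -nr_cstar nrM.
Qed.

Let starB (x y : B) : star (x - y) = star x - star y.
Proof. by apply: (addIr (star y)); rewrite -starD !subrK. Qed.

Let cmulBr (x y z : B) : x ** (y - z) = x ** y - x ** z.
Proof. by apply: (addIr (x ** z)); rewrite -cmulDr !subrK. Qed.

Let cmulBl (x y z : B) : (x - y) ** z = x ** z - y ** z.
Proof. by apply: (addIr (y ** z)); rewrite -cmulDl !subrK. Qed.

Fact bseq_star_subproof (b : bseq) :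
  exists M : R, forall n, `|star (b n)| <= M%:C%C.
Proof.
by apply: bmx; have [M bM] := bseqM b; exists M => n; rewrite nr_star.
Qed.
Definition bseq_star (b : bseq) := BSeq (bseq_star_subproof b).

Fact bseq_const_subproof (x : B) :
  exists M : R, forall n : nat, `|x| <= M%:C%C.
Proof. by apply: bmx; exists (nr x). Qed.
Definition bseq_const (x : B) := BSeq (bseq_const_subproof x).

Variable U : ultrafilterN.

#[local] Instance ufilterP : UltraFilter U := ufilter_ultra U.
#[local] Instance ufilter_proper : ProperFilter U := ultra_proper.

(* lim_U ||b_n||; the norm of B has its values in R[i], hence the Re. *)
Definition ulim_norm (b : nat -> B) : R :=
  lim (complex.Re `|b n| @[n --> ufilter U]).

Let ucvg (f : nat -> R) : (exists M : R, forall n, `|f n| <= M) ->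
  cvg (f n @[n --> ufilter U]).
Proof.
move=> [M fM]; have := @segment_compact R (- M) M (f n @[n --> ufilter U]) _.
case.
  by apply: nearW => n; rewrite /= in_itv/= -ler_norml.
move=> p [_ pcl]; apply/cvg_ex; exists p; apply/cvgrPdist_lt => e e0.
have [//|nU] := in_ultra_setVsetC [set n | `|p - f n| < e] ufilterP.
have [] := pcl (f @` ~` [set n | `|p - f n| < e]) (ball p e).
- by apply: filterS nU => n nn; exists n.
- exact: nbhsx_ballx.
- by move=> _ [[n /= nn <-] pn]; exfalso; apply: nn.
Qed.

Let ucvg_le (f g : nat -> R) l l' : f n @[n --> ufilter U] --> l ->
  g n @[n --> ufilter U] --> l' -> (forall n, f n <= g n) -> l <= l'.
Proof.
move=> fl gl fg; rewrite -subr_ge0; apply: (cvgr_to_ge (cvgB gl fl)).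
by apply: nearW => n; rewrite /= subr_ge0.
Qed.

Let ulim_cst (k : R) : k @[_ --> ufilter U] --> k.
Proof. exact: cvg_cst. Qed.

Let bcvg (b : bseq) : nr (b n) @[n --> ufilter U] --> ulim_norm b.
Proof.
apply: ucvg; have [M bM] := bseqM b; exists M => n.
by rewrite ger0_norm.
Qed.

Let ulim_eq (b : nat -> B) l :
  nr (b n) @[n --> ufilter U] --> l -> ulim_norm b = l.
Proof. by move=> bl; apply: cvg_lim. Qed.

Let ulim_ge0 (b : bseq) : 0 <= ulim_norm b.
Proof. by apply: limr_ge; [exact: bcvg|apply: nearW => n; exact: nr_ge0]. Qed.

Let ulim_le (b : bseq) M : (\forall n \near ufilter U, nr (b n) <= M) ->
  ulim_norm b <= M.
Proof. by move=> bM; apply: limr_le => //; exact: bcvg. Qed.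

Let ulim_lt (b : bseq) e :
  ulim_norm b < e -> \forall n \near ufilter U, nr (b n) < e.
Proof. by move=> be; apply: (cvgr_lt (ulim_norm b)) => //; exact: bcvg. Qed.

Let ulim_sub_le (b c d : bseq) :
  (forall n, nr (b n) <= nr (c n) + nr (d n)) ->
  ulim_norm b <= ulim_norm c + ulim_norm d.
Proof.
move=> bcd; apply: (@ucvg_le (fun n => nr (b n))
  (fun n => nr (c n) + nr (d n))) => //.
by apply: cvgD; exact: bcvg.
Qed.

Definition bseq_sub (b c : bseq) := bseq_add b (bseq_scale (-1) c).

Let bseq_subE (b c : bseq) n : bseq_sub b c n = b n - c n.
Proof. by rewrite /= scaleN1r. Qed.

(* c_U = {b : lim_U ||b_n|| = 0}, and b ~ c iff b - c is in c_U *)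
Definition bseq_eqU (b c : bseq) : bool := ulim_norm (bseq_sub b c) == 0.

Let bseq_eqU_refl : reflexive bseq_eqU.
Proof.
move=> b; apply/eqP/ulim_eq; under eq_fun do rewrite bseq_subE subrr nr0.
exact: ulim_cst.
Qed.

Let bseq_eqU_sym : symmetric bseq_eqU.
Proof.
move=> b c; rewrite /bseq_eqU; congr (_ == _); rewrite /ulim_norm.
suff -> : (fun n => complex.Re `|bseq_sub b c n|) =
  (fun n => complex.Re `|bseq_sub c b n|) by [].
by apply/funext => n; rewrite !bseq_subE distrC.
Qed.

Let le0_eqU b c : ulim_norm (bseq_sub b c) <= 0 -> bseq_eqU b c.
Proof. by move=> le0; rewrite /bseq_eqU eq_le le0 ulim_ge0. Qed.

Let bseq_eqU_trans : transitive bseq_eqU.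
Proof.
move=> c b d /eqP bc /eqP cd; apply: le0_eqU.
rewrite -[0]addr0 -{1}bc -cd; apply: ulim_sub_le => n.
by rewrite !bseq_subE; apply: le_trans (nrD _ _); rewrite subrKA.
Qed.

Definition bseq_equiv : equiv_rel bseq :=
  EquivRel bseq_eqU bseq_eqU_refl bseq_eqU_sym bseq_eqU_trans.

(* l^oo(B) / c_U *)
Definition ultrapower : Type := {eq_quot bseq_equiv}.

HB.instance Definition _ := Choice.on ultrapower.

Definition uclass (b : bseq) : ultrapower := \pi_{eq_quot bseq_equiv} b.
Definition urep (x : ultrapower) : bseq := repr (x : {eq_quot bseq_equiv}).

Lemma urepK x : uclass (urep x) = x.
Proof. exact: reprK. Qed.

Lemma uclass_eqP b c : uclass b = uclass c <-> bseq_eqU b c.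
Proof.
rewrite /uclass; split=> [/eqmodP//|bc].
by apply/(@eqmodP _ bseq_equiv).
Qed.

Lemma urep_eqU b : bseq_eqU (urep (uclass b)) b.
Proof. by apply/uclass_eqP; rewrite urepK. Qed.

Let uclass_ext (b c : bseq) : (forall n, b n = c n) -> uclass b = uclass c.
Proof.
move=> bc; apply/uclass_eqP; rewrite /bseq_eqU.
apply/eqP/ulim_eq; under eq_fun do rewrite bseq_subE bc subrr nr0.
exact: ulim_cst.
Qed.

Definition uadd x y := uclass (bseq_add (urep x) (urep y)).
Definition uopp x := uclass (bseq_scale (-1) (urep x)).
Definition uzero := uclass (bseq_const 0).
Definition uscale k x := uclass (bseq_scale k (urep x)).
Definition umul x y := uclass (bseq_mul (urep x) (urep y)).
Definition uone := uclass (bseq_const cone).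
Definition ustar x := uclass (bseq_star (urep x)).
Definition unorm x : R[i] := (ulim_norm (urep x))%:C%C.

Let eqU_cvg (b c : bseq) : bseq_eqU b c -> nr (b n - c n) @[n --> ufilter U] --> (0 : R).
Proof.
move=> /eqP bc0; have := @bcvg (bseq_sub b c); rewrite bc0.
suff -> : (fun n => nr (bseq_sub b c n)) = (fun n => nr (b n - c n)) by [].
by apply/funext => n; rewrite bseq_subE.
Qed.

Let eqU_le (b c : bseq) (f : nat -> R) : f n @[n --> ufilter U] --> (0 : R) ->
  (forall n, nr (b n - c n) <= f n) -> bseq_eqU b c.
Proof.
move=> f0 bf; apply: le0_eqU.
apply: (@ucvg_le (fun n => nr (bseq_sub b c n)) f) => //.
by move=> n; rewrite bseq_subE.
Qed.

Lemma uaddE b c : uadd (uclass b) (uclass c) = uclass (bseq_add b c).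
Proof.
apply/uclass_eqP.
apply: (eqU_le (f := fun n => nr (urep (uclass b) n - b n) +
                              nr (urep (uclass c) n - c n))).
  by rewrite -[0]addr0; apply: cvgD; apply/eqU_cvg/urep_eqU.
by move=> n /=; apply: le_trans (nrD _ _); rewrite addrACA -opprD.
Qed.

Lemma uscaleE k b : uscale k (uclass b) = uclass (bseq_scale k b).
Proof.
apply/uclass_eqP.
apply: (eqU_le (f := fun n => complex.Re `|k| * nr (urep (uclass b) n - b n))).
  rewrite -[0](mulr0 (complex.Re `|k|)).
  by apply: cvgM; [exact: cvg_cst|apply/eqU_cvg/urep_eqU].
by move=> n /=; rewrite -scalerBr nrZ.
Qed.

Lemma uoppE b : uopp (uclass b) = uclass (bseq_scale (-1) b).
Proof. exact: uscaleE. Qed.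

Lemma ustarE b : ustar (uclass b) = uclass (bseq_star b).
Proof.
apply/uclass_eqP; apply: (eqU_le (eqU_cvg (urep_eqU b))) => n /=.
by rewrite -starB nr_star.
Qed.

Lemma umulE b c : umul (uclass b) (uclass c) = uclass (bseq_mul b c).
Proof.
have [M bM] := bseqM (urep (uclass b)); have [N cN] := bseqM c.
apply/uclass_eqP.
apply: (eqU_le (f := fun n => M * nr (urep (uclass c) n - c n) +
                              nr (urep (uclass b) n - b n) * N)).
  rewrite -[0](addr0 0) -[X in X + _](mulr0 M) -[X in _ + X](mul0r N).
  apply: cvgD; apply: cvgM; try exact: cvg_cst.
    exact/eqU_cvg/urep_eqU.
  exact/eqU_cvg/urep_eqU.
move=> n /=; set b' := urep _ n; set c' := urep _ n.
have -> : b' ** c' - b n ** c n = b' ** (c' - c n) + (b' - b n) ** c n.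
  by rewrite cmulBr cmulBl addrA subrK.
apply: (le_trans (nrD _ _)); apply: lerD; apply: (le_trans (nrM _ _)).
  by apply: ler_wpM2r; [exact: nr_ge0|exact: bM].
by apply: ler_wpM2l; [exact: nr_ge0|exact: cN].
Qed.

Lemma unormE b : unorm (uclass b) = (ulim_norm b)%:C%C.
Proof.
congr (_ %:C)%C; have /eqP bb := urep_eqU b; have := urep_eqU b.
rewrite bseq_eqU_sym => /eqP bb'.
apply/eqP; rewrite eq_le; apply/andP; split.
  rewrite -[leRHS]add0r -bb; apply: ulim_sub_le => n.
  by rewrite bseq_subE; apply: le_trans (nrD _ _); rewrite subrK.
rewrite -[leRHS]add0r -bb'; apply: ulim_sub_le => n.
by rewrite bseq_subE; apply: le_trans (nrD _ _); rewrite subrK.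
Qed.

Lemma uclassP (P : ultrapower -> Prop) : (forall b, P (uclass b)) ->
  forall x, P x.
Proof. by move=> Pb x; rewrite -[x]urepK. Qed.

Let uE := (uaddE, uscaleE, uoppE, ustarE, umulE).

Fact uaddA : associative uadd.
Proof.
elim/uclassP => a; elim/uclassP => b; elim/uclassP => c; rewrite !uE.
by apply: uclass_ext => n /=; rewrite addrA.
Qed.

Fact uaddC : commutative uadd.
Proof.
elim/uclassP => a; elim/uclassP => b; rewrite !uE.
by apply: uclass_ext => n /=; rewrite addrC.
Qed.

Fact uadd0x : left_id uzero uadd.
Proof.
by elim/uclassP => a; rewrite !uE; apply: uclass_ext => n /=; rewrite add0r.
Qed.

Fact uaddNx : left_inverse uzero uopp uadd.
Proof.
elim/uclassP => a; rewrite !uE; apply: uclass_ext => n /=.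
by rewrite scaleN1r addNr.
Qed.

HB.instance Definition _ :=
  GRing.isZmodule.Build ultrapower uaddA uaddC uadd0x uaddNx.

Fact uscaleA k l x : uscale k (uscale l x) = uscale (k * l) x.
Proof.
elim/uclassP: x => a; rewrite !uE.
by apply: uclass_ext => n /=; rewrite scalerA.
Qed.

Fact uscale1 : left_id 1 uscale.
Proof.
by elim/uclassP => a; rewrite !uE; apply: uclass_ext => n /=; rewrite scale1r.
Qed.

Fact uscaleDr : right_distributive uscale +%R.
Proof.
move=> k; elim/uclassP => a; elim/uclassP => b; rewrite /GRing.add/= !uE.
by apply: uclass_ext => n /=; rewrite scalerDr.
Qed.

Fact uscaleDl x : {morph uscale^~ x : k l / k + l}.
Proof.
elim/uclassP: x => a k l; rewrite [in RHS]/GRing.add/= !uE.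
by apply: uclass_ext => n /=; rewrite scalerDl.
Qed.

HB.instance Definition _ := GRing.Zmodule_isLmodule.Build (cplx R) ultrapower
  uscaleA uscale1 uscaleDr uscaleDl.

Fact unormD x y : unorm (x + y) <= unorm x + unorm y.
Proof.
elim/uclassP: x => a; elim/uclassP: y => b.
have -> : uclass a + uclass b = uclass (bseq_add a b) by exact: uaddE.
rewrite !unormE.
have : ulim_norm (bseq_add a b) <= ulim_norm a + ulim_norm b.
  by apply: ulim_sub_le => n /=; exact: nrD.
by rewrite -lecR rmorphD.
Qed.

Fact unormZ (k : cplx R) x : unorm (k *: x) = `|k| * unorm x.
Proof.
elim/uclassP: x => a.
have -> : k *: uclass a = uclass (bseq_scale k a) by exact: uscaleE.
have E : ulim_norm (bseq_scale k a) = complex.Re `|k| * ulim_norm a.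
  apply: ulim_eq => /=; under eq_fun do rewrite nrZ.
  by apply: cvgM; [exact: ulim_cst|exact: bcvg].
by rewrite !unormE -[X in X * _]ReN E rmorphM.
Qed.

Fact unorm0_eq0 x : unorm x = 0 -> x = 0.
Proof.
elim/uclassP: x => a; rewrite unormE => -[a0].
apply/uclass_eqP/eqP/ulim_eq; under eq_fun do rewrite bseq_subE subr0.
by rewrite -a0; exact: bcvg.
Qed.

HB.instance Definition _ := Lmodule_isNormed.Build (cplx R) ultrapower
  unormD unormZ unorm0_eq0.

Let unorm_uclass b : `|uclass b| = (ulim_norm b)%:C%C.
Proof. exact: unormE. Qed.

Let usubE b c : uclass b - uclass c = uclass (bseq_sub b c).
Proof. by rewrite [LHS](_ : _ = uadd (uclass b) (uopp (uclass c)))// !uE. Qed.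

Let ufilter_ge k : \forall n \near ufilter U, (k <= n)%N.
Proof.
elim: k => [|k IHk]; first exact: nearW.
have [/ufilter_nonprincipal//|nk] := in_ultra_setVsetC [set k] ufilterP.
apply: filterS (filterI IHk nk) => n [kn /eqP nk'].
by rewrite ltn_neqAle eq_sym nk'.
Qed.

Fact ultrapower_complete (F : set_system ultrapower) :
  ProperFilter F -> cauchy F -> cvg F.
Proof.
move=> FF /(@cauchyP (cplx R) ultrapower F FF) Fc; pose e k : R := k.+1%:R^-1.
have e_gt0 k : 0 < e k by rewrite invr_gt0.
have e_le k l : (k <= l)%N -> e l <= e k.
  by move=> kl; rewrite lef_pV2 ?posrE// ler_nat.
have /choice[y Fy] k : exists x, F (ball x (e k)%:C%C).
  by apply: Fc; rewrite ltcR.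
pose b k := urep (y k).
have ynear k l : \forall n \near ufilter U, nr (b k n - b l n) < e k + e l.
  have [z []] := filter_ex (filterI (Fy k) (Fy l)).
  rewrite -ball_normE/= => zk zl.
  have /ulim_lt : ulim_norm (bseq_sub (b k) (b l)) < e k + e l.
    have nE : (ulim_norm (bseq_sub (b k) (b l)))%:C%C = `|y k - y l|.
      by rewrite -unorm_uclass -usubE !urepK.
    rewrite -ltcR nE rmorphD.
    have -> : y k - y l = (y k - z) - (y l - z) by rewrite opprB addrA subrK.
    exact: le_lt_trans (ler_normB _ _) (ltrD zk zl).
  by apply: filterS => n; rewrite bseq_subE.
pose P n m := [forall k : 'I_m.+1, forall l : 'I_m.+1,
  nr (b k n - b l n) < e k + e l].
have P0 n : P n (@ord0 n).
  apply/forallP => k; apply/forallP => l; rewrite !ord1 subrr nr0.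
  by rewrite addr_gt0.
pose m n : nat := [arg max_(i > @ord0 n | P n i) i].
have Pm n : P n (m n) by rewrite /m; case: arg_maxnP.
have m_ge k : \forall n \near ufilter U, (k <= m n)%N.
  have : \forall n \near ufilter U, P n k.
    have : \forall n \near ufilter U, forall kl : 'I_k.+1 * 'I_k.+1,
        nr (b kl.1 n - b kl.2 n) < e kl.1 + e kl.2.
      by apply: filter_forall => -[i j]; exact: ynear.
    apply: filterS => n nP; apply/forallP => i; apply/forallP => j.
    exact: (nP (i, j)).
  move=> /(filterI (ufilter_ge k)); apply: filterS => n [kn Pnk].
  rewrite /m; case: arg_maxnP => // i _ /(_ (Ordinal (kn : (k < n.+1)%N))).
  exact.
have mb n k : (k <= m n)%N -> nr (b k n - b (m n) n) < e k + e k.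
  move=> km; have /forallP/(_ (Ordinal (km : (k < (m n).+1)%N))) := Pm n.
  move=> /forallP/(_ ord_max)/= /lt_le_trans; apply.
  by rewrite lerD2l e_le.
have cM : exists M : R, forall n, `|b (m n) n| <= M%:C%C.
  apply: bmx; have [M bM] := bseqM (b 0%N); exists (M + (e 0%N + e 0%N)) => n.
  rewrite -(subrK (b 0%N n) (b (m n) n)) addrC.
  apply: (le_trans (nrD _ _)); apply: lerD; first exact: bM.
  by rewrite nrB ltW// mb.
pose c := BSeq cM.
have yc k : `|y k - uclass c| <= (e k + e k)%:C%C.
  rewrite -(urepK (y k)) usubE unorm_uclass lecR; apply: ulim_le.
  by apply: filterS (m_ge k) => n /mb /ltW; rewrite bseq_subE.
apply/cvg_ex; exists (uclass c); apply/fcvgrPdist_lt => eps eps0.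
have [d d0 ed] : exists2 d : R, 0 < d & eps = d%:C%C.
  exists (complex.Re eps); last by rewrite RRe_real// gtr0_real.
  by rewrite -ltcR RRe_real// gtr0_real.
have [k ke] : exists k, 0 + e k < d / 3 by apply: ltr_add_invr; rewrite divr_gt0.
apply: filterS (Fy k) => z; rewrite -ball_normE/= => zk.
have -> : uclass c - z = (y k - z) - (y k - uclass c).
  by rewrite opprB [RHS]addrC subrKA.
apply: le_lt_trans (ler_normB _ _) _.
apply: lt_trans (ltr_leD zk (yc k)) _.
rewrite ed -rmorphD/= ltcR; move: ke; rewrite add0r ltr_pdivlMr//.
by rewrite mulr_natr !mulrS mulr0n addr0.
Qed.

HB.instance Definition _ := Uniform_isComplete.Build ultrapower
  ultrapower_complete.

Fact umulA : associative umul.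
Proof.
elim/uclassP => a; elim/uclassP => b; elim/uclassP => c; rewrite !uE.
by apply: uclass_ext => n /=; rewrite cmulA.
Qed.

Fact umul1x : left_id uone umul.
Proof.
by elim/uclassP => a; rewrite !uE; apply: uclass_ext => n /=; rewrite cmul1x.
Qed.

Fact umulx1 : right_id uone umul.
Proof.
by elim/uclassP => a; rewrite !uE; apply: uclass_ext => n /=; rewrite cmulx1.
Qed.

Let uaddE' b c : uclass b + uclass c = uclass (bseq_add b c).
Proof. exact: uaddE. Qed.

Let uscaleE' (k : R[i]) b : k *: uclass b = uclass (bseq_scale k b).
Proof. exact: uscaleE. Qed.

Let uE' := (uaddE', uscaleE', ustarE, umulE).

Fact umulDl : left_distributive umul +%R.
Proof.
elim/uclassP => a; elim/uclassP => b; elim/uclassP => c; rewrite !uE'.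
by apply: uclass_ext => n /=; rewrite cmulDl.
Qed.

Fact umulDr : right_distributive umul +%R.
Proof.
elim/uclassP => a; elim/uclassP => b; elim/uclassP => c; rewrite !uE'.
by apply: uclass_ext => n /=; rewrite cmulDr.
Qed.

Fact umulZl (k : R[i]) x y : umul (k *: x) y = k *: umul x y.
Proof.
elim/uclassP: x => a; elim/uclassP: y => b; rewrite !uE'.
by apply: uclass_ext => n /=; rewrite cmulZl.
Qed.

Fact umulZr (k : R[i]) x y : umul x (k *: y) = k *: umul x y.
Proof.
elim/uclassP: x => a; elim/uclassP: y => b; rewrite !uE'.
by apply: uclass_ext => n /=; rewrite cmulZr.
Qed.

Fact uone_neq0 : uone <> 0.
Proof.
move=> /uclass_eqP/eqU_cvg/= /cvg_lim; rewrite subr0 lim_cst//.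
move=> /(_ (@Rhausdorff R)) n0; apply: (@cone_neq0 R B).
by apply/normr0_eq0; rewrite -nrE n0.
Qed.

Fact ustarD : {morph ustar : x y / x + y}.
Proof.
elim/uclassP => a; elim/uclassP => b; rewrite !uE'.
by apply: uclass_ext => n /=; rewrite starD.
Qed.

Fact ustarZ (k : R[i]) x : ustar (k *: x) = conjc k *: ustar x.
Proof.
elim/uclassP: x => a; rewrite !uE'.
by apply: uclass_ext => n /=; rewrite starZ.
Qed.

Fact ustarM x y : ustar (umul x y) = umul (ustar y) (ustar x).
Proof.
elim/uclassP: x => a; elim/uclassP: y => b; rewrite !uE'.
by apply: uclass_ext => n /=; rewrite starM.
Qed.

Fact ustarK : involutive ustar.
Proof.
elim/uclassP => a; rewrite !uE'.
by apply: uclass_ext => n /=; rewrite starK.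
Qed.

Fact umul_norm (x y : ultrapower) : `|umul x y| <= `|x| * `|y|.
Proof.
elim/uclassP: x => a; elim/uclassP: y => b; rewrite !uE' !unorm_uclass.
have : ulim_norm (bseq_mul a b) <= ulim_norm a * ulim_norm b.
  apply: (@ucvg_le (fun n => nr (bseq_mul a b n))
    (fun n => nr (a n) * nr (b n))) => //.
    by apply: cvgM; exact: bcvg.
  by move=> n; exact: nrM.
by rewrite -lecR rmorphM.
Qed.

Fact ustar_identity (x : ultrapower) : `|umul (ustar x) x| = `|x| ^+ 2.
Proof.
elim/uclassP: x => a; rewrite !uE' !unorm_uclass.
have -> : ulim_norm (bseq_mul (bseq_star a) a) = ulim_norm a ^+ 2.
  apply: ulim_eq => /=; under eq_fun do rewrite nr_cstar expr2.
  by rewrite expr2; apply: cvgM; exact: bcvg.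
by rewrite rmorphXn.
Qed.

HB.instance Definition _ := isCstarAlgebra.Build R ultrapower
  umulA umul1x umulx1 umulDl umulDr umulZl umulZr uone_neq0
  ustarD ustarZ ustarM ustarK umul_norm ustar_identity.

End Ultrapower.

(* If B is separable, then B^U has at most the cardinality of the continuum, so
   not all algebras D embed; as usual, only the separable ones are required to. *)
Definition locally_universal (R : realType) (B : cstarType R) : Prop :=
  forall D : cstarType R, separable D ->
  exists (U : ultrafilterN) (phi : D -> ultrapower B U), star_embedding phi.

(* Kleene's total recursive functions; mu-recursion is restricted to regular
   functions, so that no partial function is needed. *)
Inductive recursive : forall n : nat, (n.-tuple nat -> nat) -> Prop :=
| rec_zero : @recursive 0 (fun _ => 0%N)
| rec_succ : @recursive 1 (fun v => (thead v).+1)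
| rec_proj n (i : 'I_n) : @recursive n (fun v => tnth v i)
| rec_comp m n (f : m.-tuple nat -> nat) (g : 'I_m -> n.-tuple nat -> nat) :
    recursive f -> (forall i, recursive (g i)) ->
    @recursive n (fun v => f [tuple g i v | i < m])
| rec_prim n (f : n.-tuple nat -> nat) (g : n.+2.-tuple nat -> nat) :
    recursive f -> recursive g ->
    @recursive n.+1 (fun v =>
      iteri (thead v) (fun k r => g [tuple of k :: r :: behead v])
            (f [tuple of behead v]))
| rec_mu n (f : n.+1.-tuple nat -> nat) (h : n.-tuple nat -> nat) :
    recursive f ->
    (forall v, f [tuple of h v :: v] = 0%N) ->
    (forall v k, (k < h v)%N -> f [tuple of k :: v] <> 0%N) ->
    recursive h.

Definition recursive1 (f : nat -> nat) : Prop :=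
  recursive (fun v : 1.-tuple nat => f (thead v)).

Definition recursive2 (f : nat -> nat -> nat) : Prop :=
  recursive (fun v : 2.-tuple nat => f (tnth v ord0) (tnth v ord_max)).

(* The Cantor pairing (a + b)(a + b + 1)/2 + b. *)
Definition pair_code (a b : nat) : nat := ('C((a + b).+1, 2) + b)%N.

Definition int_code (z : int) : nat :=
  match z with Posz n => n.*2 | Negz n => n.*2.+1 end.

Definition rat_code (q : rat) : nat :=
  pair_code (int_code (numq q)) `|denq q|%N.

(* Noncommutative *-polynomials over Q(i) = rat[i], given by expressions. *)
Inductive starpoly (V : Type) : Type :=
| SConst of rat[i]
| SVar of V
| SAdd of starpoly V & starpoly V
| SMul of starpoly V & starpoly V
| SStar of starpoly V.
Arguments SConst {V}.

Fixpoint poly_code (p : starpoly nat) : nat :=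
  match p with
  | SConst c =>
      pair_code 0 (pair_code (rat_code (complex.Re c)) (rat_code (complex.Im c)))
  | SVar n => pair_code 1 n
  | SAdd p q => pair_code 2 (pair_code (poly_code p) (poly_code q))
  | SMul p q => pair_code 3 (pair_code (poly_code p) (poly_code q))
  | SStar p => pair_code 4 (poly_code p)
  end.

Fixpoint const_coef (V : Type) (p : starpoly V) : rat[i] :=
  match p with
  | SConst c => c
  | SVar _ => 0
  | SAdd p q => const_coef p + const_coef q
  | SMul p q => const_coef p * const_coef q
  | SStar p => conjc (const_coef p)
  end.

Definition ratc (R : realType) (c : rat[i]) : R[i] :=
  (ratr (complex.Re c) +i* ratr (complex.Im c))%C.

Fixpoint peval (R : realType) (D : cstarType R) (V : Type) (z : V -> D)
    (p : starpoly V) : D :=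
  match p with
  | SConst c => ratc R c *: cone
  | SVar v => z v
  | SAdd p q => peval z p + peval z q
  | SMul p q => peval z p ** peval z q
  | SStar p => star (peval z p)
  end.

Record presentation (R : realType) (C : cstarType R) := Presentation {
  special_point :> nat -> C;
  special_pointP : generates special_point
}.

Definition computable_presentation (R : realType) (C : cstarType R)
    (Cd : presentation C) : Prop :=
  exists2 f : nat -> nat -> nat, recursive2 f &
  forall (p : starpoly nat) (k : nat), exists2 q : rat,
    f (poly_code p) k = rat_code q &
    `| `|peval Cd p| - ratr q | < 2 ^- k.

(* The relations p_i = 0 and ||x_k|| <= C_k on generators x_1, ..., x_j.
   The distinguished generator fp_unit denotes the unit, see approx_rep; it
   replaces the constant terms. *)
Record finite_relations := FiniteRelations {
  fp_ngen : nat;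
  fp_unit : 'I_fp_ngen;
  fp_nrel : nat;
  fp_rel : 'I_fp_nrel -> starpoly 'I_fp_ngen;
  fp_bound : 'I_fp_ngen -> rat;
  fp_rel_noconst : forall i, const_coef (fp_rel i) = 0;
  fp_bound_dyadic : forall k, exists a n : nat, fp_bound k = a%:R / 2 ^+ n
}.

(* The relations making fp_unit the unit are imposed exactly, and not up to
   eps: together with the unitality of *-homomorphisms, relations such as
   e x = x e = x would, if relaxed, be met up to eps by z = 0, and no
   presentation would be weakly stable. *)
Definition approx_rep (R : realType) (X : finite_relations) (eps : R)
    (D : cstarType R) (z : 'I_(fp_ngen X) -> D) : Prop :=
  [/\ z (fp_unit X) = cone,
      (forall i, `|peval z (fp_rel i)| <= eps%:C%C)
    & forall k, `|z k| <= (ratr (fp_bound k) + eps)%:C%C].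

(* (A, x) is C*<x | X>; uniqueness of phi follows from generation. *)
Definition is_universal (R : realType) (X : finite_relations)
    (A : cstarType R) (x : 'I_(fp_ngen X) -> A) : Prop :=
  [/\ approx_rep 0 x, generates x
    & forall (D : cstarType R) (z : 'I_(fp_ngen X) -> D), approx_rep 0 z ->
      exists2 phi : A -> D, star_hom phi & forall k, phi (x k) = z k].

(* The finite tuple of special points is padded with zeros. *)
Definition pad (R : realType) (C : cstarType R) (j : nat) (x : 'I_j -> C)
    (n : nat) : C :=
  if insub n is Some k then x k else 0.

Lemma generates_pad (R : realType) (C : cstarType R) (j : nat)
  (x : 'I_j -> C) : generates x -> generates (pad x).
Proof.
move=> gx S CS Sx; apply: gx => // k.
by have := Sx k; rewrite /pad valK.
Qed.

Definition computably_weakly_stable (R : realType) (X : finite_relations)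
    (A : cstarType R) (x : 'I_(fp_ngen X) -> A) : Prop :=
  exists2 f : nat -> nat, recursive1 f &
  forall (n : nat) (D : cstarType R) (z : 'I_(fp_ngen X) -> D),
    approx_rep (2 ^- f n) z ->
    exists2 phi : A -> D, star_hom phi &
      forall k, `|phi (x k) - z k| < 2 ^- n.

Lemma universal_generates (R : realType) (X : finite_relations)
  (A : cstarType R) (x : 'I_(fp_ngen X) -> A) : is_universal x -> generates x.
Proof. by case. Qed.

Definition standard_presentation (R : realType) (X : finite_relations)
    (A : cstarType R) (x : 'I_(fp_ngen X) -> A) (ux : is_universal x) :
    presentation A :=
  Presentation (generates_pad (universal_generates ux)).

(* Main.v *)
(* Lower and upper bounds of ||p(x)|| in A are enumerated until they meet.

   Lower bounds: a tuple z of rational points of B that satisfies the relations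
   up to 2^-m, with m given by weak stability, is close to phi(x) for some
   *-homomorphism phi : A -> B, and phi is contractive, so ||p(z)|| is at most
   ||p(x)|| up to a computable error. Since A embeds into an ultrapower of B,
   such tuples bring ||p(z)|| arbitrarily close to ||p(x)||.

   Upper bounds: inequalities ||p(x) - q(x)|| <= r are derived from the relations
   by the rules of a normed *-algebra and the rule that ||a^* a|| <= r^2 implies
   ||a|| <= r. The infimum of the derivable bounds of p is a C*-seminorm on
   noncommutative *-polynomials. Its completion is a C*-algebra satisfying the
   relations, so by universality the infimum is ||p(x)||, and derivations can be
   enumerated.

   *-homomorphisms are contractive: if a is self-adjoint and ||a|| < 1, then
   1 - a^2 = b^2 for a self-adjoint b commuting with a, so phi(a) + i phi(b) is
   unitary and its real part phi(a) has norm at most 1. *)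
From HB Require Import structures.
Require Import Defs.
From mathcomp Require Import all_boot all_order all_algebra.
From mathcomp Require Import all_classical all_reals topology normedtype.
From mathcomp Require Import sequences complex zify ring lra.

Set Implicit Arguments.
Unset Strict Implicit.
Unset Printing Implicit Defensive.

Import Order.TTheory GRing.Theory Num.Theory.
Import numFieldNormedType.Exports.

(** * Recursive functions *)

Lemma recursive_eq n (f g : n.-tuple nat -> nat) :
  recursive f -> f =1 g -> recursive g.
Proof. by move=> rf /funext <-. Qed.

Lemma recursive_const n c : recursive (fun _ : n.-tuple nat => c).
Proof.
elim: c => [|c IHc].
  exact: (@rec_comp 0 n _ (fun _ _ => 0%N) rec_zero (fun i : 'I_0 => False_ind _ (notF (valP i)))).
apply: recursive_eq (@rec_comp 1 n _ (fun _ _ => c) rec_succ (fun _ => IHc)) _ => v.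
by rewrite /thead tnth_mktuple.
Qed.

Lemma recursive_comp1 n h (f : n.-tuple nat -> nat) :
  recursive1 h -> recursive f -> recursive (fun v => h (f v)).
Proof.
move=> rh rf.
apply: recursive_eq (@rec_comp 1 n _ (fun _ => f) rh (fun _ => rf)) _ => v.
by rewrite /thead tnth_mktuple.
Qed.

Lemma recursive_comp2 n h (f g : n.-tuple nat -> nat) :
  recursive2 h -> recursive f -> recursive g ->
  recursive (fun v => h (f v) (g v)).
Proof.
move=> rh rf rg.
have rfg (i : 'I_2) : recursive (if i == ord0 then f else g) by case: ifP.
apply: recursive_eq (rec_comp rh rfg) _ => v.
by rewrite !tnth_mktuple.
Qed.

Lemma recursive_iteri (f : nat -> nat) (g : nat -> nat -> nat -> nat) :
  recursive1 f ->
  recursive (fun v : 3.-tuple nat => g (tnth v (inord 0)) (tnth v (inord 1)) (tnth v (inord 2))) ->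
  recursive2 (fun a x => iteri a (fun k r => g k r x) (f x)).
Proof.
move=> rf rg; apply: recursive_eq (rec_prim rf rg) _ => v.
case/tupleP: v => a v; case/tupleP: v => x v.
have -> : tnth [tuple of a :: [tuple of x :: v]] ord_max = x.
  by rewrite (tnth_nth 0%N).
have -> : thead [tuple of a :: [tuple of x :: v]] = a by [].
have -> : tnth [tuple of a :: [tuple of x :: v]] ord0 = a by [].
have -> : thead [tuple of behead [tuple of a :: [tuple of x :: v]]] = x.
  by rewrite /thead (tnth_nth 0%N).
by apply: eq_iteri => k r; rewrite !(tnth_nth 0%N) !inordK.
Qed.


Lemma recursive1_comp f g :
  recursive1 f -> recursive1 g -> recursive1 (fun n => f (g n)).
Proof. exact: recursive_comp1. Qed.

Lemma recursive1_comp2 h f g : recursive2 h -> recursive1 f -> recursive1 g ->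
  recursive1 (fun n => h (f n) (g n)).
Proof. exact: recursive_comp2. Qed.

Lemma recursive1_id : recursive1 id.
Proof. exact: (rec_proj ord0). Qed.

Lemma recursive1_const c : recursive1 (fun _ => c).
Proof. exact: recursive_const. Qed.

Lemma recursive2_swap h : recursive2 h -> recursive2 (fun m n => h n m).
Proof. by move=> rh; exact: recursive_comp2 rh (rec_proj _) (rec_proj _). Qed.

Lemma recursive2_addn : recursive2 addn.
Proof.
have := @recursive_iteri id (fun _ r _ => r.+1) recursive1_id
  (recursive_comp1 rec_succ (rec_proj _)).
by move/recursive_eq; apply=> v /=; elim: (tnth v ord0) => //= k ->.
Qed.

Lemma recursive1_predn : recursive1 predn.
Proof.
have := recursive1_comp2 (@recursive_iteri (fun=> 0%N) (fun k _ _ => k)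
  (recursive_const _ _) (rec_proj _)) recursive1_id recursive1_id.
by move/recursive_eq; apply=> v /=; case: (thead v).
Qed.

Lemma recursive2_subn : recursive2 subn.
Proof.
have := recursive2_swap (@recursive_iteri id (fun _ r _ => r.-1) recursive1_id
  (recursive_comp1 recursive1_predn (rec_proj _))).
move/recursive_eq; apply=> v /=; elim: (tnth v ord_max) => [|k /= ->].
  by rewrite /= subn0.
by rewrite subnS.
Qed.

Lemma recursive2_muln : recursive2 muln.
Proof.
have := @recursive_iteri (fun=> 0%N) (fun _ r x => r + x)%N
  (recursive_const _ _)
  (recursive_comp2 recursive2_addn (rec_proj _) (rec_proj _)).
by move/recursive_eq; apply=> v /=; elim: (tnth v ord0) => //= k ->; rewrite mulSn addnC.
Qed.

Lemma recursive2_leq : recursive2 (fun m n => (m <= n)%N : nat).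
Proof.
have := recursive_comp2 recursive2_subn (recursive_const 2 1) recursive2_subn.
by move/recursive_eq; apply=> v; rewrite /leq; case: (tnth v ord0 - _)%N.
Qed.

Lemma recursive1_odd : recursive1 (fun n => odd n : nat).
Proof.
have := recursive1_comp2 (@recursive_iteri (fun=> 0%N) (fun _ r _ => 1 - r)%N
  (recursive_const _ _)
  (recursive_comp2 recursive2_subn (recursive_const _ 1) (rec_proj _))) recursive1_id recursive1_id.
by move/recursive_eq; apply=> v /=; elim: (thead v) => //= k ->; case: odd.
Qed.

Lemma recursive1_half : recursive1 half.
Proof.
have := recursive1_comp2 (@recursive_iteri (fun=> 0%N) (fun k r _ => r + odd k)%N
  (recursive_const _ _)
  (recursive_comp2 recursive2_addn (rec_proj _)
    (recursive_comp1 recursive1_odd (rec_proj _)))) recursive1_id recursive1_id.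
move/recursive_eq; apply=> v /=; elim: (thead v) => //= k ->.
by rewrite uphalf_half addnC.
Qed.

Lemma recursive1_mu (P : nat -> nat -> bool) (exP : forall n, exists k, P k n) :
  recursive2 (fun k n => P k n : nat) ->
  recursive1 (fun n => ex_minn (exP n)).
Proof.
move=> rP; pose f (v : 2.-tuple nat) := (1 - P (tnth v ord0) (tnth v ord_max))%N.
have rf : recursive f.
  exact: recursive_comp2 recursive2_subn (recursive_const _ 1) rP.
have fE k (v : 1.-tuple nat) : f [tuple of k :: v] = (1 - P k (thead v))%N.
  by case/tupleP: v => x v; rewrite /f !(tnth_nth 0%N).
apply: rec_mu rf _ _ => v; rewrite ?fE; case: ex_minnP => m Pm mmin.
  by rewrite Pm.
by move=> k km; rewrite fE; case Pk : (P _ _) => //; have := mmin _ Pk; rewrite leqNgt km.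
Qed.

Lemma recursive1_bin2 : recursive1 (fun n => 'C(n.+1, 2)).
Proof.
have := recursive1_comp2 (@recursive_iteri (fun=> 0%N) (fun k r _ => r + k.+1)%N
  (recursive_const _ _)
  (recursive_comp2 recursive2_addn (rec_proj _)
    (recursive_comp1 rec_succ (rec_proj _)))) recursive1_id recursive1_id.
move/recursive_eq; apply=> v /=; elim: (thead v) => //= k ->.
by rewrite [RHS]binS bin1.
Qed.

Lemma recursive2_pair_code : recursive2 pair_code.
Proof.
exact: recursive_comp2 recursive2_addn
  (recursive_comp1 recursive1_bin2 recursive2_addn) (rec_proj _).
Qed.

Lemma bin2_succ n : 'C(n.+2, 2) = ('C(n.+1, 2) + n.+1)%N.
Proof. by rewrite [LHS]binS bin1. Qed.

Lemma pair_code_sum_ex n : exists s, (n < 'C(s.+2, 2))%N.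
Proof. by exists n; rewrite bin2_succ; lia. Qed.

(* Inverse of the Cantor pairing: [pair_sum (pair_code a b) = a + b]. *)
Definition pair_sum n := ex_minn (pair_code_sum_ex n).
Definition psnd n := (n - 'C((pair_sum n).+1, 2))%N.
Definition pfst n := (pair_sum n - psnd n)%N.

Lemma pair_sumE a b : pair_sum (pair_code a b) = (a + b)%N.
Proof.
rewrite /pair_sum /pair_code; case: ex_minnP => s; rewrite bin2_succ => slt smin.
have : (s <= a + b)%N by apply: smin; rewrite bin2_succ; lia.
rewrite leq_eqVlt => /orP[/eqP//|sab].
have : ('C(s.+2, 2) <= 'C((a + b).+1, 2))%N.
  rewrite -(subnK sab); elim: (_ - _)%N => // k IHk.
  by apply: leq_trans IHk _; rewrite bin2_succ leq_addr.
by rewrite bin2_succ; lia.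
Qed.

Lemma pair_codeKsnd a b : psnd (pair_code a b) = b.
Proof. by rewrite /psnd pair_sumE /pair_code addKn. Qed.

Lemma pair_codeKfst a b : pfst (pair_code a b) = a.
Proof. by rewrite /pfst pair_codeKsnd pair_sumE addnK. Qed.

Lemma recursive1_pair_sum : recursive1 pair_sum.
Proof.
apply: recursive1_mu.
apply: recursive_comp2 recursive2_leq _ _.
  exact: recursive_comp1 rec_succ (rec_proj _).
exact: recursive_comp1 recursive1_bin2 (recursive_comp1 rec_succ (rec_proj _)).
Qed.

Lemma recursive1_psnd : recursive1 psnd.
Proof.
apply: recursive1_comp2 recursive2_subn recursive1_id _.
exact: recursive1_comp recursive1_bin2 recursive1_pair_sum.
Qed.

Lemma recursive1_pfst : recursive1 pfst.
Proof.
exact: recursive1_comp2 recursive2_subn recursive1_pair_sum recursive1_psnd.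
Qed.

Lemma pair_code_gefst a b : (a <= pair_code a b)%N.
Proof. by case: a => [|a]; rewrite ?leq0n// /pair_code addSn bin2_succ; lia. Qed.

Lemma pair_code_gesnd a b : (b <= pair_code a b)%N.
Proof. by rewrite /pair_code leq_addl. Qed.

Lemma recursive1_curry h :
  recursive2 h -> recursive1 (fun n => h (pfst n) (psnd n)).
Proof.
by move=> rh; exact: recursive1_comp2 rh recursive1_pfst recursive1_psnd.
Qed.

Lemma recursive2_uncurry f :
  recursive1 f -> recursive2 (fun m n => f (pair_code m n)).
Proof. by move=> rf; exact: recursive_comp1 rf recursive2_pair_code. Qed.

(** * Computability with respect to encodings *)

Class coded (T : Type) := code : T -> nat.

#[local] Instance coded_nat : coded nat := id.
#[local] Instance coded_bool : coded bool := nat_of_bool.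
#[local] Instance coded_int : coded int := int_code.
#[local] Instance coded_rat : coded rat := rat_code.
#[local] Instance coded_pair T U (cT : coded T) (cU : coded U) : coded (T * U) :=
  fun x => pair_code (code x.1) (code x.2).
#[local] Instance coded_gauss : coded rat[i] :=
  fun c => pair_code (code (complex.Re c)) (code (complex.Im c)).
#[local] Instance coded_starpoly : coded (starpoly nat) := poly_code.

(* The realizer [g] is arbitrary outside the range of the encoding of [T]. *)
Definition computable (T U : Type) {cT : coded T} {cU : coded U} (f : T -> U) :=
  exists2 g, recursive1 g & forall x, g (code x) = code (f x).

Section Computable.
Variables (E T U V : Type) (cE : coded E) (cT : coded T) (cU : coded U)
  (cV : coded V).

Lemma computable_id : computable (fun x : T => x).
Proof. by exists id => //; exact: recursive1_id. Qed.

Lemma computable_const (y : U) : computable (fun _ : T => y).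
Proof. by exists (fun=> code y) => //; exact: recursive1_const. Qed.

Lemma computable_comp (g : T -> U) (f : E -> T) :
  computable g -> computable f -> computable (fun e => g (f e)).
Proof.
move=> [g' rg gE] [f' rf fE]; exists (fun n => g' (f' n)).
  exact: recursive1_comp.
by move=> x; rewrite fE gE.
Qed.

Lemma computable_pair (f : E -> T) (g : E -> U) :
  computable f -> computable g -> computable (fun e => (f e, g e)).
Proof.
move=> [f' rf fE] [g' rg gE]; exists (fun n => pair_code (f' n) (g' n)).
  exact: recursive1_comp2 recursive2_pair_code _ _.
by move=> x; rewrite fE gE.
Qed.

Lemma computable_fst (f : E -> T * U) :
  computable f -> computable (fun e => (f e).1).
Proof.
move=> [f' rf fE]; exists (fun n => pfst (f' n)).
  exact: recursive1_comp recursive1_pfst _.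
by move=> x; rewrite fE pair_codeKfst.
Qed.

Lemma computable_snd (f : E -> T * U) :
  computable f -> computable (fun e => (f e).2).
Proof.
move=> [f' rf fE]; exists (fun n => psnd (f' n)).
  exact: recursive1_comp recursive1_psnd _.
by move=> x; rewrite fE pair_codeKsnd.
Qed.

End Computable.

Section ComputableOperators.
Variables (E T U V : Type) (cE : coded E) (cT : coded T) (cU : coded U)
  (cV : coded V).

Lemma computable_comp2 (h : T -> U -> V) (f : E -> T) (g : E -> U) :
  computable (fun p => h p.1 p.2) -> computable f -> computable g ->
  computable (fun e => h (f e) (g e)).
Proof.
by move=> ch cf cg; exact: computable_comp ch (computable_pair cf cg).
Qed.

End ComputableOperators.

Section ComputableConstructions.
Variables (E T U V : Type) (cE : coded E) (cT : coded T) (cU : coded U)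
  (cV : coded V).

Lemma computable_nat1 h (f : E -> nat) :
  recursive1 h -> computable f -> computable (fun e => h (f e)).
Proof. by move=> rh; apply: computable_comp; exists h. Qed.

Lemma computable_nat2 h (f g : E -> nat) : recursive2 h ->
  computable f -> computable g -> computable (fun e => h (f e) (g e)).
Proof.
move=> rh; apply: computable_comp2; exists (fun n => h (pfst n) (psnd n)).
  exact: recursive1_curry rh.
by move=> [a b]; rewrite pair_codeKfst pair_codeKsnd.
Qed.

Lemma computable_code (f : E -> T) : computable f -> computable (fun e => code (f e)).
Proof. by []. Qed.

Lemma computable_if (b : E -> bool) (f g : E -> T) :
  computable b -> computable f -> computable g ->
  computable (fun e => if b e then f e else g e).
Proof.
move=> [b' rb bE] [f' rf fE] [g' rg gE].
exists (fun n => b' n * f' n + (1 - b' n) * g' n)%N.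
  apply: recursive1_comp2 recursive2_addn _ _;
    apply: recursive1_comp2 recursive2_muln _ _ => //.
  exact: recursive1_comp2 recursive2_subn (recursive1_const _) _.
move=> x; rewrite bE fE gE; case: (b x) => /=.
  by rewrite mul1n mul0n addn0.
by rewrite mul0n mul1n.
Qed.

Lemma computable_iter (F : T -> T) (n : E -> nat) (f : E -> T) :
  computable F -> computable n -> computable f ->
  computable (fun e => iter (n e) F (f e)).
Proof.
move=> [F' rF FE]; apply: (computable_comp2 (h := fun k x => iter k F x)).
exists (fun m => iteri (pfst m) (fun _ r => F' r) (psnd m)).
  apply: (recursive1_curry (@recursive_iteri id (fun _ r _ => F' r) recursive1_id _)).
  exact: recursive_comp1 rF (rec_proj _).
move=> [k x]; rewrite pair_codeKfst pair_codeKsnd /=.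
by rewrite [code k]/code /coded_nat; elim: k => //= k ->.
Qed.

Lemma computable_mu (dec : nat -> T) (P : nat -> T -> bool)
    (exP : forall x, exists k, P k x) :
  computable dec -> cancel code dec -> computable (fun p => P p.1 p.2) ->
  computable (fun x => ex_minn (exP x)).
Proof.
move=> [d rd dE] decK [p rp pE].
exists (fun n => ex_minn (exP (dec n))); last by move=> x; rewrite decK.
apply: (@recursive1_mu (fun k n => P k (dec n))).
have := recursive_comp2 (recursive2_uncurry rp) (@rec_proj 2 ord0)
  (recursive_comp1 rd (@rec_proj 2 ord_max)).
move/recursive_eq; apply=> v; rewrite (dE (tnth v ord_max)).
exact: pE (tnth v ord0, dec (tnth v ord_max)).
Qed.

End ComputableConstructions.

Section ComputableNat.
Variables (E : Type) (cE : coded E).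
Implicit Types (f g : E -> nat) (b : E -> bool).

Lemma computable_addn f g : computable f -> computable g ->
  computable (fun e => f e + g e)%N.
Proof. exact: computable_nat2 recursive2_addn. Qed.

Lemma computable_muln f g : computable f -> computable g ->
  computable (fun e => f e * g e)%N.
Proof. exact: computable_nat2 recursive2_muln. Qed.

Lemma computable_subn f g : computable f -> computable g ->
  computable (fun e => f e - g e)%N.
Proof. exact: computable_nat2 recursive2_subn. Qed.

Lemma computable_succn f : computable f -> computable (fun e => (f e).+1).
Proof. exact: computable_nat1 rec_succ. Qed.

Lemma computable_double f : computable f -> computable (fun e => (f e).*2).
Proof.
move=> cf; rewrite (_ : (fun e => _) = fun e => f e + f e)%N.
  exact: computable_addn.
by apply/funext => e; rewrite addnn.
Qed.

Lemma computable_leq f g : computable f -> computable g ->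
  computable (fun e => f e <= g e)%N.
Proof.
by move=> cf cg; have [h rh hE] := computable_nat2 recursive2_leq cf cg; exists h.
Qed.

Lemma computable_expn2 f : computable f -> computable (fun e => 2 ^ f e)%N.
Proof.
move=> cf; rewrite (_ : (fun e => _) = fun e => iter (f e) (fun k => k + k)%N 1%N).
  apply: computable_iter => //; last exact: computable_const.
  by apply: (computable_nat2 recursive2_addn); exact: computable_id.
by apply/funext => e; elim: (f e) => //= k <-; rewrite expnS mul2n addnn.
Qed.

Lemma computable_odd f : computable f -> computable (fun e => odd (f e)).
Proof.
move=> cf; have [h rh hE] := computable_nat1 recursive1_odd cf; exists h => //.
Qed.

Lemma computable_and b b' : computable b -> computable b' ->
  computable (fun e => b e && b' e).
Proof.
by move=> cb cb'; apply: computable_if => //; exact: computable_const.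
Qed.

Lemma computable_or b b' : computable b -> computable b' ->
  computable (fun e => b e || b' e).
Proof.
by move=> cb cb'; apply: computable_if => //; exact: computable_const.
Qed.

Lemma computable_eqn f g : computable f -> computable g ->
  computable (fun e => f e == g e).
Proof.
move=> cf cg; rewrite (_ : (fun e => _) = fun e => (f e <= g e) && (g e <= f e))%N.
  by apply: computable_and; exact: computable_leq.
by apply/funext => e; rewrite eqn_leq.
Qed.

Lemma computable_all (I : Type) (s : seq I) (P : I -> E -> bool) :
  (forall i, computable (P i)) -> computable (fun e => all (P^~ e) s).
Proof.
move=> cP; elim: s => /= [|i s IHs]; first exact: computable_const.
exact: computable_and.
Qed.

Lemma computable_nth (T : Type) (cT : coded T) (x0 : T) s f :
  computable f -> computable (fun e => nth x0 s (f e)).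
Proof.
elim: s f => [|x s IHs] f cf.
  rewrite (_ : (fun e => _) = fun=> x0); first exact: computable_const.
  by apply/funext => e; rewrite nth_nil.
rewrite (_ : (fun e => _) = fun e => if f e == 0 then x else nth x0 s (f e).-1)%N.
  apply: computable_if; [|exact: computable_const|].
    by apply: computable_eqn => //; exact: computable_const.
  by apply: IHs; exact: computable_nat1 recursive1_predn _.
by apply/funext => e; case: (f e).
Qed.

End ComputableNat.

(* To be extended once more operations are known to be computable. *)
Ltac computability_hook := idtac.

Ltac computability :=
  lazymatch goal with
  | |- computable (fun _ => ?c) => exact: computable_const
  | |- computable (fun e => e) => exact: computable_id
  | |- computable (fun e => (_, _)) => apply: computable_pair; computability
  | |- computable (fun e => (_).1) => apply: computable_fst; computability
  | |- computable (fun e => (_).2) => apply: computable_snd; computability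
  | |- computable (fun e => if _ then _ else _) =>
      apply: computable_if; computability
  | |- computable (fun e => _ && _) => apply: computable_and; computability
  | |- computable (fun e => _ || _) => apply: computable_or; computability
  | |- computable (fun e => (_ + _)%N) => apply: computable_addn; computability
  | |- computable (fun e => (_ * _)%N) => apply: computable_muln; computability
  | |- computable (fun e => (_ - _)%N) => apply: computable_subn; computability
  | |- computable (fun e => (_ <= _)%N) => apply: computable_leq; computability
  | |- computable (fun e => (_.*2)%N) => apply: computable_double; computability
  | |- computable (fun e => (2 ^ _)%N) => apply: computable_expn2; computability
  | |- computable (fun e => (_).+1) => apply: computable_succn; computability
  | |- computable (fun e => odd _) => apply: computable_odd; computability
  | |- computable (fun e => _ == _) => apply: computable_eqn; computability
  | |- computable fst => apply: computable_fst; exact: computable_id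
  | |- computable snd => apply: computable_snd; exact: computable_id
  | |- _ => computability_hook
  end.

Definition nat2_decode n := (pfst n, psnd n).

Lemma nat2_codeK : cancel code nat2_decode.
Proof. by case=> a b; rewrite /nat2_decode pair_codeKfst pair_codeKsnd. Qed.

Lemma computable_nat2_decode : computable nat2_decode.
Proof.
apply: computable_pair; first by exists pfst => //; exact: recursive1_pfst.
by exists psnd => //; exact: recursive1_psnd.
Qed.

Lemma computable_divn : computable (fun p : nat * nat => p.1 %/ p.2)%N.
Proof.
have ex (p : nat * nat) : exists k, (p.2 == 0) || (p.1 < k.+1 * p.2)%N.
  by exists p.1; case: p => m [|d]//=; exact: leq_pmulr.
rewrite (_ : (fun p => _) = fun p => ex_minn (ex p)).
  have := @computable_mu _ _ nat2_decode _ ex computable_nat2_decode nat2_codeK; apply.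
  by computability.
apply/funext => -[m d]/=; case: ex_minnP => k; case: d => [|d] /=.
  by move=> _ /(_ 0%N isT); case: k.
rewrite -ltn_divLR// ltnS => mk kmin; apply/eqP; rewrite eqn_leq mk/=.
by apply: kmin; rewrite -ltn_divLR.
Qed.

Local Open Scope ring_scope.

Lemma computable_realizer E T (cE : coded E) (cT : coded T) (f : E -> T)
  (h : E -> nat) : computable h -> (forall e, h e = code (f e)) -> computable f.
Proof.
by move=> [h' rh hE] hf; exists h' => // x; rewrite hE -hf.
Qed.

Definition zpos (z : int) : nat := if z is Posz n then n else 0%N.
Definition zneg (z : int) : nat := if z is Negz n then n.+1 else 0%N.

Lemma zposneg (z : int) : z = (zpos z)%:Z - (zneg z)%:Z :> int.
Proof. by case: z => n /=; rewrite ?subr0 ?sub0r ?NegzE. Qed.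

Section ComputableInt.
Variables (E : Type) (cE : coded E).
Implicit Types f g : E -> int.

Lemma computable_half (f : E -> nat) : computable f -> computable (fun e => (f e)./2).
Proof. exact: computable_nat1 recursive1_half. Qed.

Lemma computable_zpos f : computable f -> computable (fun e => zpos (f e)).
Proof.
move=> cf; apply: (@computable_realizer _ _ _ _ _
  (fun e => if odd (code (f e)) then 0 else (code (f e))./2)%N).
  computability; last apply: computable_half; exact: computable_code.
by move=> e; case: (f e) => n; rewrite /code/= odd_double ?doubleK.
Qed.

Lemma computable_zneg f : computable f -> computable (fun e => zneg (f e)).
Proof.
move=> cf; apply: (@computable_realizer _ _ _ _ _
  (fun e => if odd (code (f e)) then (code (f e))./2.+1 else 0)%N).
  computability; last apply: computable_half; exact: computable_code.
by move=> e; case: (f e) => n; rewrite /code/= odd_double ?uphalf_double.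
Qed.

Lemma computable_subz (f g : E -> nat) : computable f -> computable g ->
  computable (fun e => (f e)%:Z - (g e)%:Z : int).
Proof.
move=> cf cg; apply: (@computable_realizer _ _ _ _ _ (fun e =>
  if g e <= f e then (f e - g e).*2 else (g e - (f e).+1).*2.+1)%N).
  by computability.
move=> e; case: leqP => fg; first by rewrite subzn.
suff -> : (f e)%:Z - (g e)%:Z = Negz (g e - (f e).+1) :> int by [].
by rewrite NegzE -subSn// subSS -subzn 1?ltnW// opprB.
Qed.

Lemma computable_addz f g : computable f -> computable g ->
  computable (fun e => f e + g e : int).
Proof.
move=> cf cg; rewrite (_ : (fun e => _) = fun e =>
  (zpos (f e) + zpos (g e))%N%:Z - (zneg (f e) + zneg (g e))%N%:Z).
  by apply: computable_subz; computability;
    do ?[exact: computable_zpos|exact: computable_zneg].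
by apply/funext => e; rewrite [f e in LHS]zposneg [g e in LHS]zposneg !PoszD; ring.
Qed.

Lemma computable_mulz f g : computable f -> computable g ->
  computable (fun e => f e * g e : int).
Proof.
move=> cf cg; rewrite (_ : (fun e => _) = fun e =>
  (zpos (f e) * zpos (g e) + zneg (f e) * zneg (g e))%N%:Z -
  (zneg (f e) * zpos (g e) + zpos (f e) * zneg (g e))%N%:Z).
  by apply: computable_subz; computability;
    do ?[exact: computable_zpos|exact: computable_zneg].
by apply/funext => e; rewrite [f e in LHS]zposneg [g e in LHS]zposneg !PoszD !PoszM; ring.
Qed.

Lemma computable_oppz f : computable f -> computable (fun e => - f e : int).
Proof.
move=> cf; rewrite (_ : (fun e => _) = fun e => (zneg (f e))%:Z - (zpos (f e))%:Z).
  by apply: computable_subz; [exact: computable_zneg|exact: computable_zpos].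
by apply/funext => e; rewrite [f e in LHS]zposneg opprB.
Qed.

Lemma computable_posz (f : E -> nat) : computable f ->
  computable (fun e => (f e)%:Z).
Proof.
by move=> cf; apply: (computable_realizer (computable_double cf)) => e.
Qed.

Lemma computable_absz f : computable f -> computable (fun e => `|f e|%N).
Proof.
move=> cf; rewrite (_ : (fun e => _) = fun e => zpos (f e) + zneg (f e))%N.
  by computability; [exact: computable_zpos|exact: computable_zneg].
by apply/funext => e; case: (f e) => n /=; rewrite ?addn0.
Qed.

Lemma computable_ge0z f : computable f -> computable (fun e => 0 <= f e :> int).
Proof.
move=> cf; rewrite (_ : (fun e => _) = fun e => zneg (f e) == 0%N).
  by computability; exact: computable_zneg.
by apply/funext => e; case: (f e).
Qed.

End ComputableInt.

Lemma computable_dvdn E (cE : coded E) (f g : E -> nat) :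
  computable f -> computable g -> computable (fun e => f e %| g e)%N.
Proof.
move=> cf cg; rewrite (_ : (fun e => _) = fun e => g e %/ f e * f e == g e)%N.
  computability => //.
  exact: (computable_comp2 (h := divn) computable_divn).
by apply/funext => e; rewrite dvdn_eq.
Qed.

Lemma denq_frac (a d : nat) : (0 < d)%N ->
  forall k, (d %| a * k)%N = (`|denq (a%:Q / d%:Q)|%N %| k)%N.
Proof.
move=> d0 k; set q := (_ / _)%R.
have dn0 : d%:Q != 0 by rewrite intr_eq0 -lt0n.
have qE : numq q * d%:Z = a%:Z * denq q.
  apply: (@intr_inj rat); rewrite !rmorphM/= [in LHS]numqE /q.
  by rewrite mulrAC divfK.
have qEn : (`|numq q| * d = a * `|denq q|)%N.
  by rewrite -[d in LHS]/(`|d%:Z|%N) -abszM qE abszM.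
have den0 : (0 < `|denq q|)%N by rewrite absz_gt0 denq_neq0.
rewrite -(@dvdn_pmul2r `|denq q|)// mulnAC -qEn.
rewrite mulnAC [(d * _)%N]mulnC dvdn_pmul2r// Gauss_dvdr//.
by rewrite coprime_sym coprime_num_den.
Qed.

(* The least such [k] is the reduced denominator of [p.1 / p.2]. *)
Definition frac_den (p : nat * nat) k :=
  (0 < k)%N && ((p.2 == 0) || (p.2 %| p.1 * k))%N.

Lemma frac_den_ex p : exists k, frac_den p k.
Proof.
case: p => a [|d]; first by exists 1%N.
by exists d.+1; rewrite /frac_den/= dvdn_mull.
Qed.

Lemma frac_denE a d : (0 < d)%N ->
  ex_minn (frac_den_ex (a, d)) = `|denq (a%:Q / d%:Q)|%N.
Proof.
move=> d0; case: ex_minnP => k; rewrite /frac_den/= (gtn_eqF d0)/= => /andP[k0].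
rewrite denq_frac// => dk kmin; apply/eqP.
rewrite eqn_leq [X in _ && X]dvdn_leq// andbT; apply: kmin.
by rewrite absz_gt0 denq_neq0/= denq_frac.
Qed.

Lemma computable_frac_den : computable (fun p => ex_minn (frac_den_ex p)).
Proof.
have := @computable_mu _ _ nat2_decode _ frac_den_ex computable_nat2_decode nat2_codeK; apply.
rewrite /frac_den; computability; apply: computable_dvdn; by computability.
Qed.

Section ComputableRat.
Variables (E : Type) (cE : coded E).
Implicit Types f g : E -> rat.

Lemma computable_numq f : computable f -> computable (fun e => numq (f e)).
Proof.
move=> [f' rf fE]; exists (fun n => pfst (f' n)).
  exact: recursive1_comp recursive1_pfst _.
by move=> x; rewrite fE [code (f x)]/code/= pair_codeKfst.
Qed.

Lemma computable_denq f : computable f -> computable (fun e => `|denq (f e)|%N).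
Proof.
move=> [f' rf fE]; exists (fun n => psnd (f' n)).
  exact: recursive1_comp recursive1_psnd _.
by move=> x; rewrite fE [code (f x)]/code/= pair_codeKsnd.
Qed.

Lemma computable_frac (z : E -> int) (d : E -> nat) :
  computable z -> computable d ->
  computable (fun e => (z e)%:Q / (d e)%:Q).
Proof.
move=> cz cd.
pose k e := ex_minn (frac_den_ex (`|z e|%N, d e)).
have ck : computable k.
  apply: (computable_comp computable_frac_den); computability => //.
  exact: computable_absz.
pose m e := (`|z e| * k e %/ d e)%N.
have cm : computable m.
  apply: (computable_comp2 (h := divn) computable_divn) => //.
  by computability => //; exact: computable_absz.
apply: (@computable_realizer _ _ _ _ _ (fun e => if d e == 0%N then code 0%Q else
   pair_code (code ((if 0%R <= z e then (m e)%:Z else - (m e)%:Z)%R)) (k e))%N).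
  computability => //.
  apply: (computable_nat2 recursive2_pair_code) => //.
  apply: computable_code; apply: computable_if; first exact: computable_ge0z.
    exact: computable_posz.
  by apply: computable_oppz; exact: computable_posz.
move=> e; case: eqVneq => [-> |dn0]; first by rewrite invr0 mulr0.
have d0 : (0 < d e)%N by rewrite lt0n.
have dQ0 : (d e)%:Q != 0 by rewrite intr_eq0.
set q := (z e)%:Q / _.
have kE : k e = `|denq (`|z e|%:Q / (d e)%:Q)|%N by rewrite /k frac_denE.
have num_den (a : nat) : numq (a%:Q / (d e)%:Q) = (a * `|denq (a%:Q / (d e)%:Q)|%N %/ d e)%N.
  set r := _ / _.
  have : (`|numq r|%N * d e = a * `|denq r|)%N.
    rewrite -[d e in LHS]/(`|(d e)%:Z|%N) -[a in RHS]/(`|a%:Z|%N) -!abszM; congr absz.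
    apply: (@intr_inj rat); rewrite !rmorphM/= [in LHS]numqE /r.
    by rewrite mulrAC divfK.
  move=> <-; rewrite mulnK//.
  by rewrite gez0_abs// numq_ge0 /r divr_ge0// ler0z.
rewrite [code q]/code/= /coded_rat /rat_code; congr pair_code.
  case: ifP => z0.
    congr int_code; rewrite /q -(gez0_abs z0) num_den.
    by rewrite /m kE -(gez0_abs z0).
  have z0' : z e = - (`|z e|%N)%:Z by rewrite lez0_abs ?opprK// ltW// ltNge z0.
  congr int_code; rewrite /q z0' rmorphN/= mulNr numqN num_den.
  by rewrite /m kE.
rewrite kE /q; case z0 : (0 <= z e); first by rewrite -[in RHS](gez0_abs z0).
have z0' : z e = - (`|z e|%N)%:Z by rewrite lez0_abs ?opprK// ltW// ltNge z0.
by rewrite [in RHS]z0' rmorphN/= mulNr denqN.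
Qed.

Lemma ratE (q : rat) : q = (numq q)%:Q / (`|denq q|%N)%:Q.
Proof. by rewrite gez0_abs ?denq_ge0// divq_num_den. Qed.

Lemma computable_addq f g : computable f -> computable g ->
  computable (fun e => f e + g e : rat).
Proof.
move=> cf cg; rewrite (_ : (fun e => _) = fun e =>
  (numq (f e) * (`|denq (g e)|%N)%:Z + numq (g e) * (`|denq (f e)|%N)%:Z)%:Q /
  (`|denq (f e)| * `|denq (g e)|)%N%:Q).
  apply: computable_frac; last first.
    by computability; exact: computable_denq.
  apply: computable_addz; apply: computable_mulz; do ?exact: computable_numq;
    by apply: computable_posz; exact: computable_denq.
apply/funext => e; rewrite [f e in LHS]ratE [g e in LHS]ratE addf_div; last 2 first.
- by rewrite intr_eq0 eqz_nat absz_eq0 denq_neq0.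
- by rewrite intr_eq0 eqz_nat absz_eq0 denq_neq0.
by rewrite rmorphD/= !rmorphM.
Qed.

Lemma computable_mulq f g : computable f -> computable g ->
  computable (fun e => f e * g e : rat).
Proof.
move=> cf cg; rewrite (_ : (fun e => _) = fun e =>
  (numq (f e) * numq (g e))%:Q / (`|denq (f e)| * `|denq (g e)|)%N%:Q).
  apply: computable_frac; last first.
    by computability; exact: computable_denq.
  by apply: computable_mulz; exact: computable_numq.
apply/funext => e; rewrite [f e in LHS]ratE [g e in LHS]ratE mulf_div.
by rewrite rmorphM/= PoszM rmorphM.
Qed.

Lemma computable_oppq f : computable f -> computable (fun e => - f e : rat).
Proof.
move=> cf; rewrite (_ : (fun e => _) = fun e =>
  (- numq (f e))%:Q / (`|denq (f e)|)%N%:Q).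
  apply: computable_frac; last exact: computable_denq.
  by apply: computable_oppz; exact: computable_numq.
by apply/funext => e; rewrite [f e in LHS]ratE rmorphN/= mulNr.
Qed.

Lemma computable_leq_rat f g : computable f -> computable g ->
  computable (fun e => f e <= g e :> rat).
Proof.
move=> cf cg; rewrite (_ : (fun e => _) = fun e => 0 <= numq (g e - f e)).
  apply: computable_ge0z; apply: computable_numq; apply: computable_addq => //.
  exact: computable_oppq.
by apply/funext => e; rewrite numq_ge0 subr_ge0.
Qed.

Lemma computable_invn (f : E -> nat) : computable f ->
  computable (fun e => (f e)%:R^-1 : rat).
Proof.
move=> cf; rewrite (_ : (fun e => _) = fun e => 1%:Q / (f e)%:Q).
  by apply: computable_frac => //; exact: computable_const.
by apply/funext => e; rewrite mul1r.
Qed.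

End ComputableRat.

(** * Recursion on codes *)

(* Course-of-values recursion in which the value at [n] depends on the values
   at [i n] and [j n] only, with default value [u0] if these are not below [n]. *)
Section BinaryRecursion.
Variables (E U : Type) (cE : coded E) (cU : coded U) (u0 : U).
Variables (F : E -> nat -> U -> U -> U) (i j : nat -> nat).

Let look (t : seq U) n a := if (a < n)%N then nth u0 t (n - a.+1) else u0.

Let table e n :=
  iteri n (fun k t => F e k (look t k (i k)) (look t k (j k)) :: t) [::].

Definition binrec e n :=
  let t := table e n in F e n (look t n (i n)) (look t n (j n)).

Let nth_table e n a : (a < n)%N -> nth u0 (table e n) (n - a.+1) = binrec e a.
Proof.
elim: n => // n IHn; rewrite ltnS leq_eqVlt => /orP[/eqP ->|an].
  by rewrite subnn.
by rewrite subSn//= IHn.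
Qed.

Lemma binrecE e n : binrec e n =
  F e n (if (i n < n)%N then binrec e (i n) else u0)
        (if (j n < n)%N then binrec e (j n) else u0).
Proof.
by rewrite {1}/binrec /look; do 2 case: ifP => ?; rewrite ?nth_table.
Qed.

Hypothesis cF : computable (fun x : (E * nat) * (U * U) => F x.1.1 x.1.2 x.2.1 x.2.2).
Hypothesis ci : computable i.
Hypothesis cj : computable j.

Lemma computable_binrec : computable (fun x => binrec x.1 x.2).
Proof.
have [f rf fE] := cF.
pose get n r a := (if a < n then pfst (iter (n - a.+1) psnd r) else cU u0)%N.
pose step x n r := f (pair_code (pair_code x n) (pair_code (get n r (i n)) (get n r (j n)))).
pose T x n := iteri n (fun k r => pair_code (step x k r) r) 0%N.
have TS x n : T x n.+1 = pair_code (step x n (T x n)) (T x n) by [].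
have cpsnd : computable psnd by exists psnd => //; exact: recursive1_psnd.
have cpair E' (cE' : coded E') (g h : E' -> nat) : computable g ->
    computable h -> computable (fun e => pair_code (g e) (h e)).
  exact: computable_nat2 recursive2_pair_code.
have cstep : computable (fun x : nat * (nat * nat) => step x.2.2 x.1 x.2.1).
  apply: computable_nat1 rf _; apply: (cpair) => //.
    by apply: (cpair); computability.
  have cget (k : nat -> nat) : computable k ->
      computable (fun x : nat * (nat * nat) => get x.1 x.2.1 (k x.1)).
    move=> ck.
    have ck' : computable (fun e : nat * (nat * nat) => k e.1).
      by apply: (computable_comp ck); computability.
    rewrite /get; computability => //.
    apply: (computable_nat1 recursive1_pfst).
    by apply: computable_iter => //; computability.
  by apply: (cpair); exact: cget.
have cT : computable (fun x : nat * nat => T x.1 x.2).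
  have [s rs sE] := cpair _ _ _ _ cstep
    (computable_fst (computable_snd (@computable_id (nat * (nat * nat)) _))).
  have rT : recursive2 (fun n x => T x n).
    apply: (recursive_eq (@recursive_iteri (fun=> 0%N)
        (fun k r x => s (pair_code k (pair_code r x))) (recursive1_const _) _)).
      apply: recursive_comp1 rs _.
      apply: (recursive_comp2 recursive2_pair_code (rec_proj _)).
      exact: (recursive_comp2 recursive2_pair_code (rec_proj _) (rec_proj _)).
    by move=> v; apply: eq_iteri => k r; exact: (sE (k, (r, tnth v ord_max))).
  exists (fun n => T (pfst n) (psnd n)) => [|[x n]].
    exact: recursive1_curry (recursive2_swap rT).
  by rewrite pair_codeKfst pair_codeKsnd.
have cG : computable (fun x : nat * nat => step x.1 x.2 (T x.1 x.2)).
  apply: (computable_comp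
    (g := fun x : nat * (nat * nat) => step x.2.2 x.1 x.2.1)
    (f := fun x : nat * nat => (x.2, (T x.1 x.2, x.1))) cstep).
  by computability.
have TE e n a : (a < n)%N -> pfst (iter (n - a.+1) psnd (T (code e) n)) = code (binrec e a).
  elim/ltn_ind: n a => n IHn a an.
  have stepE m : (m < n)%N -> step (code e) m (T (code e) m) = code (binrec e m).
    move=> mn; rewrite binrecE /step.
    have getE k : get m (T (code e) m) k = code (if k < m then binrec e k else u0)%N.
      by rewrite /get; case: ifP => // km; rewrite IHn.
    by rewrite !getE; exact: (fE ((e, m), (_, _))).
  move: an stepE; case: n {IHn} => // n; rewrite ltnS => an stepE.
  rewrite subSS; move: an; elim: (n) stepE => [|m IHm] stepE.
    rewrite leqn0 => /eqP ->; rewrite TS; apply: etrans (pair_codeKfst _ _) _; exact: stepE.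
  rewrite leq_eqVlt => /orP[/eqP ->|am].
    rewrite subnn TS; apply: etrans (pair_codeKfst _ _) _; exact: stepE.
  rewrite ltnS in am; rewrite subSn// iterSr TS pair_codeKsnd.
  apply: IHm => // k km; exact/stepE/ltnW.
have [g rg gE] := cG; exists g => // -[e n]; rewrite [RHS]/=.
have getE k : get n (T (code e) n) k = code (if k < n then binrec e k else u0)%N.
  by rewrite /get; case: ifP => // kn; rewrite TE.
rewrite [LHS](gE (code e, n)) binrecE /= /step !getE.
exact: (fE ((e, n), (_, _))).
Qed.

End BinaryRecursion.

Section Decoding.
Variables (E : Type) (cE : coded E).

Lemma computable_pfst (f : E -> nat) : computable f -> computable (fun e => pfst (f e)).
Proof. exact: computable_nat1 recursive1_pfst. Qed.

Lemma computable_psnd (f : E -> nat) : computable f -> computable (fun e => psnd (f e)).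
Proof. exact: computable_nat1 recursive1_psnd. Qed.

Lemma computable_pair_code (f g : E -> nat) : computable f -> computable g ->
  computable (fun e => pair_code (f e) (g e)).
Proof. exact: computable_nat2 recursive2_pair_code. Qed.

Lemma computable_gauss (f g : E -> rat) : computable f -> computable g ->
  computable (fun e => (f e +i* g e)%C).
Proof.
by move=> cf cg; apply: (computable_realizer (computable_pair_code cf cg)).
Qed.

Lemma computable_Re (f : E -> rat[i]) : computable f ->
  computable (fun e => complex.Re (f e)).
Proof.
move=> cf; apply: (@computable_realizer _ _ _ _ _ (fun e => pfst (code (f e)))).
  exact: computable_pfst.
by move=> e; rewrite pair_codeKfst.
Qed.

Lemma computable_Im (f : E -> rat[i]) : computable f ->
  computable (fun e => complex.Im (f e)).
Proof.
move=> cf; apply: (@computable_realizer _ _ _ _ _ (fun e => psnd (code (f e)))).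
  exact: computable_psnd.
by move=> e; rewrite pair_codeKsnd.
Qed.

Definition int_decode n : int := if odd n then - (n./2.+1)%:Z else (n./2)%:Z.

Lemma int_codeK : cancel int_code int_decode.
Proof.
by case=> n; rewrite /int_decode /= odd_double ?doubleK //= uphalf_double NegzE.
Qed.

Lemma computable_int_decode (f : E -> nat) : computable f ->
  computable (fun e => int_decode (f e)).
Proof.
move=> cf; rewrite /int_decode; computability => //.
  apply: computable_oppz; apply: computable_posz; computability.
  exact: computable_half.
by apply: computable_posz; exact: computable_half.
Qed.

Definition rat_decode n : rat := (int_decode (pfst n))%:Q / (psnd n)%:Q.

Lemma rat_codeK : cancel rat_code rat_decode.
Proof.
move=> q; rewrite /rat_decode /rat_code pair_codeKfst pair_codeKsnd int_codeK.
by rewrite -ratE.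
Qed.

Lemma computable_rat_decode (f : E -> nat) : computable f ->
  computable (fun e => rat_decode (f e)).
Proof.
move=> cf; apply: computable_frac; last exact: computable_psnd.
by apply: computable_int_decode; exact: computable_pfst.
Qed.

Definition gauss_decode n : rat[i] :=
  (rat_decode (pfst n) +i* rat_decode (psnd n))%C.

Lemma gauss_codeK (c : rat[i]) : gauss_decode (code c) = c.
Proof.
rewrite /gauss_decode pair_codeKfst pair_codeKsnd !rat_codeK.
by case: c.
Qed.

Lemma computable_gauss_decode (f : E -> nat) : computable f ->
  computable (fun e => gauss_decode (f e)).
Proof.
by move=> cf; apply: computable_gauss; apply: computable_rat_decode;
  [exact: computable_pfst|exact: computable_psnd].
Qed.

Lemma computable_SConst (f : E -> rat[i]) : computable f ->
  computable (fun e => SConst (f e) : starpoly nat).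
Proof.
move=> cf; apply: (@computable_realizer _ _ _ _ _ (fun e => pair_code 0 (code (f e)))) => //.
by apply: computable_pair_code => //; exact: computable_const.
Qed.

Lemma computable_SVar (f : E -> nat) : computable f ->
  computable (fun e => SVar (f e)).
Proof.
move=> cf; apply: (@computable_realizer _ _ _ _ _ (fun e => pair_code 1 (f e))) => //.
by apply: computable_pair_code => //; exact: computable_const.
Qed.

Lemma computable_SAdd (f g : E -> starpoly nat) : computable f -> computable g ->
  computable (fun e => SAdd (f e) (g e)).
Proof.
move=> cf cg; apply: (@computable_realizer _ _ _ _ _
  (fun e => pair_code 2 (pair_code (code (f e)) (code (g e))))) => //.
apply: computable_pair_code; first exact: computable_const.
exact: computable_pair_code.
Qed.

Lemma computable_SMul (f g : E -> starpoly nat) : computable f -> computable g ->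
  computable (fun e => SMul (f e) (g e)).
Proof.
move=> cf cg; apply: (@computable_realizer _ _ _ _ _
  (fun e => pair_code 3 (pair_code (code (f e)) (code (g e))))) => //.
apply: computable_pair_code; first exact: computable_const.
exact: computable_pair_code.
Qed.

Lemma computable_SStar (f : E -> starpoly nat) : computable f ->
  computable (fun e => SStar (f e)).
Proof.
move=> cf; apply: (@computable_realizer _ _ _ _ _ (fun e => pair_code 4 (code (f e)))) => //.
by apply: computable_pair_code => //; exact: computable_const.
Qed.

End Decoding.

Fixpoint starpoly_fold (V U : Type) (fc : rat[i] -> U) (fv : V -> U)
    (fa fm : U -> U -> U) (fs : U -> U) (p : starpoly V) : U :=
  match p with
  | SConst c => fc c
  | SVar v => fv v
  | SAdd p q => fa (starpoly_fold fc fv fa fm fs p) (starpoly_fold fc fv fa fm fs q)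
  | SMul p q => fm (starpoly_fold fc fv fa fm fs p) (starpoly_fold fc fv fa fm fs q)
  | SStar p => fs (starpoly_fold fc fv fa fm fs p)
  end.

Lemma pair_code_ltsnd k n : (n < pair_code k.+1 n)%N.
Proof. by rewrite /pair_code addSn bin2_succ; lia. Qed.

Section Fold.
Variables (E U : Type) (cE : coded E) (cU : coded U) (u0 : U).
Variables (fc : rat[i] -> U) (fv : E -> nat -> U) (fa fm : U -> U -> U) (fs : U -> U).

Let fold_step (e : E) (n : nat) (u v : U) :=
  if pfst n == 0%N then fc (gauss_decode (psnd n)) else
  if pfst n == 1%N then fv e (psnd n) else
  if pfst n == 2%N then fa u v else
  if pfst n == 3%N then fm u v else
  if pfst n == 4%N then fs u else u0.

Let left n := if pfst n == 4%N then psnd n else pfst (psnd n).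
Let right n := psnd (psnd n).

Definition code_fold := binrec u0 fold_step left right.

Lemma code_foldE e p :
  code_fold e (poly_code p) = starpoly_fold fc (fv e) fa fm fs p.
Proof.
elim: p => [c|n|p IHp q IHq|p IHp q IHq|p IHp];
  rewrite /code_fold binrecE /fold_step /left /right pair_codeKfst /= !pair_codeKsnd.
- by rewrite gauss_codeK.
- by [].
- rewrite pair_codeKfst !ifT//.
  + by rewrite [X in fa X]IHp [X in fa _ X]IHq.
  + exact: leq_ltn_trans (pair_code_gesnd _ _) (pair_code_ltsnd _ _).
  + exact: leq_ltn_trans (pair_code_gefst _ _) (pair_code_ltsnd _ _).
- rewrite pair_codeKfst !ifT//.
  + by rewrite [X in fm X]IHp [X in fm _ X]IHq.
  + exact: leq_ltn_trans (pair_code_gesnd _ _) (pair_code_ltsnd _ _).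
  + exact: leq_ltn_trans (pair_code_gefst _ _) (pair_code_ltsnd _ _).
- by rewrite pair_code_ltsnd [X in fs X]IHp.
Qed.

Hypothesis cfc : computable fc.
Hypothesis cfv : computable (fun x => fv x.1 x.2).
Hypothesis cfa : computable (fun x => fa x.1 x.2).
Hypothesis cfm : computable (fun x => fm x.1 x.2).
Hypothesis cfs : computable fs.

Lemma computable_code_fold : computable (fun x => code_fold x.1 x.2).
Proof.
apply: computable_binrec.
- rewrite /fold_step; computability; do ?by apply: computable_pfst; computability.
  + apply: (computable_comp cfc); apply: computable_gauss_decode.
    by apply: computable_psnd; computability.
  + apply: (computable_comp2 cfv); first by computability.
    by apply: computable_psnd; computability.
  + by apply: (computable_comp2 cfa); computability.
  + by apply: (computable_comp2 cfm); computability.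
  + by apply: (computable_comp cfs); computability.
- rewrite /left; computability; do ?apply: computable_pfst;
    do ?apply: computable_psnd; by computability.
- by rewrite /right; do ?apply: computable_psnd; computability.
Qed.

Lemma computable_fold (f : E -> starpoly nat) : computable f ->
  computable (fun e => starpoly_fold fc (fv e) fa fm fs (f e)).
Proof.
move=> cf; rewrite (_ : (fun e => _) = fun e => code_fold e (code (f e))).
  by apply: (computable_comp2 computable_code_fold); [exact: computable_id|].
by apply/funext => e; rewrite code_foldE.
Qed.

End Fold.

Definition starpoly_decode : nat -> starpoly nat :=
  code_fold (SConst 0) SConst (fun _ : nat => @SVar nat) (@SAdd _) (@SMul _) (@SStar _) 0%N.

Lemma poly_codeK : cancel poly_code starpoly_decode.
Proof.
move=> p; rewrite /starpoly_decode code_foldE.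
by elim: p => //= [p -> q ->|p -> q ->|p ->].
Qed.

Lemma computable_starpoly_decode E (cE : coded E) (f : E -> nat) :
  computable f -> computable (fun e => starpoly_decode (f e)).
Proof.
move=> cf; apply: (computable_comp2 (h := code_fold _ _ _ _ _ _)) => //.
  apply: computable_code_fold.
  - by apply: computable_SConst; exact: computable_id.
  - by apply: computable_SVar; computability.
  - by apply: computable_SAdd; computability.
  - by apply: computable_SMul; computability.
  - by apply: computable_SStar; computability.
exact: computable_const.
Qed.

Definition starpoly_subst (V W : Type) (s : V -> starpoly W) : starpoly V -> starpoly W :=
  starpoly_fold SConst s (@SAdd _) (@SMul _) (@SStar _).

(* [t] codes a sequence by iterated pairing. *)
Definition tget (t n : nat) : starpoly nat :=
  starpoly_decode (pfst (iter n psnd t)).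

Lemma tget_ex (s : nat -> starpoly nat) m :
  exists t, forall n, (n < m)%N -> tget t n = s n.
Proof.
elim: m s => [|m IHm] s; first by exists 0%N.
have [t tE] := IHm (fun n => s n.+1).
exists (pair_code (poly_code (s 0%N)) t) => -[|n] nm.
  by rewrite /tget pair_codeKfst poly_codeK.
by rewrite /tget iterSr pair_codeKsnd; exact: tE.
Qed.

Lemma computable_tget E (cE : coded E) (t n : E -> nat) :
  computable t -> computable n -> computable (fun e => tget (t e) (n e)).
Proof.
move=> ct cn; apply: computable_starpoly_decode; apply: computable_pfst.
apply: computable_iter => //.
by exists psnd => //; exact: recursive1_psnd.
Qed.

Lemma computable_subst E (cE : coded E) (s : E -> nat -> starpoly nat)
    (p : E -> starpoly nat) :
  computable (fun x => s x.1 x.2) -> computable p ->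
  computable (fun e => starpoly_subst (s e) (p e)).
Proof.
move=> cs cp; apply: computable_fold => //; first exact: (SConst 0).
- by apply: computable_SConst; exact: computable_id.
- by apply: computable_SAdd; computability.
- by apply: computable_SMul; computability.
- by apply: computable_SStar; computability.
Qed.

(* The derivation [(pair_code w (pair_code i j)).+1] applies the rule [w] to the
   results of the derivations [i] and [j]. *)
Lemma computable_closure (U : Type) (cU : coded U) (u0 : U) (F : nat -> U -> U -> U) :
  computable (fun x => F x.1 x.2.1 x.2.2) ->
  exists e : nat -> U, [/\ computable e, e 0%N = u0,
    (forall w i j, exists n, e n = F w (e i) (e j)) &
    forall P : U -> Prop, P u0 -> (forall w x y, P x -> P y -> P (F w x y)) ->
      forall n, P (e n)].
Proof.
move=> cF.
pose F' (_ n : nat) u v := if n == 0%N then u0 else F (pfst n.-1) u v.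
pose i n := pfst (psnd n.-1); pose j n := psnd (psnd n.-1).
have cpred : computable predn by exists predn => //; exact: recursive1_predn.
exists (binrec u0 F' i j 0%N); split.
- apply: (computable_comp2 (h := binrec u0 F' i j)).
  + apply: computable_binrec.
    * rewrite /F'; computability.
      apply: (computable_comp (g := fun x => F x.1 x.2.1 x.2.2)
        (f := fun e : nat * nat * (U * U) => (pfst e.1.2.-1, (e.2.1, e.2.2))) cF).
      computability; apply: computable_pfst; apply: (computable_comp cpred).
      by computability.
    * by apply: computable_pfst; apply: computable_psnd.
    * by apply: computable_psnd; apply: computable_psnd.
  + exact: computable_const.
  + exact: computable_id.
- by rewrite binrecE.
- move=> w a b; exists (pair_code w (pair_code a b)).+1.
  rewrite binrecE /F' /i /j /= !pair_codeKsnd !pair_codeKfst !ifT// ltnS.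
    exact: leq_trans (pair_code_gesnd _ _) (pair_code_gesnd _ _).
  exact: leq_trans (pair_code_gefst _ _) (pair_code_gesnd _ _).
- move=> P P0 PF; elim/ltn_ind => n IHn; rewrite binrecE /F'.
  by case: eqP => // _; apply: PF; case: ifP => // ?; exact: IHn.
Qed.

(** * C*-algebras *)

Local Open Scope classical_set_scope.
Local Open Scope quotient_scope.

Section CstarBasics.
Variables (R : realType) (A : cstarType R).
Implicit Types x y z : A.

Definition nrm x : R := complex.Re `|x|.

Lemma nrmE x : (nrm x)%:C%C = `|x|.
Proof. by apply: RRe_real; rewrite normr_real. Qed.

Lemma nrm_ge0 x : 0 <= nrm x.
Proof. by rewrite -lecR nrmE normr_ge0. Qed.

Lemma nrm0 : nrm 0 = 0.
Proof. by rewrite /nrm normr0. Qed.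

Lemma nrm_eq0 x : nrm x = 0 -> x = 0.
Proof. by move=> x0; apply/normr0_eq0; rewrite -nrmE x0. Qed.

Lemma nrmD x y : nrm (x + y) <= nrm x + nrm y.
Proof. by rewrite -lecR rmorphD/= !nrmE ler_normD. Qed.

Lemma nrmN x : nrm (- x) = nrm x.
Proof. by rewrite /nrm normrN. Qed.

Lemma nrmB x y : nrm (x - y) = nrm (y - x).
Proof. by rewrite -nrmN opprB. Qed.

Lemma nrm_triangle z x y : nrm (x - y) <= nrm (x - z) + nrm (z - y).
Proof. by apply: le_trans (nrmD _ _); rewrite subrKA. Qed.

Lemma nrmM x y : nrm (x ** y) <= nrm x * nrm y.
Proof. by rewrite -lecR rmorphM/= !nrmE cmul_norm. Qed.

Lemma normcE (c : R[i]) : (Normc.normc c)%:C%C = `|c|.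
Proof. by []. Qed.

Lemma normc_real (r : R) : Normc.normc r%:C%C = `|r|.
Proof. by rewrite /= expr0n addr0 sqrtr_sqr. Qed.

Lemma nrmZ c x : nrm (c *: x) = Normc.normc c * nrm x.
Proof.
by apply: (@complexI R); rewrite rmorphM/= !nrmE normcE normrZ.
Qed.

Lemma nrm_cstar x : nrm (star x ** x) = nrm x ^+ 2.
Proof. by apply: (@complexI R); rewrite rmorphXn/= !nrmE cstar_identity. Qed.

Lemma cmulNl x y : (- x) ** y = - (x ** y).
Proof. by rewrite -scaleN1r cmulZl scaleN1r. Qed.

Lemma cmulNr x y : x ** (- y) = - (x ** y).
Proof. by rewrite -scaleN1r cmulZr scaleN1r. Qed.

Lemma cmulBl x y z : (x - y) ** z = x ** z - y ** z.
Proof. by rewrite cmulDl cmulNl. Qed.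

Lemma cmulBr x y z : x ** (y - z) = x ** y - x ** z.
Proof. by rewrite cmulDr cmulNr. Qed.

Lemma cmul0l x : 0 ** x = 0.
Proof. by rewrite -(subrr x) cmulBl !subrr. Qed.

Lemma cmul0r x : x ** 0 = 0.
Proof. by rewrite -(subrr x) cmulBr !subrr. Qed.

Lemma starN x : star (- x) = - star x.
Proof. by rewrite -scaleN1r starZ -[RHS]scaleN1r rmorphN rmorph1. Qed.

Lemma starB x y : star (x - y) = star x - star y.
Proof. by rewrite starD starN. Qed.

Lemma star0 : star (0 : A) = 0.
Proof. by rewrite -(subrr (0 : A)) starB !subrr. Qed.

Lemma star_one : star cone = cone :> A.
Proof. by rewrite -[LHS]cmul1x -{1}[cone]starK -starM cmul1x starK. Qed.

Lemma nrm_star x : nrm (star x) = nrm x.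
Proof.
suff le z : nrm z <= nrm (star z).
  by apply/eqP; rewrite eq_le le andbT -{2}(starK x) le.
have [->|z0] := eqVneq (nrm z) 0; first exact: nrm_ge0.
have zp : 0 < nrm z by rewrite lt_neqAle eq_sym z0 nrm_ge0.
by rewrite -(ler_pM2r zp) -expr2 -nrm_cstar nrmM.
Qed.

Lemma nrm_one : nrm cone = 1.
Proof.
have n0 : nrm cone != 0 by apply/eqP => /nrm_eq0; exact: cone_neq0.
by apply: (mulfI n0); rewrite mulr1 -expr2 -nrm_cstar star_one cmul1x.
Qed.

Lemma nrm_small_eq0 x : (forall e, 0 < e -> nrm x < e) -> x = 0.
Proof.
move=> xe; apply: nrm_eq0; apply/eqP; rewrite eq_le nrm_ge0 andbT.
by rewrite leNgt; apply/negP => /xe; rewrite ltxx.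
Qed.

Lemma cauchy_limit (u : nat -> A) :
  (forall e, 0 < e -> exists N, forall m n, (N <= m)%N -> (N <= n)%N ->
    nrm (u m - u n) < e) ->
  exists l, forall e, 0 < e -> exists N, forall n, (N <= n)%N ->
    nrm (u n - l) < e.
Proof.
move=> uc.
have /cauchy_cvgP/cvg_ex[l ul] : cauchy (u @ \oo).
  apply/cauchy_exP => e e0.
  have ee : e = (complex.Re e)%:C%C by rewrite RRe_real// gtr0_real.
  have /uc[N uN] : 0 < complex.Re e by rewrite -ltcR -ee.
  exists (u N); exists N => // n /= Nn.
  by rewrite -ball_normE /= -nrmE ee ltcR; exact: uN.
exists l => e e0; have e0' : 0 < e%:C%C by rewrite ltcR.
have /cvgrPdist_lt/(_ _ e0')[N _ uN] := ul.
by exists N => n /uN /=; rewrite -nrmE ltcR nrmB.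
Qed.

End CstarBasics.

Lemma expr_small (R : realType) (r e : R) : 0 <= r < 1 -> 0 < e ->
  exists N, forall n, (N <= n)%N -> r ^+ n < e.
Proof.
move=> /andP[r0 r1] e0; have := @cvg_geometric R 1 r.
rewrite ger0_norm// => /(_ r1)/cvgrPdist_lt/(_ e e0)[N _ rN].
by exists N => n /rN/=; rewrite sub0r normrN mul1r ger0_norm ?exprn_ge0.
Qed.

Section Contractive.
Variables (R : realType).

(* The fixed point [y] of [y |-> (c + y^2) / 2] gives [(1 - y)^2 = 1 - c]. *)
Lemma sqrt_fixed_point (A : cstarType R) (a c : A) : star c = c ->
  a ** c = c ** a -> nrm c < 1 ->
  exists y, [/\ star y = y, a ** y = y ** a & y + y = c + y ** y].
Proof.
move=> cs ac c1.
pose f (y : A) : A := (2^-1)%:C%C *: (c + y ** y).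
pose y n := iter n f 0.
pose r := 1 - Num.sqrt (1 - nrm c).
have c0 := nrm_ge0 c.
have s0 : 0 < Num.sqrt (1 - nrm c) by rewrite sqrtr_gt0 subr_gt0.
have s1 : Num.sqrt (1 - nrm c) <= 1 by rewrite -[leRHS]sqrtr1 ler_wsqrtr// gerBl.
have sE : Num.sqrt (1 - nrm c) ^+ 2 = 1 - nrm c by rewrite sqr_sqrtr// subr_ge0 ltW.
have r01 : 0 <= r < 1 by apply/andP; split; rewrite /r; lra.
have [r0 r1] := andP r01.
have nf z : nrm (f z) = 2^-1 * nrm (c + z ** z).
  by rewrite /f nrmZ normc_real ger0_norm ?invr_ge0.
have fs z : star z = z -> star (f z) = f z.
  by move=> zs; rewrite /f starZ starD starM zs cs conjc_real.
have fa z : a ** z = z ** a -> a ** f z = f z ** a.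
  move=> za; rewrite /f cmulZr cmulZl cmulDr cmulDl ac; congr (_ *: (_ + _)).
  by rewrite cmulA za -!cmulA za.
have ys n : star (y n) = y n.
  by elim: n => [|n IHn]; [exact: star0|exact: fs].
have ya n : a ** y n = y n ** a.
  by elim: n => [|n IHn]; [rewrite cmul0l cmul0r|exact: fa].
have yr n : nrm (y n) <= r.
  elim: n => [|n IHn]; first by rewrite nrm0.
  rewrite [y _]/= nf; have := nrmD c (y n ** y n); have := nrmM (y n) (y n).
  have : nrm (y n) * nrm (y n) <= r * r by apply: ler_pM => //; exact: nrm_ge0.
  have : r * r = 2 * r - nrm c by rewrite -[nrm c](subKr 1) -sE /r; ring.
  lra.
have fL z w : nrm z <= r -> nrm w <= r -> nrm (f z - f w) <= r * nrm (z - w).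
  move=> zr wr; have -> : f z - f w = (2^-1)%:C%C *: (z ** (z - w) + (z - w) ** w).
    rewrite /f -scalerBr cmulBr cmulBl addrA subrK; congr (_ *: _).
    by rewrite opprD addrACA subrr add0r.
  rewrite nrmZ normc_real ger0_norm ?invr_ge0//.
  have := nrmD (z ** (z - w)) ((z - w) ** w).
  have := nrmM z (z - w); have := nrmM (z - w) w.
  have : nrm z * nrm (z - w) <= r * nrm (z - w) by apply: ler_wpM2r => //; exact: nrm_ge0.
  have : nrm (z - w) * nrm w <= nrm (z - w) * r by apply: ler_wpM2l => //; exact: nrm_ge0.
  lra.
pose C := nrm (y 1%N) / (1 - r).
have dS n : nrm (y n.+1 - y n) <= C * (r ^+ n - r ^+ n.+1).
  have -> : C * (r ^+ n - r ^+ n.+1) = r ^+ n * nrm (y 1%N).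
    by rewrite /C exprS; field; rewrite subr_eq0 gt_eqF.
  elim: n => [|n IHn]; first by rewrite expr0 mul1r subr0.
  apply: le_trans (fL (y n.+1) (y n) (yr _) (yr _)) _.
  by rewrite exprS -mulrA; apply: ler_wpM2l.
have dD n k : nrm (y (n + k)%N - y n) <= C * (r ^+ n - r ^+ (n + k)).
  elim: k => [|k IHk]; first by rewrite addn0 !subrr nrm0 mulr0.
  rewrite addnS; apply: le_trans (nrm_triangle (y (n + k)%N) _ _) _.
  by have := dS (n + k)%N; lra.
have C0 : 0 <= C by rewrite divr_ge0 ?nrm_ge0// subr_ge0 ltW.
have [l yl] : exists l, forall e, 0 < e -> exists N, forall n, (N <= n)%N ->
    nrm (y n - l) < e.
  apply: cauchy_limit => e e0.
  have e1 : 0 < e / (C + 1) / 2 by rewrite !divr_gt0// ltr_wpDl.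
  have [N rN] := expr_small r01 e1; exists N.
  suff H k n : (N <= n)%N -> nrm (y (n + k)%N - y n) < e.
    move=> m n Nm Nn; case: (leqP m n) => mn.
      by rewrite nrmB -(subnKC mn) H.
    by rewrite -(subnKC (ltnW mn)) H.
  move=> Nn; apply: le_lt_trans (dD n k) _.
  have := rN _ Nn; rewrite -mulrA -invfM ltr_pdivlMr ?mulr_gt0 ?ltr_wpDl// => rn.
  have : 0 <= C * r ^+ (n + k) by rewrite mulr_ge0// exprn_ge0.
  have : 0 <= r ^+ n by rewrite exprn_ge0.
  have : 0 <= C * r ^+ n by rewrite mulr_ge0// exprn_ge0.
  lra.
exists l; split.
- apply/subr0_eq/nrm_small_eq0 => e e0.
  have [N yN] := yl _ (divr_gt0 e0 (ltr0n R 2)); have := yN _ (leqnn N).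
  have : nrm (star l - y N) = nrm (y N - l) by rewrite -{1}ys -starB nrm_star nrmB.
  have := nrm_triangle (y N) (star l) l; lra.
- apply/subr0_eq/nrm_small_eq0 => e e0.
  have e1 : 0 < e / (nrm a + 1) / 2 by rewrite !divr_gt0// ltr_wpDl// nrm_ge0.
  have [N yN] := yl _ e1; have := yN _ (leqnn N).
  rewrite -mulrA -invfM ltr_pdivlMr ?mulr_gt0 ?ltr_wpDl ?nrm_ge0//.
  have -> : a ** l - l ** a = (y N - l) ** a - a ** (y N - l).
    by rewrite cmulBr cmulBl ya opprB [RHS]addrC subrKA.
  have := nrmD ((y N - l) ** a) (- (a ** (y N - l))).
  rewrite nrmN; have := nrmM (y N - l) a; have := nrmM a (y N - l).
  have := nrm_ge0 (y N - l); lra.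
- have h2 z : f z + f z = c + z ** z.
    rewrite /f -scalerDl -rmorphD/= (_ : _ + _ = 1 :> R) ?scale1r//; lra.
  rewrite -h2; suff -> : f l = l by [].
  apply/subr0_eq/nrm_small_eq0 => e e0.
  have [N yN] := yl _ (divr_gt0 e0 (ltr0n R 2)).
  have lr : nrm l <= r.
    rewrite leNgt; apply/negP => rl; have lr0 : 0 < nrm l - r by rewrite subr_gt0.
    have [M yM] := yl _ lr0; have := yM _ (leqnn M); have := yr M.
    have := nrmD (y M) (l - y M); rewrite subrKC (nrmB l).
    lra.
  have := yN _ (leqnSn N); have := yN _ (leqnn N).
  have := fL _ _ (yr N) lr.
  have := nrm_triangle (f (y N)) (f l) l; have := nrmB (f l) (f (y N)).
  have : r * nrm (y N - l) <= nrm (y N - l) by rewrite ler_piMl ?nrm_ge0// ltW.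
  by rewrite -[f (y N)]/(y N.+1); lra.
Qed.

(* [s] is the real part of the unitary [s + i t]. *)
Lemma nrm_commuting_squares (D : cstarType R) (s t : D) :
  star s = s -> star t = t -> s ** t = t ** s -> s ** s + t ** t = cone ->
  nrm s <= 1.
Proof.
move=> ss ts st sq; pose u := s + 'i%C *: t.
have us : star u = s - 'i%C *: t.
  rewrite /u starD starZ ss ts -scaleNr; congr (_ + _ *: _); rewrite /conjc.
  by congr (_ +i* _)%C; rewrite oppr0.
have u1 : nrm u = 1.
  apply/eqP; rewrite -(@eqrXn2 _ 2)// ?nrm_ge0// expr1n -nrm_cstar us.
  have -> : (s - 'i%C *: t) ** u = s ** s + t ** t.
    rewrite /u cmulDr !cmulBl !cmulZl !cmulZr scalerA st addrA subrK.
    rewrite -scaleNr; congr (_ + _); rewrite -[RHS]scale1r; congr (_ *: _).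
    by rewrite -expr2 sqr_i opprK.
  by rewrite sq nrm_one.
have -> : s = (2^-1)%:C%C *: (u + star u).
  rewrite us /u addrACA subrr addr0 scalerDr -scalerDl -rmorphD/=.
  by rewrite (_ : 2^-1 + 2^-1 = 1 :> R) ?scale1r//; lra.
rewrite nrmZ normc_real ger0_norm ?invr_ge0//.
have := nrmD u (star u); rewrite nrm_star u1; lra.
Qed.

End Contractive.

Section StarHom.
Variables (R : realType) (A D : cstarType R) (phi : A -> D).
Hypothesis phi_hom : star_hom phi.

Lemma star_homD x y : phi (x + y) = phi x + phi y.
Proof. by have [+ _ _ _] := phi_hom => /(_ 1 x y); rewrite !scale1r. Qed.

Lemma star_hom0 : phi 0 = 0.
Proof. by apply: (addrI (phi 0)); rewrite -star_homD !addr0. Qed.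

Lemma star_homZ c x : phi (c *: x) = c *: phi x.
Proof. by have [+ _ _ _] := phi_hom => /(_ c x 0); rewrite !addr0 star_hom0 addr0. Qed.

Lemma star_hom_peval V (z : V -> A) p : phi (peval z p) = peval (phi \o z) p.
Proof.
have [_ phiM phi1 phis] := phi_hom.
elim: p => //= [c|p IHp q IHq|p IHp q IHq|p IHp].
- by rewrite star_homZ phi1.
- by rewrite star_homD IHp IHq.
- by rewrite phiM IHp IHq.
- by rewrite phis IHp.
Qed.

(* [1 - a^2] is the square of a self-adjoint element commuting with [a], and so
   is its image. *)
Lemma star_hom_self_adjoint a : star a = a -> nrm a < 1 -> nrm (phi a) <= 1.
Proof.
have [_ phiM phi1 phis] := phi_hom.
move=> sa a1; have a0 := nrm_ge0 a.
have c1 : nrm (a ** a) < 1.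
  apply: le_lt_trans (nrmM _ _) _.
  by rewrite -expr2 expr_lt1.
have cs : star (a ** a) = a ** a by rewrite starM sa.
have [y [ys ay yy]] := sqrt_fixed_point cs (cmulA a a a) c1.
pose b := cone - y.
have bs : star b = b by rewrite /b starB star_one ys.
have ab : a ** b = b ** a by rewrite /b cmulBr cmulBl cmulx1 cmul1x ay.
have sq : a ** a + b ** b = cone.
  have -> : b ** b = cone - (y + y) + y ** y.
    by rewrite /b cmulBr !cmulBl !cmulx1 !cmul1x opprB opprD [y ** y - y]addrC !addrA.
  by rewrite yy opprD [cone + _]addrA (subrK (y ** y)) (subrKC (a ** a)).
apply: (nrm_commuting_squares (t := phi b)).
- by rewrite -phis sa.
- by rewrite -phis bs.
- by rewrite -!phiM ab.
- by rewrite -!phiM -star_homD sq.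
Qed.

Lemma star_hom_contractive x : nrm (phi x) <= nrm x.
Proof.
have [_ phiM phi1 phis] := phi_hom.
suff sa a : star a = a -> nrm (phi a) <= nrm a.
  rewrite -(@ler_pXn2r _ 2)// ?nnegrE ?nrm_ge0// -!nrm_cstar -phis -phiM.
  by apply: sa; rewrite starM starK.
move=> as_; rewrite leNgt; apply/negP => lt.
pose t := (nrm a + nrm (phi a)) / 2.
have at_ : nrm a < t by rewrite /t; lra.
have tphi : t < nrm (phi a) by rewrite /t; lra.
have t0 : 0 < t by apply: le_lt_trans at_; exact: nrm_ge0.
have : nrm (phi (t^-1%:C%C *: a)) <= 1.
  apply: star_hom_self_adjoint.
    by rewrite starZ as_ conjc_real.
  by rewrite nrmZ normc_real gtr0_norm ?invr_gt0// mulrC ltr_pdivrMr// mul1r.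
rewrite star_homZ nrmZ normc_real gtr0_norm ?invr_gt0// mulrC ler_pdivrMr// mul1r.
by rewrite leNgt tphi.
Qed.

End StarHom.

Section Polynomials.
Variable R : realType.

Lemma normc_ge0 (c : R[i]) : 0 <= Normc.normc c.
Proof. by case: c => a b; exact: sqrtr_ge0. Qed.

Lemma normc_le (a b : R) : Normc.normc (a +i* b)%C <= `|a| + `|b|.
Proof.
rewrite /= -[leRHS]ger0_norm ?addr_ge0// -sqrtr_sqr ler_wsqrtr//.
by rewrite sqrrD !real_normK ?num_real// lerD2r lerDl mulrn_wge0 ?mulr_ge0.
Qed.

Lemma normr_ratr_le (q : rat) : `|ratr q| <= (`|numq q|%N)%:R :> R.
Proof.
rewrite -ratr_norm -(ratr_nat R) ler_rat -[in leLHS](divq_num_den q) normrM.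
rewrite normfV ler_pdivrMr ?normr_gt0 ?intr_eq0 ?denq_neq0//.
rewrite -intr_norm -abszE -[X in X * _]/(`|numq q|%N%:Q) ler_peMr//.
by rewrite -intr_norm ler1z -gtz0_ge1 normr_gt0 denq_neq0.
Qed.

Definition gauss_bound (c : rat[i]) : nat :=
  (`|numq (complex.Re c)| + `|numq (complex.Im c)|)%N.

Lemma normc_ratc c : Normc.normc (ratc R c) <= (gauss_bound c)%:R.
Proof.
apply: le_trans (normc_le _ _) _.
by rewrite /gauss_bound natrD lerD// normr_ratr_le.
Qed.

Lemma ratc_dense (c : R[i]) e : 0 < e ->
  exists q, Normc.normc (ratc R q - c) < e.
Proof.
move=> e0; have h (a : R) : exists q : rat, `|ratr q - a| < e / 2.
  have e2 : 0 < e / 2 by rewrite divr_gt0.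
  have [|q] := @rat_in_itvoo R (a - e / 2) (a + e / 2); first lra.
  by rewrite in_itv/= => q_in; exists q; rewrite ltr_distl.
case: c => a b; have [q qa] := h a; have [r rb] := h b.
exists (q +i* r)%C; rewrite /ratc /=.
apply: le_lt_trans (normc_le _ _) _.
by rewrite [e]splitr ltrD.
Qed.

Definition lipschitz_bound (V : Type) (K : nat) : starpoly V -> nat :=
  starpoly_fold gauss_bound (fun _ => K.+1) addn (fun a b => 2 * (a * b))%N id.

Lemma peval_lipschitz (D : cstarType R) V (y z : V -> D) K d p : 0 <= d ->
  (forall v, nrm (y v) <= K.+1%:R) -> (forall v, nrm (z v) <= K.+1%:R) ->
  (forall v, nrm (y v - z v) <= d) ->
  [/\ nrm (peval y p) <= (lipschitz_bound K p)%:R,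
      nrm (peval z p) <= (lipschitz_bound K p)%:R &
      nrm (peval y p - peval z p) <= (lipschitz_bound K p)%:R * d].
Proof.
move=> d0 yK zK yzd.
elim: p => [c|v|p [py pz pd] q [qy qz qd]|p [py pz pd] q [qy qz qd]|p [py pz pd]];
  rewrite /lipschitz_bound/= -?/(lipschitz_bound K _).
- have c_le : nrm (ratc R c *: (cone : D)) <= (gauss_bound c)%:R.
    by rewrite nrmZ nrm_one mulr1 normc_ratc.
  by split => //; rewrite subrr nrm0 mulr_ge0.
- split => //; apply: le_trans (yzd v) _.
  by rewrite ler_peMl// ler1n.
- split; rewrite natrD.
  + by apply: le_trans (nrmD _ _) _; exact: lerD.
  + by apply: le_trans (nrmD _ _) _; exact: lerD.
  + rewrite opprD addrACA mulrDl.
    by apply: le_trans (nrmD _ _) _; exact: lerD.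
- have le2 (a b : R) : 0 <= a -> 0 <= b -> a * b <= 2 * (a * b).
    by move=> a0 b0; rewrite ler_peMl ?mulr_ge0// ler1n.
  split; rewrite !natrM.
  + apply: le_trans (nrmM _ _) _; apply: le_trans (le2 _ _ _ _); rewrite ?ler0n//.
    by apply: ler_pM; rewrite ?nrm_ge0.
  + apply: le_trans (nrmM _ _) _; apply: le_trans (le2 _ _ _ _); rewrite ?ler0n//.
    by apply: ler_pM; rewrite ?nrm_ge0.
  + have -> : peval y p ** peval y q - peval z p ** peval z q =
      (peval y p - peval z p) ** peval y q + peval z p ** (peval y q - peval z q).
      by rewrite cmulBr cmulBl addrA subrK.
    have h1 : nrm (peval y p - peval z p) * nrm (peval y q) <=
        (lipschitz_bound K p)%:R * d * (lipschitz_bound K q)%:R.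
      by apply: ler_pM; rewrite ?nrm_ge0.
    have h2 : nrm (peval z p) * nrm (peval y q - peval z q) <=
        (lipschitz_bound K p)%:R * ((lipschitz_bound K q)%:R * d).
      by apply: ler_pM; rewrite ?nrm_ge0.
    have := nrmD ((peval y p - peval z p) ** peval y q)
      (peval z p ** (peval y q - peval z q)).
    have := nrmM (peval y p - peval z p) (peval y q).
    have := nrmM (peval z p) (peval y q - peval z q).
    lra.
- by rewrite !nrm_star -starB nrm_star.
Qed.

Lemma rational_points_dense (C : cstarType R) (a : nat -> C) :
  generates a -> forall x e, 0 < e -> exists p, nrm (peval a p - x) < e.
Proof.
move=> ga; pose S : set C := [set x | forall e, 0 < e -> exists p, nrm (peval a p - x) < e].
suff ST : S = setT by move=> x; have : setT x := I; rewrite -ST.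
apply: ga; last by move=> n e e0; exists (SVar n); rewrite subrr nrm0.
split.
- move=> x xS e e0; have e2 : 0 < e / 2 by rewrite divr_gt0.
  have [y [Sy]] : S `&` ball x (e / 2)%:C%C !=set0.
    by apply: xS; apply: nbhsx_ballx; rewrite ltcR.
  rewrite -ball_normE/= -nrmE ltcR => xy.
  have [p py] := Sy _ e2; exists p.
  have := nrm_triangle y (peval a p) x; have := nrmB x y; lra.
- move=> e e0; exists (SConst 1).
  rewrite /= (_ : ratc R 1 = 1) ?scale1r ?subrr ?nrm0//.
  by rewrite /ratc/= rmorph1 rmorph0.
- move=> c x y Sx Sy e e0.
  have e3 : 0 < e / 3 by rewrite divr_gt0.
  have x0 : 0 < nrm x + 1 by rewrite ltr_wpDl// nrm_ge0.
  have [q qc] := ratc_dense c (divr_gt0 e3 x0).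
  have [r yr] := Sy _ e3.
  have k0 : 0 < Normc.normc (ratc R q) + 1 by rewrite ltr_wpDl// normc_ge0.
  have [p xp] := Sx _ (divr_gt0 e3 k0).
  exists (SAdd (SMul (SConst q) p) r) => /=.
  rewrite cmulZl cmul1x.
  have -> : ratc R q *: peval a p + peval a r - (c *: x + y) =
    ratc R q *: (peval a p - x) + (ratc R q - c) *: x + (peval a r - y).
    by rewrite scalerBr scalerBl (subrKA (ratc R q *: x)) opprD addrACA.
  have := nrmD (ratc R q *: (peval a p - x) + (ratc R q - c) *: x) (peval a r - y).
  have := nrmD (ratc R q *: (peval a p - x)) ((ratc R q - c) *: x).
  rewrite !nrmZ.
  have h1 : Normc.normc (ratc R q) * nrm (peval a p - x) <= e / 3.
    move: xp; rewrite ltr_pdivlMr// => xp.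
    have := nrm_ge0 (peval a p - x); lra.
  have h2 : Normc.normc (ratc R q - c) * nrm x <= e / 3.
    move: qc; rewrite ltr_pdivlMr// => qc.
    have := normc_ge0 (ratc R q - c).
    lra.
  lra.
- move=> x y Sx Sy e e0.
  have e2 : 0 < e / 2 by rewrite divr_gt0.
  have y0 : 0 < nrm y + 1 by rewrite ltr_wpDl// nrm_ge0.
  have [p xp] := Sx _ (divr_gt0 e2 y0).
  have p0 : 0 < nrm (peval a p) + 1 by rewrite ltr_wpDl// nrm_ge0.
  have [q yq] := Sy _ (divr_gt0 e2 p0).
  exists (SMul p q) => /=.
  have -> : peval a p ** peval a q - x ** y =
    peval a p ** (peval a q - y) + (peval a p - x) ** y.
    by rewrite cmulBr cmulBl addrA subrK.
  have := nrmD (peval a p ** (peval a q - y)) ((peval a p - x) ** y).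
  have := nrmM (peval a p) (peval a q - y).
  have := nrmM (peval a p - x) y.
  move: xp yq; rewrite !ltr_pdivlMr//.
  have := nrm_ge0 (peval a p - x); have := nrm_ge0 (peval a q - y).
  lra.
- move=> x Sx e e0; have [p xp] := Sx _ e0; exists (SStar p).
  by rewrite /= -starB nrm_star.
Qed.

Lemma presentation_separable (C : cstarType R) (a : nat -> C) :
  generates a -> separable C.
Proof.
move=> ga; exists (range (fun n => peval a (starpoly_decode n))); split.
  exact: card_image_le.
move=> O [x Ox] oO; have /nbhs_ballP[e /= e0 xeO] : nbhs x O by exact: open_nbhs_nbhs.
have ee : e = (complex.Re e)%:C%C by rewrite RRe_real// gtr0_real.
have [|p xp] := rational_points_dense ga x (e := complex.Re e).
  by rewrite -ltcR -ee.
exists (peval a p); split; last by exists (poly_code p) => //; rewrite poly_codeK.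
by apply: xeO; rewrite -ball_normE/= -nrmE ee ltcR nrmB.
Qed.

End Polynomials.

(** * Completion of a C*-seminorm on polynomials *)

Section RatComplex.
Variable R : realType.

Lemma ratcD c d : ratc R (c + d) = ratc R c + ratc R d.
Proof. by case: c => a b; case: d => a' b'; rewrite /ratc/= !rmorphD. Qed.

Lemma ratcN c : ratc R (- c) = - ratc R c.
Proof. by case: c => a b; rewrite /ratc/= !rmorphN. Qed.

Lemma ratcB c d : ratc R (c - d) = ratc R c - ratc R d.
Proof. by rewrite ratcD ratcN. Qed.

Lemma ratcM c d : ratc R (c * d) = ratc R c * ratc R d.
Proof.
case: c => a b; case: d => a' b'; rewrite /ratc/=.
by rewrite rmorphB rmorphD/= !rmorphM.
Qed.

Lemma ratc_conj c : ratc R (conjc c) = conjc (ratc R c).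
Proof. by case: c => a b; rewrite /ratc/= rmorphN. Qed.

Lemma gauss_conjK (c : rat[i]) : conjc (conjc c) = c.
Proof. by case: c => a b; rewrite /= opprK. Qed.

Lemma ratc0 : ratc R 0 = 0.
Proof. by rewrite /ratc/= !rmorph0. Qed.

Lemma ratc1 : ratc R 1 = 1.
Proof. by rewrite /ratc/= rmorph1 rmorph0. Qed.

Lemma normcN (c : R[i]) : Normc.normc (- c) = Normc.normc c.
Proof. by case: c => a b; rewrite /= !sqrrN. Qed.

Lemma normcD (c d : R[i]) : Normc.normc (c + d) <= Normc.normc c + Normc.normc d.
Proof. by rewrite -lecR rmorphD/= !normcE ler_normD. Qed.

Lemma normcM (c d : R[i]) : Normc.normc (c * d) = Normc.normc c * Normc.normc d.
Proof. exact: Normc.normcM. Qed.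

Lemma normc_conj (c : R[i]) : Normc.normc (conjc c) = Normc.normc c.
Proof. by case: c => a b; rewrite /= sqrrN. Qed.

End RatComplex.

(* The variables 0, 1, 2 stand for arbitrary polynomials. *)
Definition axiom_templates : seq (starpoly nat * starpoly nat) :=
  let a := SVar 0%N in let b := SVar 1%N in let c := SVar 2%N in
  [:: (SAdd a (SAdd b c), SAdd (SAdd a b) c);
      (SAdd a b, SAdd b a);
      (SAdd a (SConst 0), a);
      (SAdd a (SMul (SConst (-1)) a), SConst 0);
      (SMul a (SMul b c), SMul (SMul a b) c);
      (SMul a (SAdd b c), SAdd (SMul a b) (SMul a c));
      (SMul (SAdd a b) c, SAdd (SMul a c) (SMul b c));
      (SMul (SConst 1) a, a);
      (SStar (SAdd a b), SAdd (SStar a) (SStar b));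
      (SStar (SMul a b), SMul (SStar b) (SStar a));
      (SStar (SStar a), a);
      (SMul a (SConst 0), SConst 0);
      (SStar (SConst 0), SConst 0)].

Record cstar_pseudometric (R : realType) := CstarPseudometric {
  rho :> starpoly nat -> starpoly nat -> R;
  rho_sym : forall p q, rho p q = rho q p;
  rho_triangle : forall q p r, rho p r <= rho p q + rho q r;
  rho_add : forall p p' q q',
    rho (SAdd p q) (SAdd p' q') <= rho p p' + rho q q';
  rho_mull : forall c p q,
    rho (SMul c p) (SMul c q) <= rho c (SConst 0) * rho p q;
  rho_mulr : forall c p q,
    rho (SMul p c) (SMul q c) <= rho p q * rho c (SConst 0);
  rho_star : forall p q, rho (SStar p) (SStar q) <= rho p q;
  rho_cstar : forall p,
    rho p (SConst 0) ^+ 2 <= rho (SMul (SStar p) p) (SConst 0);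
  rho_axiom : forall i s, (i < size axiom_templates)%N ->
    let t := nth (SConst 0, SConst 0) axiom_templates i in
    rho (starpoly_subst s t.1) (starpoly_subst s t.2) = 0;
  rho_central : forall c p, rho (SMul (SConst c) p) (SMul p (SConst c)) = 0;
  (* With suitable constants equal to 0 and 1, this gives the sum, the product,
     the conjugate and the norm of constants. *)
  rho_const : forall a b c d,
    rho (SAdd (SMul (SStar (SConst a)) (SConst b)) (SConst c)) (SConst d) <=
    Normc.normc (ratc R (conjc a * b + c - d));
  rho_one : 1 <= rho (SConst 1) (SConst 0)
}.

Section Completion.
Variables (R : realType) (P : cstar_pseudometric R).
Local Notation E := (starpoly nat).
Local Notation K := (@SConst nat).
Let N p := P p (K 0).
Implicit Types p q r s : E.

Let ax i a b c : (i < 13)%N ->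
  let s := nth (K 0) [:: a; b; c] in
  let t := nth (K 0, K 0) axiom_templates i in
  P (starpoly_subst s t.1) (starpoly_subst s t.2) = 0.
Proof. by move=> i13; exact: rho_axiom. Qed.

Let rho_addA a b c : P (SAdd a (SAdd b c)) (SAdd (SAdd a b) c) = 0.
Proof. exact: (@ax 0 a b c). Qed.
Let rho_addC a b : P (SAdd a b) (SAdd b a) = 0.
Proof. exact: (@ax 1 a b a). Qed.
Let rho_add0 a : P (SAdd a (K 0)) a = 0.
Proof. exact: (@ax 2 a a a). Qed.
Let rho_addN a : P (SAdd a (SMul (K (-1)) a)) (K 0) = 0.
Proof. exact: (@ax 3 a a a). Qed.
Let rho_mulA a b c : P (SMul a (SMul b c)) (SMul (SMul a b) c) = 0.
Proof. exact: (@ax 4 a b c). Qed.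
Let rho_mulDr a b c : P (SMul a (SAdd b c)) (SAdd (SMul a b) (SMul a c)) = 0.
Proof. exact: (@ax 5 a b c). Qed.
Let rho_mulDl a b c : P (SMul (SAdd a b) c) (SAdd (SMul a c) (SMul b c)) = 0.
Proof. exact: (@ax 6 a b c). Qed.
Let rho_mul1 a : P (SMul (K 1) a) a = 0.
Proof. exact: (@ax 7 a a a). Qed.
Let rho_starD a b : P (SStar (SAdd a b)) (SAdd (SStar a) (SStar b)) = 0.
Proof. exact: (@ax 8 a b a). Qed.
Let rho_starM a b : P (SStar (SMul a b)) (SMul (SStar b) (SStar a)) = 0.
Proof. exact: (@ax 9 a b a). Qed.
Let rho_starK a : P (SStar (SStar a)) a = 0.
Proof. exact: (@ax 10 a a a). Qed.

Let rho_le0 p : P p p <= 0.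
Proof.
apply: le_trans (rho_triangle P (SAdd p (K 0)) p p) _.
by rewrite rho_sym rho_add0 addr0.
Qed.

Let rho_ge0 p q : 0 <= P p q.
Proof.
have h r : 0 <= P r r by have := rho_triangle P r r r; lra.
have := rho_triangle P q p p; have := h p; rewrite (rho_sym P q p); lra.
Qed.

Let rho_refl p : P p p = 0.
Proof. by apply/eqP; rewrite eq_le rho_le0 rho_ge0. Qed.

Let rho_eql p q r : P p q = 0 -> P p r = P q r.
Proof.
move=> pq; apply/eqP; rewrite eq_le; have := rho_triangle P q p r.
by have := rho_triangle P p q r; rewrite (rho_sym P q p) pq !add0r => -> ->.
Qed.

Let rho_eqr p q r : P p q = 0 -> P r p = P r q.
Proof. by move=> pq; rewrite !(rho_sym P r); exact: rho_eql. Qed.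

Let le_eq0 (x : R) : 0 <= x -> x <= 0 -> x = 0.
Proof. by move=> x0 x0'; apply/eqP; rewrite eq_le x0 x0'. Qed.

Let rho_add_eq p p' q q' : P p p' = 0 -> P q q' = 0 ->
  P (SAdd p q) (SAdd p' q') = 0.
Proof.
by move=> pp qq; apply: le_eq0 => //; rewrite (le_trans (rho_add P _ _ _ _))// pp qq addr0.
Qed.

Let rho_mul_eq p p' q q' : P p p' = 0 -> P q q' = 0 ->
  P (SMul p q) (SMul p' q') = 0.
Proof.
move=> pp qq; apply: le_eq0 => //.
rewrite (le_trans (rho_triangle P (SMul p q') _ _))//.
have := rho_mull P p q q'; have := rho_mulr P q' p p'.
rewrite pp qq mulr0 mul0r; lra.
Qed.

Let rho_mulx1 a : P (SMul a (K 1)) a = 0.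
Proof. by rewrite (rho_eql _ (etrans (rho_sym P _ _) (rho_central P 1 a))). Qed.

Let rho_const_star a b c d :
  P (SAdd (SMul (K a) (K b)) (K c)) (K d) <= Normc.normc (ratc R (a * b + c - d)).
Proof.
have starKa : P (K a) (SStar (K (conjc a))) = 0.
  rewrite rho_sym; have := rho_const P (conjc a) 1 0 a.
  rewrite (rho_eql _ (rho_add0 _)) (rho_eql _ (rho_mulx1 _)).
  rewrite gauss_conjK mulr1 addr0 subrr ratc0 Normc.normc0; exact: le_eq0.
rewrite -[a in leRHS]gauss_conjK.
rewrite (rho_eql _ (rho_add_eq (rho_mul_eq starKa (rho_refl _)) (rho_refl _))).
exact: rho_const.
Qed.

Let rho_constM a b d : P (SMul (K a) (K b)) (K d) <= Normc.normc (ratc R (a * b - d)).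
Proof.
by have := rho_const_star a b 0 d; rewrite (rho_eql _ (rho_add0 _)) addr0.
Qed.

Let rho_constD a b d : P (SAdd (K a) (K b)) (K d) <= Normc.normc (ratc R (a + b - d)).
Proof.
have := rho_const_star a 1 b d; rewrite mulr1.
by rewrite (rho_eql _ (rho_add_eq (rho_mulx1 _) (rho_refl _))).
Qed.

Let rho_constB a d : P (K a) (K d) <= Normc.normc (ratc R (a - d)).
Proof. by have := rho_constD a 0 d; rewrite (rho_eql _ (rho_add0 _)) addr0. Qed.

Let rho_constS a d : P (SStar (K a)) (K d) <= Normc.normc (ratc R (conjc a - d)).
Proof.
have := rho_const P a 1 0 d; rewrite mulr1 addr0.
by rewrite (rho_eql _ (rho_add0 _)) (rho_eql _ (rho_mulx1 _)).
Qed.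

Let ssub p q := SAdd p (SMul (K (-1)) q).

Let N_sub p q : N (ssub p q) = P p q.
Proof.
apply/eqP; rewrite eq_le /N; apply/andP; split.
  rewrite -(rho_eqr _ (rho_addN q)).
  by apply: le_trans (rho_add P _ _ _ _) _; rewrite rho_refl addr0.
have pE : P p (SAdd (ssub p q) q) = 0.
  rewrite -(rho_eqr _ (rho_addA _ _ _)) rho_sym.
  rewrite (rho_eql _ (rho_add_eq (rho_refl p) (rho_addC _ _))).
  by rewrite (rho_eql _ (rho_add_eq (rho_refl p) (rho_addN _))).
have qE : P q (SAdd (K 0) q) = 0.
  by rewrite -(rho_eqr _ (rho_addC _ _)) rho_sym.
rewrite (rho_eql _ pE) (rho_eqr _ qE).
by apply: le_trans (rho_add P _ _ _ _) _; rewrite rho_refl addr0.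
Qed.

Let N_ge0 p : 0 <= N p. Proof. exact: rho_ge0. Qed.

Let N_rho p q : N p <= N q + P p q.
Proof. by rewrite addrC; exact: rho_triangle. Qed.

Let N_lip p q : `|N p - N q| <= P p q.
Proof.
have := N_rho p q; have := N_rho q p; rewrite (rho_sym P q p) ler_norml; lra.
Qed.

Let N_add p q : N (SAdd p q) <= N p + N q.
Proof. by rewrite /N -(rho_eqr _ (rho_add0 (K 0))); exact: rho_add. Qed.

Let rho_mul0 p : P (SMul p (K 0)) (K 0) = 0.
Proof. exact: (@ax 11 p p p). Qed.

Let N_mul p q : N (SMul p q) <= N p * N q.
Proof. by rewrite /N -[P (SMul _ _) _](rho_eqr _ (rho_mul0 p)); exact: rho_mull. Qed.

Let N_star p : N (SStar p) = N p.
Proof.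
have s0 : P (SStar (K 0)) (K 0) = 0 by exact: (@ax 12 p p p).
have le q : N (SStar q) <= N q by rewrite /N -(rho_eqr _ s0); exact: rho_star.
apply/eqP; rewrite eq_le le /=.
by rewrite -[X in X <= _](rho_eql _ (rho_starK p)); exact: le.
Qed.

Let N_cstar p : N (SMul (SStar p) p) = N p ^+ 2.
Proof.
apply/eqP; rewrite eq_le rho_cstar andbT.
by apply: le_trans (N_mul _ _) _; rewrite N_star expr2.
Qed.

Let N_const c : N (K c) <= Normc.normc (ratc R c).
Proof. by have := rho_constB c 0; rewrite subr0. Qed.

Record cseq := CSeq {
  cval :> nat -> E;
  cvalP : forall e : R, 0 < e -> exists M, forall m n,
    (M <= m)%N -> (M <= n)%N -> P (cval m) (cval n) < e
}.

HB.instance Definition _ := gen_eqMixin cseq.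
HB.instance Definition _ := gen_choiceMixin cseq.

Let null (f : nat -> R) := f n @[n --> \oo] --> (0 : R).

Let cvg_close (f g d : nat -> R) (l : R) : f n @[n --> \oo] --> l -> null d ->
  (forall n, `|g n - f n| <= d n) -> g n @[n --> \oo] --> l.
Proof.
move=> fl d0 gf; apply: (@squeeze_cvgr _ _ _ _ (fun n => f n - d n) (fun n => f n + d n)).
- apply: nearW => n; have := gf n; rewrite ler_distl lerBlDr => /andP[? ?].
  by apply/andP; split; lra.
- by rewrite -[l]subr0; apply: cvgB.
- by rewrite -[l]addr0; apply: cvgD.
Qed.

Let null_le (f g : nat -> R) : null f -> (forall n, 0 <= g n <= f n) -> null g.
Proof.
move=> f0 gf; apply: (cvg_close (cvg_cst 0) f0) => n.
by have /andP[g0 gf'] := gf n; rewrite subr0 ger0_norm.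
Qed.

Let null0 : null (fun=> 0). Proof. exact: cvg_cst. Qed.

Let nullD f g : null f -> null g -> null (fun n => f n + g n).
Proof. by move=> f0 g0; rewrite /null -[0]addr0; apply: cvgD. Qed.

Let nullM a f : null f -> null (fun n => a * f n).
Proof. by move=> f0; rewrite /null -[0](mulr0 a); apply: cvgM => //; exact: cvg_cst. Qed.

Let nullP f : null f <-> forall e, 0 < e -> exists M, forall n, (M <= n)%N -> `|f n| < e.
Proof.
split=> [/cvgrPdist_lt f0 e /f0[M _ fM]|f0].
  by exists M => n /fM /=; rewrite sub0r normrN.
apply/cvgrPdist_lt => e /f0[M fM]; exists M => // n /= Mn.
by rewrite sub0r normrN fM.
Qed.

Let N_cvg (u : cseq) : cvg (N (u n) @[n --> \oo]).
Proof.
apply/cauchy_cvgP/cauchy_exP => e /(cvalP u)[M uM].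
exists (N (u M)); exists M => // n /= Mn; rewrite -ball_normE /=.
by apply: le_lt_trans (N_lip _ _) _; exact: uM.
Qed.

Definition cnorm (u : cseq) : R := lim (N (u n) @[n --> \oo]).

Let N_lim (u : cseq) : N (u n) @[n --> \oo] --> cnorm u.
Proof. exact: N_cvg. Qed.

Let cnormE (u : cseq) (l : R) : N (u n) @[n --> \oo] --> l -> cnorm u = l.
Proof. by move=> ul; apply: cvg_lim. Qed.

Let N_bound (u : cseq) : exists2 M : R, 0 <= M & forall n, N (u n) <= M.
Proof.
have [M [Mr uM]] := cvg_seq_bounded (@N_cvg u).
have M1 : M < `|M| + 1 by rewrite (le_lt_trans (ler_norm _))// ltrDl.
exists (`|M| + 1); first by rewrite addr_ge0.
by move=> n; apply: le_trans (uM _ M1 n I); exact: ler_norm.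
Qed.

Fact cconst_subproof p (e : R) : 0 < e -> exists M : nat, forall m n,
  (M <= m)%N -> (M <= n)%N -> P p p < e.
Proof. by move=> e0; exists 0%N; rewrite rho_refl. Qed.
Definition cconst p := CSeq (cconst_subproof p).

Fact cadd_subproof (u v : cseq) (e : R) : 0 < e -> exists M, forall m n,
  (M <= m)%N -> (M <= n)%N -> P (SAdd (u m) (v m)) (SAdd (u n) (v n)) < e.
Proof.
move=> e0; have e2 : 0 < e / 2 by rewrite divr_gt0.
have [M uM] := cvalP u e2; have [M' vM] := cvalP v e2.
exists (maxn M M') => m n; rewrite !geq_max => /andP[um vm] /andP[un vn].
by apply: le_lt_trans (rho_add P _ _ _ _) _; rewrite [e]splitr ltrD ?uM ?vM.
Qed.
Definition cadd u v := CSeq (cadd_subproof u v).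

Let rho_mul M M' p p' q q' : N p <= M -> N q' <= M' ->
  P (SMul p q) (SMul p' q') <= M * P q q' + M' * P p p'.
Proof.
move=> pM qM; apply: le_trans (rho_triangle P (SMul p q') _ _) _.
apply: lerD; first by apply: le_trans (rho_mull P _ _ _) _; rewrite ler_wpM2r.
by apply: le_trans (rho_mulr P _ _ _) _; rewrite mulrC ler_wpM2r.
Qed.

Fact cmul_subproof (u v : cseq) (e : R) : 0 < e -> exists M, forall m n,
  (M <= m)%N -> (M <= n)%N -> P (SMul (u m) (v m)) (SMul (u n) (v n)) < e.
Proof.
have [A A0 uA] := N_bound u; have [B B0 vB] := N_bound v.
move=> e0; have AB0 : 0 < A + B + 1 by rewrite ltr_wpDl ?addr_ge0.
have [t t0 ->] : exists2 t, 0 < t & e = (A + B + 1) * t.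
  by exists (e / (A + B + 1)); rewrite ?divr_gt0// mulrCA divff ?mulr1// gt_eqF.
have [M uM] := cvalP u t0; have [M' vM] := cvalP v t0.
exists (maxn M M') => m n; rewrite !geq_max => /andP[um vm] /andP[un vn].
apply: le_lt_trans (rho_mul _ _ (uA _) (vB _)) _.
have : A * P (v m) (v n) <= A * t by rewrite ler_wpM2l// ltW// vM.
have : B * P (u m) (u n) <= B * t by rewrite ler_wpM2l// ltW// uM.
lra.
Qed.
Definition cmulr u v := CSeq (cmul_subproof u v).

Fact cstar_subproof (u : cseq) (e : R) : 0 < e -> exists M, forall m n,
  (M <= m)%N -> (M <= n)%N -> P (SStar (u m)) (SStar (u n)) < e.
Proof.
move=> /(cvalP u)[M uM]; exists M => m n Mm Mn.
by apply: le_lt_trans (rho_star P _ _) _; exact: uM.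
Qed.
Definition cstar u := CSeq (cstar_subproof u).

Let approx_ex (c : R[i]) n :
  exists q : rat[i], Normc.normc (ratc R q - c) < n.+1%:R^-1.
Proof. by apply: ratc_dense; rewrite invr_gt0. Qed.

Let approx c n : rat[i] := projT1 (cid (approx_ex c n)).

Let approxP c n : Normc.normc (ratc R (approx c n) - c) < n.+1%:R^-1.
Proof. by rewrite /approx; case: cid. Qed.

Let eps n : R := n.+1%:R^-1.

Let eps0 : null eps.
Proof. exact: cvg_harmonic. Qed.

Let approx_lt c n : Normc.normc (ratc R (approx c n) - c) < eps n.
Proof. exact: approxP. Qed.

Let eps_le m n : (m <= n)%N -> eps n <= eps m.
Proof. by move=> mn; rewrite lef_pV2 ?posrE// ler_nat. Qed.

Let eps_small e : 0 < e -> exists M, forall n, (M <= n)%N -> eps n < e.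
Proof.
move=> e0; have /nullP/(_ _ e0)[M epsM] := eps0.
by exists M => n /epsM; rewrite ger0_norm// invr_ge0.
Qed.

Fact cscal_subproof (c : R[i]) (e : R) : 0 < e -> exists M, forall m n,
  (M <= m)%N -> (M <= n)%N -> P (K (approx c m)) (K (approx c n)) < e.
Proof.
move=> e0; have e2 : 0 < e / 2 by rewrite divr_gt0.
have [M epsM] := eps_small e2; exists M => m n Mm Mn.
apply: le_lt_trans (rho_constB _ _) _; rewrite ratcB.
have -> : ratc R (approx c m) - ratc R (approx c n) =
    (ratc R (approx c m) - c) - (ratc R (approx c n) - c) by ring.
apply: le_lt_trans (normcD _ _) _; rewrite normcN.
by rewrite [e]splitr ltrD// (lt_trans (approx_lt _ _))// epsM.
Qed.
Definition cscal c := CSeq (cscal_subproof c).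

Definition ceq (u v : cseq) : bool := `[< null (fun n => P (u n) (v n)) >].

Let ceq_refl : reflexive ceq.
Proof. by move=> u; apply/asboolP; under eq_fun do rewrite rho_refl; exact: null0. Qed.

Let ceq_sym : symmetric ceq.
Proof.
by move=> u v; congr asbool; congr null; apply/funext => n; rewrite rho_sym.
Qed.

Let ceq_trans : transitive ceq.
Proof.
move=> v u w /asboolP uv /asboolP vw; apply/asboolP.
apply: null_le (nullD uv vw) _ => n.
by rewrite rho_ge0 rho_triangle.
Qed.

Definition ceq_equiv : equiv_rel cseq := EquivRel ceq ceq_refl ceq_sym ceq_trans.

Definition completion : Type := {eq_quot ceq_equiv}.

HB.instance Definition _ := Choice.on completion.

Definition cclass (u : cseq) : completion := \pi_{eq_quot ceq_equiv} u.
Definition crep (x : completion) : cseq := repr (x : {eq_quot ceq_equiv}).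

Let crepK x : cclass (crep x) = x.
Proof. exact: reprK. Qed.

Lemma cclass_eqP u v : cclass u = cclass v <-> null (fun n => P (u n) (v n)).
Proof.
rewrite /cclass; split=> [/eqmodP/asboolP//|uv].
by apply/(@eqmodP _ ceq_equiv)/asboolP.
Qed.

Let crep_null u : null (fun n => P (crep (cclass u) n) (u n)).
Proof. by apply/cclass_eqP; rewrite crepK. Qed.

Lemma cclassP (Q : completion -> Prop) : (forall u, Q (cclass u)) ->
  forall x, Q x.
Proof. by move=> Qu x; rewrite -[x]crepK. Qed.

Let cclass_ext (u v : cseq) : (forall n, P (u n) (v n) = 0) -> cclass u = cclass v.
Proof.
by move=> uv; apply/cclass_eqP; under eq_fun do rewrite uv; exact: null0.
Qed.

Definition dadd x y := cclass (cadd (crep x) (crep y)).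
Definition dmul x y := cclass (cmulr (crep x) (crep y)).
Definition dstar x := cclass (cstar (crep x)).
Definition dconst p := cclass (cconst p).
Definition dopp x := dmul (dconst (K (-1))) x.
(* Scalars act through limits of constants in Q(i). *)
Definition dscale (c : R[i]) x := dmul (cclass (cscal c)) x.
Definition dnorm x : R[i] := (cnorm (crep x))%:C%C.

Let daddE u v : dadd (cclass u) (cclass v) = cclass (cadd u v).
Proof.
apply/cclass_eqP; apply: null_le (nullD (crep_null u) (crep_null v)) _ => n.
by rewrite rho_ge0 rho_add.
Qed.

Let dmulE u v : dmul (cclass u) (cclass v) = cclass (cmulr u v).
Proof.
have [A A0 uA] := N_bound (crep (cclass u)); have [B B0 vB] := N_bound v.
apply/cclass_eqP; apply: null_le (nullD (nullM A (crep_null v)) (nullM B (crep_null u))) _ => n.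
by rewrite rho_ge0 rho_mul.
Qed.

Let dstarE u : dstar (cclass u) = cclass (cstar u).
Proof.
apply/cclass_eqP; apply: null_le (crep_null u) _ => n.
by rewrite rho_ge0 rho_star.
Qed.

Let dnormE u : dnorm (cclass u) = (cnorm u)%:C%C.
Proof.
congr (_ %:C)%C; apply/esym/cnormE.
by apply: cvg_close (@N_lim _) (crep_null u) _ => n; rewrite distrC N_lip.
Qed.

Let dE := (daddE, dmulE, dstarE).

Fact daddA : associative dadd.
Proof.
elim/cclassP => a; elim/cclassP => b; elim/cclassP => c; rewrite !dE.
by apply: cclass_ext => n /=; exact: rho_addA.
Qed.

Fact daddC : commutative dadd.
Proof.
elim/cclassP => a; elim/cclassP => b; rewrite !dE.
by apply: cclass_ext => n /=; exact: rho_addC.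
Qed.

Fact dadd0x : left_id (dconst (K 0)) dadd.
Proof.
elim/cclassP => a; rewrite daddC !dE.
by apply: cclass_ext => n /=; exact: rho_add0.
Qed.

Fact daddNx : left_inverse (dconst (K 0)) dopp dadd.
Proof.
elim/cclassP => a; rewrite daddC /dopp dmulE daddE.
by apply: cclass_ext => n /=; exact: rho_addN.
Qed.

HB.instance Definition _ :=
  GRing.isZmodule.Build completion daddA daddC dadd0x daddNx.

Fact dmulA : associative dmul.
Proof.
elim/cclassP => a; elim/cclassP => b; elim/cclassP => c; rewrite !dE.
by apply: cclass_ext => n /=; exact: rho_mulA.
Qed.

Fact dmul1x : left_id (dconst (K 1)) dmul.
Proof.
elim/cclassP => a; rewrite !dE.
by apply: cclass_ext => n /=; exact: rho_mul1.
Qed.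

Fact dmulx1 : right_id (dconst (K 1)) dmul.
Proof.
elim/cclassP => a; rewrite !dE.
by apply: cclass_ext => n /=; exact: rho_mulx1.
Qed.

Let dclassD u v : cclass u + cclass v = cclass (cadd u v).
Proof. exact: daddE. Qed.

Let dE' := (dclassD, dmulE, dstarE).

Fact dmulDl : left_distributive dmul +%R.
Proof.
elim/cclassP => a; elim/cclassP => b; elim/cclassP => c; rewrite !dE'.
by apply: cclass_ext => n /=; exact: rho_mulDl.
Qed.

Fact dmulDr : right_distributive dmul +%R.
Proof.
elim/cclassP => a; elim/cclassP => b; elim/cclassP => c; rewrite !dE'.
by apply: cclass_ext => n /=; exact: rho_mulDr.
Qed.

Fact dstarD : {morph dstar : x y / x + y}.
Proof.
elim/cclassP => a; elim/cclassP => b; rewrite !dE'.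
by apply: cclass_ext => n /=; exact: rho_starD.
Qed.

Fact dstarM x y : dstar (dmul x y) = dmul (dstar y) (dstar x).
Proof.
elim/cclassP: x => a; elim/cclassP: y => b; rewrite !dE.
by apply: cclass_ext => n /=; exact: rho_starM.
Qed.

Fact dstarK : involutive dstar.
Proof.
elim/cclassP => a; rewrite !dE.
by apply: cclass_ext => n /=; exact: rho_starK.
Qed.

Let scal_central c x : dmul (cclass (cscal c)) x = dmul x (cclass (cscal c)).
Proof.
elim/cclassP: x => a; rewrite !dE.
by apply: cclass_ext => n /=; exact: rho_central.
Qed.

Let scal_eq (u : cseq) (c : R[i]) (d : nat -> rat[i]) f :
  (forall n (q : rat[i]), P (u n) (K q) <= Normc.normc (ratc R (d n - q))) ->
  null f -> (forall n, Normc.normc (ratc R (d n) - c) <= f n) ->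
  cclass u = cclass (cscal c).
Proof.
move=> ud f0 df; apply/cclass_eqP; apply: null_le (nullD f0 eps0) _ => n.
rewrite rho_ge0/=; apply: le_trans (ud _ _) _; rewrite ratcB.
have -> : ratc R (d n) - ratc R (approx c n) =
    (ratc R (d n) - c) - (ratc R (approx c n) - c) by ring.
by apply: le_trans (normcD _ _) _; rewrite normcN lerD// ltW// approx_lt.
Qed.

Let scal_rat (q : rat[i]) : cclass (cscal (ratc R q)) = dconst (K q).
Proof.
apply/esym/(scal_eq (d := fun=> q) _ null0) => n; last by rewrite subrr Normc.normc0.
by move=> r; exact: rho_constB.
Qed.

Let scalD c d : cclass (cscal (c + d)) = cclass (cscal c) + cclass (cscal d).
Proof.
rewrite dE'; apply/esym/(scal_eq (d := fun n => approx c n + approx d n) _ (nullD eps0 eps0)) => n.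
  by move=> q; exact: rho_constD.
rewrite ratcD opprD addrACA; apply: le_trans (normcD _ _) _.
by rewrite lerD// ltW// approx_lt.
Qed.

Let scalM c d : cclass (cscal (c * d)) = dmul (cclass (cscal c)) (cclass (cscal d)).
Proof.
rewrite dE; pose f n := (Normc.normc c + 1) * eps n + Normc.normc d * eps n.
apply/esym/(scal_eq (d := fun n => approx c n * approx d n) (f := f)) => [n q||n].
- exact: rho_constM.
- by apply: nullD; exact: nullM.
- rewrite ratcM.
  have -> : ratc R (approx c n) * ratc R (approx d n) - c * d =
    ratc R (approx c n) * (ratc R (approx d n) - d) + d * (ratc R (approx c n) - c) by ring.
  apply: le_trans (normcD _ _) _; rewrite !normcM; apply: lerD.
    apply: ler_pM; rewrite ?normc_ge0// ?(ltW (approx_lt _ _))//.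
    rewrite -[X in Normc.normc X](subrK c) addrC.
    apply: le_trans (normcD _ _) _; rewrite lerD2l ltW//.
    apply: lt_le_trans (approx_lt _ _) _.
    by rewrite invf_le1// ler1n.
  by rewrite ler_wpM2l ?normc_ge0// ltW// approx_lt.
Qed.

Let scal_star c : dstar (cclass (cscal c)) = cclass (cscal (conjc c)).
Proof.
rewrite dE; apply: (scal_eq (d := fun n => conjc (approx c n)) _ eps0) => n.
  by move=> q; exact: rho_constS.
by rewrite ratc_conj -rmorphB normc_conj ltW// approx_lt.
Qed.

Fact dscaleA k l x : dscale k (dscale l x) = dscale (k * l) x.
Proof. by rewrite /dscale dmulA -scalM. Qed.

Fact dscale1 : left_id 1 dscale.
Proof. by move=> x; rewrite /dscale -(ratc1 R) scal_rat dmul1x. Qed.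

Fact dscaleDr : right_distributive dscale +%R.
Proof. by move=> k x y; rewrite /dscale dmulDr. Qed.

Fact dscaleDl x : {morph dscale^~ x : k l / k + l}.
Proof. by move=> k l; rewrite /dscale scalD dmulDl. Qed.

HB.instance Definition _ := GRing.Zmodule_isLmodule.Build (cplx R) completion
  dscaleA dscale1 dscaleDr dscaleDl.

Let cn x : R := cnorm (crep x).

Let cnE u : cn (cclass u) = cnorm u.
Proof. by have := dnormE u => -[]. Qed.

Let cnD x y : cn (x + y) <= cn x + cn y.
Proof.
elim/cclassP: x => a; elim/cclassP: y => b; rewrite dclassD !cnE.
apply: ler_cvg_to (@N_lim _) (cvgD (@N_lim a) (@N_lim b)) _.
by apply: nearW => n; exact: N_add.
Qed.

Let cnM x y : cn (dmul x y) <= cn x * cn y.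
Proof.
elim/cclassP: x => a; elim/cclassP: y => b; rewrite dmulE !cnE.
apply: ler_cvg_to (@N_lim _) (cvgM (@N_lim a) (@N_lim b)) _.
by apply: nearW => n; exact: N_mul.
Qed.

Let cn_cstar x : cn (dmul (dstar x) x) = cn x ^+ 2.
Proof.
elim/cclassP: x => a; rewrite !dE !cnE; apply: cnormE.
under eq_fun do rewrite N_cstar expr2.
by rewrite expr2; apply: cvgM; exact: N_lim.
Qed.

Let cn_ge0 x : 0 <= cn x.
Proof.
elim/cclassP: x => a; rewrite cnE; apply: ler_cvg_to (cvg_cst 0) (@N_lim a) _.
by apply: nearW => n; exact: N_ge0.
Qed.

Let cn_scal c : cn (cclass (cscal c)) <= Normc.normc c.
Proof.
rewrite cnE; rewrite -[leRHS]addr0.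
apply: ler_cvg_to (@N_lim _) (cvgD (cvg_cst _) eps0) _.
apply: nearW => n; apply: le_trans (N_const _) _.
rewrite -[X in Normc.normc X](subrK c) addrC.
by apply: le_trans (normcD _ _) _; rewrite lerD2l ltW// approx_lt.
Qed.

Let cnZ_le (c : R[i]) x : cn (c *: x) <= Normc.normc c * cn x.
Proof.
by apply: le_trans (cnM _ _) _; rewrite ler_wpM2r ?cn_scal ?cn_ge0.
Qed.

Let cnZ (c : R[i]) x : cn (c *: x) = Normc.normc c * cn x.
Proof.
apply/eqP; rewrite eq_le cnZ_le /=.
have [->|c0] := eqVneq c 0; first by rewrite Normc.normc0 mul0r.
have nc0 : 0 < Normc.normc c.
  by rewrite lt_neqAle normc_ge0 andbT eq_sym; apply: contra c0 => /eqP/Normc.eq0_normc ->.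
rewrite -[x in leLHS]scale1r -(mulVf c0) -scalerA mulrC -ler_pdivlMr//.
by rewrite mulrC -Normc.normcV; exact: cnZ_le.
Qed.

Fact dnormD x y : dnorm (x + y) <= dnorm x + dnorm y.
Proof. by rewrite /dnorm -rmorphD/= lecR cnD. Qed.

Fact dnormZ (k : cplx R) x : dnorm (k *: x) = `|k| * dnorm x.
Proof. by rewrite /dnorm -normcE -rmorphM; congr (_ %:C)%C; exact: cnZ. Qed.

Fact dnorm0_eq0 x : dnorm x = 0 -> x = 0.
Proof.
move=> [] x0; rewrite -[x]crepK; apply/cclass_eqP; rewrite /null -x0.
exact: N_lim.
Qed.

HB.instance Definition _ := Lmodule_isNormed.Build (cplx R) completion
  dnormD dnormZ dnorm0_eq0.

Let norm_cn x : `|x| = (cn x)%:C%C.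
Proof. by []. Qed.

Let dclassB (u v : cseq) : cclass u - cclass v =
  dadd (cclass u) (dmul (dconst (K (-1))) (cclass v)).
Proof. by []. Qed.

Let dist_cvg (u v : cseq) : P (u n) (v n) @[n --> \oo] --> cn (cclass u - cclass v).
Proof.
rewrite dclassB dmulE daddE cnE.
by under eq_fun do rewrite -N_sub; exact: (@N_lim (cadd u (cmulr (cconst (K (-1))) v))).
Qed.

Let dist_le (u v : cseq) (e : R) : (\forall n \near \oo, P (u n) (v n) <= e) ->
  `|cclass u - cclass v| <= e%:C%C.
Proof.
move=> uv; rewrite norm_cn lecR; apply: ler_cvg_to (@dist_cvg u v) (cvg_cst e) _.
exact: uv.
Qed.

Let dist_const p q : `|dconst p - dconst q| = (P p q)%:C%C.
Proof.
rewrite norm_cn; congr (_ %:C)%C; have := @dist_cvg (cconst p) (cconst q).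
move=> /(cvg_lim (@Rhausdorff R)) <-; rewrite /=; apply: cvg_lim; last exact: cvg_cst.
exact: Rhausdorff.
Qed.

Let const_dense x (e : R) : 0 < e -> exists p, `|x - dconst p| < e%:C%C.
Proof.
elim/cclassP: x => u e0; have e2 : 0 < e / 2 by rewrite divr_gt0.
have [M uM] := cvalP u e2; exists (u M).
apply: (@le_lt_trans _ _ (e / 2)%:C%C); last by rewrite ltcR; lra.
by apply: dist_le; exists M => // n Mn; apply/ltW/uM.
Qed.

Fact completion_complete (F : set_system completion) :
  ProperFilter F -> cauchy F -> cvg F.
Proof.
move=> FF /(@cauchyP (cplx R) completion F FF) Fc.
have /choice[p Fp] n : exists p, F (ball (dconst p) (eps n)%:C%C).
  have e2 : 0 < eps n / 2 by rewrite divr_gt0// invr_gt0.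
  have [|y Fy] := Fc (eps n / 2)%:C%C; first by rewrite ltcR.
  have [p yp] := const_dense y e2; exists p.
  apply: filterS Fy => z; rewrite -!ball_normE/= => yz.
  have -> : dconst p - z = (y - z) - (y - dconst p) by rewrite opprB [RHS]addrC subrKA.
  apply: le_lt_trans (ler_normB _ _) _.
  by rewrite [eps n]splitr rmorphD/= ltrD.
have pp m n : P (p m) (p n) < eps m + eps n.
  have [z []] := filter_ex (filterI (Fp m) (Fp n)).
  rewrite -!ball_normE/= => zm zn; rewrite -ltcR -dist_const rmorphD/=.
  have -> : dconst (p m) - dconst (p n) = (dconst (p m) - z) - (dconst (p n) - z).
    by rewrite opprB subrKA.
  exact: le_lt_trans (ler_normB _ _) (ltrD zm zn).
have pc (e : R) : 0 < e -> exists M, forall m n, (M <= m)%N -> (M <= n)%N ->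
    P (p m) (p n) < e.
  move=> e0; have e2 : 0 < e / 2 by rewrite divr_gt0.
  have [M epsM] := eps_small e2; exists M => m n Mm Mn.
  by apply: lt_trans (pp m n) _; rewrite [e]splitr ltrD// epsM.
pose l := cclass (CSeq pc).
have pl n : `|dconst (p n) - l| <= (eps n + eps n)%:C%C.
  apply: dist_le; exists n => // k nk /=.
  by apply: le_trans (ltW (pp _ _)) _; rewrite lerD2l eps_le.
apply/cvg_ex; exists l; apply/fcvgrPdist_lt => e e0.
have ee : e = (complex.Re e)%:C%C by rewrite RRe_real// gtr0_real.
have e3 : 0 < complex.Re e / 3 by rewrite divr_gt0// -ltcR -ee.
have [M epsM] := eps_small e3; have {}epsM := epsM _ (leqnn M).
apply: filterS (Fp M) => z; rewrite -ball_normE/= => zM.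
have -> : l - z = (dconst (p M) - z) - (dconst (p M) - l).
  by rewrite opprB [RHS]addrC subrKA.
apply: le_lt_trans (ler_normB _ _) _.
apply: lt_trans (ltr_leD zM (pl M)) _.
by rewrite ee -rmorphD/= ltcR; lra.
Qed.

HB.instance Definition _ := Uniform_isComplete.Build completion
  completion_complete.

Fact dmulZl (c : R[i]) x y : dmul (c *: x) y = c *: dmul x y.
Proof. exact: esym (dmulA _ _ _). Qed.

Fact dmulZr (c : R[i]) x y : dmul x (c *: y) = c *: dmul x y.
Proof.
by apply: etrans (dmulA _ _ _) _; rewrite -scal_central; exact: esym (dmulA _ _ _).
Qed.

Fact done_neq0 : dconst (K 1) <> 0.
Proof.
move=> e; have := dist_const (K 1) (K 0); rewrite e subrr normr0 => -[N1].
by have := rho_one P; rewrite -N1 ler10.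
Qed.

Fact dstarZ (c : R[i]) x : dstar (c *: x) = conjc c *: dstar x.
Proof. by apply: etrans (dstarM _ _) _; rewrite scal_star -scal_central. Qed.

Fact dmul_norm x y : `|dmul x y| <= `|x| * `|y|.
Proof. by rewrite !norm_cn -rmorphM/= lecR cnM. Qed.

Fact dstar_identity x : `|dmul (dstar x) x| = `|x| ^+ 2.
Proof. by rewrite !norm_cn cn_cstar rmorphXn. Qed.

HB.instance Definition _ := isCstarAlgebra.Build R completion
  dmulA dmul1x dmulx1 dmulDl dmulDr dmulZl dmulZr done_neq0
  dstarD dstarZ dstarM dstarK dmul_norm dstar_identity.

Lemma peval_completion p :
  peval (fun n => dconst (SVar n) : completion) p = dconst p.
Proof.
elim: p => //= [c|p -> q ->|p -> q ->|p ->].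
- by apply: etrans (dmulx1 _) _; exact: scal_rat.
- by apply: etrans (dclassD _ _) _; apply: cclass_ext => n /=.
- by apply: etrans (dmulE _ _) _; apply: cclass_ext => n /=.
- by apply: etrans (dstarE _) _; apply: cclass_ext => n /=.
Qed.

Lemma norm_completion p : `|dconst p : completion| = (P p (K 0))%:C%C.
Proof. by rewrite -dist_const subr0. Qed.

End Completion.

(** * Derivable inequalities *)

Ltac computability_hook ::=
  lazymatch goal with
  | |- computable pfst => exact: computable_pfst (@computable_id _ _)
  | |- computable psnd => exact: computable_psnd (@computable_id _ _)
  | |- computable (fun e => pfst _) => apply: computable_pfst; computability
  | |- computable (fun e => psnd _) => apply: computable_psnd; computability
  | |- computable (fun e => poly_code (@?f e)) =>
      change (computable (fun e => code (f e))); apply: computable_code; computability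
  | |- computable (fun e => SConst _) => apply: computable_SConst; computability
  | |- computable (fun e => SVar _) => apply: computable_SVar; computability
  | |- computable (fun e => SAdd _ _) => apply: computable_SAdd; computability
  | |- computable (fun e => SMul _ _) => apply: computable_SMul; computability
  | |- computable (fun e => SStar _) => apply: computable_SStar; computability
  | |- computable (fun e => starpoly_decode _) =>
      apply: computable_starpoly_decode; computability
  | |- computable (fun e => gauss_decode _) =>
      apply: computable_gauss_decode; computability
  | |- computable (fun e => rat_decode _) =>
      apply: computable_rat_decode; computability
  | |- computable (fun e => complex.Re _) => apply: computable_Re; computability
  | |- computable (fun e => complex.Im _) => apply: computable_Im; computability
  | |- computable (fun e => tget _ _) => apply: computable_tget; computability
  | |- computable (fun e => starpoly_subst _ _) =>
      apply: computable_subst; computability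
  | |- computable (fun e => nth _ _ _) => apply: computable_nth; computability
  | |- computable (fun e => (_ + _)%R) => apply: computable_addq; computability
  | |- computable (fun e => (_ * _)%R) => apply: computable_mulq; computability
  | |- computable (fun e => (- _)%R) => apply: computable_oppq; computability
  | |- computable (fun e => (_ <= _)%R) =>
      apply: computable_leq_rat; computability
  | |- computable (fun e => _^-1) => apply: computable_invn; computability
  | |- _ => idtac
  end.

Definition judgement : Type := starpoly nat * starpoly nat * rat.

Section Derivations.
Variable X : finite_relations.
Local Notation K := (@SConst nat).

Definition lift_poly (p : starpoly 'I_(fp_ngen X)) : starpoly nat :=
  starpoly_subst (fun k : 'I_(fp_ngen X) => SVar (k : nat)) p.

Definition relation_judgements : seq judgement :=
  (SVar (fp_unit X : nat), K 1, 0) ::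
  [seq (lift_poly (fp_rel i), K 0, 0) | i <- enum 'I_(fp_nrel X)] ++
  [seq (SVar (k : nat), K 0, fp_bound k) | k : 'I_(fp_ngen X) <- enum 'I_(fp_ngen X)].

Definition trivial_judgement : judgement := (K 0, K 0, 0).

(* [|conj(a) b + c - d| <= r] *)
Definition const_condition (a b c d : rat[i]) (r : rat) : bool :=
  (0 <= r) &&
  ((complex.Re a * complex.Re b + complex.Im a * complex.Im b + complex.Re c - complex.Re d) *
   (complex.Re a * complex.Re b + complex.Im a * complex.Im b + complex.Re c - complex.Re d) +
   (complex.Re a * complex.Im b - complex.Im a * complex.Re b + complex.Im c - complex.Im d) *
   (complex.Re a * complex.Im b - complex.Im a * complex.Re b + complex.Im c - complex.Im d)
     <= r * r).

(* A judgement [(p, q, r)] stands for the inequality [|p(x) - q(x)| <= r]. The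
   last rule infers [|a| <= r] from [|a^* a| <= r^2], which makes the infimum of
   the derivable bounds a C*-seminorm. *)
Definition derive (w : nat) (J J' : judgement) : judgement :=
  let k := pfst w in let m := psnd w in
  if k == 0%N then
    (starpoly_subst (tget (psnd m)) (nth (K 0, K 0) axiom_templates (pfst m)).1,
     starpoly_subst (tget (psnd m)) (nth (K 0, K 0) axiom_templates (pfst m)).2, 0)
  else if k == 1%N then
    (SMul (K (gauss_decode (pfst m))) (starpoly_decode (psnd m)),
     SMul (starpoly_decode (psnd m)) (K (gauss_decode (pfst m))), 0)
  else if k == 2%N then
    let a := gauss_decode (pfst m) in let m := psnd m in
    let b := gauss_decode (pfst m) in let m := psnd m in
    let c := gauss_decode (pfst m) in let m := psnd m in
    let d := gauss_decode (pfst m) in let r := rat_decode (psnd m) in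
    if const_condition a b c d r then
      (SAdd (SMul (SStar (K a)) (K b)) (K c), K d, r)
    else trivial_judgement
  else if k == 3%N then nth trivial_judgement relation_judgements m
  else if k == 4%N then
    if (fp_ngen X <= m)%N then (SVar m, K 0, 0) else trivial_judgement
  else if k == 5%N then (J.1.2, J.1.1, J.2)
  else if k == 6%N then
    if poly_code J.1.2 == poly_code J'.1.1 then (J.1.1, J'.1.2, J.2 + J'.2)
    else trivial_judgement
  else if k == 7%N then (SAdd J.1.1 J'.1.1, SAdd J.1.2 J'.1.2, J.2 + J'.2)
  else if k == 8%N then
    if poly_code J.1.2 == poly_code (K 0) then
      (SMul J.1.1 J'.1.1, SMul J.1.1 J'.1.2, J.2 * J'.2)
    else trivial_judgement
  else if k == 9%N then
    if poly_code J'.1.2 == poly_code (K 0) then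
      (SMul J.1.1 J'.1.1, SMul J.1.2 J'.1.1, J.2 * J'.2)
    else trivial_judgement
  else if k == 10%N then (SStar J.1.1, SStar J.1.2, J.2)
  else
    let a := starpoly_decode (pfst m) in let r := rat_decode (psnd m) in
    if [&& poly_code J.1.1 == poly_code (SMul (SStar a) a),
           poly_code J.1.2 == poly_code (K 0), 0 <= r & J.2 <= r * r] then
      (a, K 0, r)
    else trivial_judgement.

Lemma computable_derive : computable (fun x => derive x.1 x.2.1 x.2.2).
Proof. by rewrite /derive /const_condition; cbv zeta; computability. Qed.

Inductive derivable : judgement -> Prop :=
| derivable_trivial : derivable trivial_judgement
| derivable_derive w J J' :
    derivable J -> derivable J' -> derivable (derive w J J').

Lemma derivable_enum : exists e : nat -> judgement,
  [/\ computable e, forall n, derivable (e n) &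
      forall J, derivable J -> exists n, e n = J].
Proof.
have [e [ce e0 e_derive e_ind]] := computable_closure trivial_judgement computable_derive.
exists e; split=> // [n|J].
  by apply: (e_ind derivable); [exact: derivable_trivial|exact: derivable_derive].
elim=> [|w J1 J2 _ [i <-] _ [j <-]]; first by exists 0%N.
exact: e_derive.
Qed.

Let deriveP k m J J' : derivable J -> derivable J' ->
  derivable (derive (pair_code k m) J J').
Proof. exact: derivable_derive. Qed.

(* Otherwise [/=] unfolds the codes of constants to large numerals. *)
Local Arguments poly_code : simpl never.
Local Arguments pair_code : simpl never.

Let unpair := (pair_codeKfst, pair_codeKsnd).

Lemma derivable_axiom i (s : nat -> starpoly nat) : (i < size axiom_templates)%N ->
  let t := nth (K 0, K 0) axiom_templates i in
  derivable (starpoly_subst s t.1, starpoly_subst s t.2, 0).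
Proof.
move=> i13 /=; have [u uE] := tget_ex s 3.
have := deriveP 0 (pair_code i u) derivable_trivial derivable_trivial.
rewrite /derive !unpair /=.
have uE0 : tget u 0 = s 0%N by exact: uE.
have uE1 : tget u 1 = s 1%N by exact: uE.
have uE2 : tget u 2 = s 2%N by exact: uE.
by do 13 (case: i i13 => [_|i i13]; first by rewrite /starpoly_subst /= ?uE0 ?uE1 ?uE2).
Qed.

Lemma derivable_central c p :
  derivable (SMul (K c) p, SMul p (K c), 0).
Proof.
have := deriveP 1 (pair_code (coded_gauss c) (poly_code p)) derivable_trivial derivable_trivial.
by rewrite /derive !unpair /= gauss_codeK poly_codeK.
Qed.

Lemma derivable_const a b c d r : const_condition a b c d r ->
  derivable (SAdd (SMul (SStar (K a)) (K b)) (K c), K d, r).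
Proof.
move=> h; have := deriveP 2 (pair_code (coded_gauss a) (pair_code (coded_gauss b)
  (pair_code (coded_gauss c) (pair_code (coded_gauss d) (rat_code r)))))
  derivable_trivial derivable_trivial.
by rewrite /derive !unpair /= !gauss_codeK rat_codeK h.
Qed.

Lemma derivable_relation J : List.In J relation_judgements -> derivable J.
Proof.
move=> JX; have [n <-] : exists n, nth trivial_judgement relation_judgements n = J.
  elim: relation_judgements JX => //= J' s IHs [->|/IHs[n nJ]]; first by exists 0%N.
  by exists n.+1.
have := deriveP 3 n derivable_trivial derivable_trivial.
by rewrite /derive !unpair.
Qed.

Lemma derivable_unit : derivable (SVar (fp_unit X : nat), K 1, 0).
Proof. by apply: derivable_relation; left. Qed.

Lemma derivable_rel i : derivable (lift_poly (fp_rel i), K 0, 0).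
Proof.
apply: derivable_relation; right; apply: List.in_or_app; left.
apply: (List.in_map (fun i => (lift_poly (fp_rel i), K 0, 0) : judgement)).
have : i \in enum 'I_(fp_nrel X) by rewrite mem_enum.
by elim: (enum _) => //= k s IHs; rewrite inE => /orP[/eqP ->|/IHs]; [left|right].
Qed.

Lemma derivable_bound (k : 'I_(fp_ngen X)) : derivable (SVar (k : nat), K 0, fp_bound k).
Proof.
apply: derivable_relation; right; apply: List.in_or_app; right.
apply: (List.in_map (fun k : 'I_(fp_ngen X) => (SVar (k : nat), K 0, fp_bound k) : judgement)).
have : k \in enum 'I_(fp_ngen X) by rewrite mem_enum.
by elim: (enum _) => //= l s IHs; rewrite inE => /orP[/eqP ->|/IHs]; [left|right].
Qed.

Lemma derivable_pad n : (fp_ngen X <= n)%N -> derivable (SVar n, K 0, 0).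
Proof.
move=> h; have := deriveP 4 n derivable_trivial derivable_trivial.
by rewrite /derive !unpair /= h.
Qed.

Lemma derivable_sym p q r : derivable (p, q, r) -> derivable (q, p, r).
Proof.
by move=> h; have := deriveP 5 0 h derivable_trivial; rewrite /derive !unpair.
Qed.

Lemma derivable_trans q p p' r r' : derivable (p, q, r) -> derivable (q, p', r') ->
  derivable (p, p', r + r').
Proof.
by move=> h h'; have := deriveP 6 0 h h'; rewrite /derive !unpair /= ?eqxx.
Qed.

Lemma derivable_add p q p' q' r r' : derivable (p, q, r) -> derivable (p', q', r') ->
  derivable (SAdd p p', SAdd q q', r + r').
Proof.
by move=> h h'; have := deriveP 7 0 h h'; rewrite /derive !unpair.
Qed.

Lemma derivable_mull c p q M r : derivable (c, K 0, M) -> derivable (p, q, r) ->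
  derivable (SMul c p, SMul c q, M * r).
Proof.
by move=> h h'; have := deriveP 8 0 h h'; rewrite /derive !unpair /= ?eqxx.
Qed.

Lemma derivable_mulr c p q M r : derivable (p, q, r) -> derivable (c, K 0, M) ->
  derivable (SMul p c, SMul q c, r * M).
Proof.
by move=> h h'; have := deriveP 9 0 h h'; rewrite /derive !unpair /= ?eqxx.
Qed.

Lemma derivable_star p q r : derivable (p, q, r) ->
  derivable (SStar p, SStar q, r).
Proof.
by move=> h; have := deriveP 10 0 h derivable_trivial; rewrite /derive !unpair.
Qed.

Lemma derivable_cstar p r r' : derivable (SMul (SStar p) p, K 0, r) ->
  0 <= r' -> r <= r' * r' -> derivable (p, K 0, r').
Proof.
move=> h r0 rr.
have [m [mp mr]] : exists m, starpoly_decode (pfst m) = p /\ rat_decode (psnd m) = r'.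
  by exists (pair_code (poly_code p) (rat_code r')); rewrite !unpair poly_codeK rat_codeK.
have := deriveP 11 m h derivable_trivial; rewrite /derive !unpair mp mr.
rewrite [X in derivable X -> _]ifT//.
by apply/and4P; split => //; apply/eqP.
Qed.

Let axm i a b c (s := nth (K 0) [:: a; b; c]) (h : (i < 13)%N) := @derivable_axiom i s h.

Lemma derivable_bounded p : exists r, derivable (p, K 0, r).
Proof.
elim: p => [c|n|p [r pr] q [s qs]|p [r pr] q [s qs]|p [r pr]].
- pose r := Num.max 1 (complex.Re c * complex.Re c + complex.Im c * complex.Im c).
  have r1 : 1 <= r by rewrite le_max lexx.
  have h : derivable (SAdd (SMul (SStar (K 0)) (K 0)) (K c), K 0, r).
    apply: derivable_const; rewrite /const_condition /= !(mulr0, mul0r, addr0, add0r, subr0, subrr).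
    rewrite (le_trans ler01 r1)/=; apply: (@le_trans _ _ r).
      by rewrite le_max lexx orbT.
    by rewrite ler_peMl// (le_trans ler01 r1).
  have h' : derivable (SAdd (SMul (SStar (K 0)) (K 0)) (K c), K c, 0).
    apply: derivable_const; rewrite /const_condition /= !(mulr0, mul0r, addr0, add0r, subr0, subrr).
    by rewrite ?lexx.
  by exists (0 + r); exact: derivable_trans (derivable_sym h') h.
- case: (ltnP n (fp_ngen X)) => nj; last by exists 0; exact: derivable_pad.
  by exists (fp_bound (Ordinal nj)); exact: derivable_bound (Ordinal nj).
- exists (r + s + 0); apply: derivable_trans (derivable_add pr qs) _.
  exact: (@axm 2 (K 0) (K 0) (K 0)).
- exists (r * s + 0); apply: derivable_trans (derivable_mull pr qs) _.
  exact: (@axm 11 p p p).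
- exists (r + 0); apply: derivable_trans (derivable_star pr) _.
  exact: (@axm 12 p p p).
Qed.

End Derivations.

Lemma peval_subst (R : realType) (D : cstarType R) V W (z : W -> D)
    (s : V -> starpoly W) p :
  peval z (starpoly_subst s p) = peval (fun v => peval z (s v)) p.
Proof. by elim: p => //= [p -> q ->|p -> q ->|p ->]. Qed.

Lemma peval_ext (R : realType) (D : cstarType R) V (y z : V -> D) p :
  (forall v, y v = z v) -> peval y p = peval z p.
Proof. by move=> /funext ->. Qed.

Lemma peval_axiom (R : realType) (D : cstarType R) (z : nat -> D) i :
  peval z (nth (SConst 0, SConst 0) axiom_templates i).1 =
  peval z (nth (SConst 0, SConst 0) axiom_templates i).2.
Proof.
have N1 : ratc R (-1) = -1 by rewrite ratcN ratc1.
case: i => [|[|[|[|[|[|[|[|[|[|[|[|[|i]]]]]]]]]]]]] /=;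
  rewrite ?ratc0 ?ratc1 ?N1 ?scale0r ?scale1r.
- by rewrite addrA.
- by rewrite addrC.
- by rewrite addr0.
- by rewrite cmulZl cmul1x scaleN1r subrr.
- by rewrite cmulA.
- by rewrite cmulDr.
- by rewrite cmulDl.
- by rewrite cmul1x.
- by rewrite starD.
- by rewrite starM.
- by rewrite starK.
- by rewrite cmul0r.
- by rewrite star0.
- by rewrite nth_nil.
Qed.

Lemma const_conditionP (R : realType) a b c d r : const_condition a b c d r ->
  Normc.normc (ratc R (conjc a * b + c - d)) <= ratr r.
Proof.
case/andP => r0; case: a b c d => a a' [b b'] [c c'] [d d'] h.
rewrite [ratc _ _]/ratc [Normc.normc _]/= -[leRHS]ger0_norm ?ler0q//.
rewrite -sqrtr_sqr ler_wsqrtr// -!rmorphXn -rmorphD/= ler_rat.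
apply: le_trans h; rewrite /= !expr2 le_eqVlt; apply/orP; left; apply/eqP.
ring.
Qed.

Lemma const_condition_complete (R : realType) a b c d r : 0 <= r ->
  Normc.normc (ratc R (conjc a * b + c - d)) <= ratr r ->
  const_condition a b c d r.
Proof.
move=> r0; case: a b c d => a a' [b b'] [c c'] [d d'].
rewrite [ratc _ _]/ratc [Normc.normc _]/= -[leRHS]ger0_norm ?ler0q//.
rewrite -sqrtr_sqr ler_sqrt ?sqr_ge0// -!rmorphXn -rmorphD/= ler_rat => h.
rewrite /const_condition r0; apply: le_trans h.
rewrite /= !expr2 le_eqVlt; apply/orP; left; apply/eqP.
ring.
Qed.

Section Soundness.
Variables (R : realType) (X : finite_relations) (A : cstarType R).
Variable x : 'I_(fp_ngen X) -> A.
Hypothesis xX : approx_rep 0 x.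

Definition sound (J : judgement) : Prop :=
  nrm (peval (pad x) J.1.1 - peval (pad x) J.1.2) <= ratr J.2.

Lemma peval_lift p : peval (pad x) (lift_poly p) = peval x p.
Proof. by rewrite /lift_poly peval_subst; apply: peval_ext => k; rewrite /= /pad valK. Qed.

Let sound_eq p q : peval (pad x) p = peval (pad x) q -> sound (p, q, 0).
Proof. by move=> pq; rewrite /sound/= pq subrr nrm0 rmorph0. Qed.

Let sound0 p r : nrm (peval (pad x) p) <= ratr r -> sound (p, SConst 0, r).
Proof. by rewrite /sound/= ratc0 scale0r subr0. Qed.

Let soundP p r : sound (p, SConst 0, r) -> nrm (peval (pad x) p) <= ratr r.
Proof. by rewrite /sound/= ratc0 scale0r subr0. Qed.

Lemma sound_relation n : sound (nth (trivial_judgement) (relation_judgements X) n).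
Proof.
have [xu xr xb] := xX.
have all_nth (s : seq judgement) k : (forall J, List.In J s -> sound J) ->
    sound (nth trivial_judgement s k).
  elim: s k => [|J s IHs] [|k] sJ /=; try exact: sound_eq.
    by apply: sJ; left.
  by apply: IHs => J' J's; apply: sJ; right.
apply: all_nth => J [<-|].
  by apply: sound_eq; rewrite /= ratc1 scale1r -xu /pad valK.
move=> /(@List.in_app_or _ _ _ _)[|] /List.in_map_iff[k [<- _]].
  apply: sound0; rewrite peval_lift rmorph0 -lecR nrmE.
  exact: xr.
apply: sound0; rewrite /= /pad valK -lecR nrmE.
by have := xb k; rewrite addr0.
Qed.

Lemma derive_sound w J J' : sound J -> sound J' -> sound (derive X w J J').
Proof.
have triv : sound trivial_judgement by exact: sound_eq.
case: J => -[p q] r; case: J' => -[p' q'] r' h h'; rewrite /derive.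
case: ifP => _.
  by apply: sound_eq; rewrite !peval_subst peval_axiom.
case: ifP => _.
  by apply: sound_eq; rewrite /= cmulZl cmulZr cmul1x cmulx1.
case: ifP => _.
  case: ifP => // /const_conditionP-/(_ R) hc; apply: le_trans hc.
  rewrite [X in nrm X]/= starZ star_one cmulZl cmul1x scalerA -scalerDl -scalerBl nrmZ nrm_one.
  by rewrite mulr1 ratcB ratcD ratcM ratc_conj.
case: ifP => _; first exact: sound_relation.
case: ifP => _.
  case: ifP => // jn; apply: sound0; rewrite /= /pad insubF ?nrm0 ?rmorph0//.
  by apply/negbTE; rewrite -leqNgt.
case: ifP => _; first by rewrite /sound/= nrmB.
case: ifP => _.
  case: ifP => //= /eqP/(can_inj poly_codeK) qp.
  rewrite /sound/= rmorphD/=; apply: le_trans (nrm_triangle (peval (pad x) q) _ _) _.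
  by apply: lerD => //; rewrite qp.
case: ifP => _.
  rewrite /sound/= rmorphD/= opprD addrACA.
  by apply: le_trans (nrmD _ _) _; exact: lerD.
case: ifP => _.
  case: ifP => // /eqP q0; have {}q0 : q = SConst 0 by exact: can_inj poly_codeK _ _ q0.
  rewrite /sound/= rmorphM/= -cmulBr; apply: le_trans (nrmM _ _) _.
  by apply: ler_pM; rewrite ?nrm_ge0//; apply: soundP; rewrite -q0.
case: ifP => _.
  case: ifP => // /eqP q0; have {}q0 : q' = SConst 0 by exact: can_inj poly_codeK _ _ q0.
  rewrite /sound/= rmorphM/= -cmulBl; apply: le_trans (nrmM _ _) _.
  by apply: ler_pM; rewrite ?nrm_ge0//; apply: soundP; rewrite -q0.
case: ifP => _; first by rewrite /sound/= -starB nrm_star.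
set a := starpoly_decode _; set t := rat_decode _.
case: ifP => // /and4P[/eqP pa /eqP q0 t0 rt].
have {}pa : p = SMul (SStar a) a by exact: can_inj poly_codeK _ _ pa.
have {}q0 : q = SConst 0 by exact: can_inj poly_codeK _ _ q0.
move: h; rewrite pa q0 => /soundP h; apply: sound0.
rewrite -(@ler_pXn2r _ 2)// ?nnegrE ?nrm_ge0 ?ler0q// -nrm_cstar.
by apply: le_trans h _; rewrite -rmorphXn ler_rat expr2.
Qed.

Lemma derivable_sound J : derivable X J -> sound J.
Proof.
elim=> [|w J1 J2 _ s1 _ s2]; first exact: sound_eq.
exact: derive_sound.
Qed.

End Soundness.

Lemma le_mul_of_lt (R : realType) (x a b : R) : 0 <= a -> 0 <= b ->
  (forall s t, a < s -> b < t -> x <= s * t) -> x <= a * b.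
Proof.
move=> a0 b0 xst; apply/ler_addgt0Pr => e e0.
pose d := Num.min 1 (e / (a + b + 1)).
have ab0 : 0 < a + b + 1 by rewrite ltr_wpDl ?addr_ge0.
have d0 : 0 < d by rewrite lt_min ltr01 divr_gt0.
have d1 : d <= 1 by rewrite ge_min lexx.
have de : d * (a + b + 1) <= e by rewrite -ler_pdivlMr// ge_min lexx orbT.
have := xst (a + d) (b + d); rewrite !ltrDl => /(_ d0 d0) /le_trans; apply.
have : d * d <= d * 1 by rewrite ler_pM2l.
lra.
Qed.

Section UpperBounds.
Variables (R : realType) (X : finite_relations) (A : cstarType R).
Variable x : 'I_(fp_ngen X) -> A.
Hypothesis ux : is_universal x.
Local Notation K := (@SConst nat).

Let xX : approx_rep 0 x. Proof. by case: ux. Qed.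

Definition derivable_dist (p q : starpoly nat) : R :=
  inf [set ratr r | r in [set r | derivable X (p, q, r)]].

Local Notation rho := derivable_dist.

Let der_ge0 p q r : derivable X (p, q, r) -> 0 <= r.
Proof.
move=> /(derivable_sound xX) h; rewrite -(@ler0q R); apply: le_trans h.
exact: nrm_ge0.
Qed.

Let der_has_inf p q : has_inf [set (ratr r : R) | r in [set r | derivable X (p, q, r)]].
Proof.
split; last by exists 0 => _ [r /der_ge0 r0 <-]; rewrite ler0q.
have [r pr] := derivable_bounded X p; have [s qs] := derivable_bounded X q.
exists (ratr (r + s)); exists (r + s) => //.
exact: derivable_trans pr (derivable_sym qs).
Qed.

Let rho_der p q r : derivable X (p, q, r) -> rho p q <= ratr r.
Proof.
move=> h; apply: ge_inf; last by exists r.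
by have [] := der_has_inf p q.
Qed.

Let rho_lt p q t : rho p q < t -> exists2 r, derivable X (p, q, r) & ratr r < t.
Proof.
move=> pqt; have [_ [r pqr <-] rt] := inf_lt (der_has_inf p q).1 pqt.
by exists r.
Qed.

Let rho_ge0 p q : 0 <= rho p q.
Proof.
apply: lb_le_inf; first by have [] := der_has_inf p q.
by move=> _ [r /der_ge0 r0 <-]; rewrite ler0q.
Qed.

Let rho_le p q a : (forall t, a < t -> exists2 r, derivable X (p, q, r) & ratr r <= t) ->
  rho p q <= a.
Proof.
move=> h; apply/ler_addgt0Pr => e e0.
have [|r pqr re] := h (a + e); first by rewrite ltrDl.
exact: le_trans (rho_der pqr) re.
Qed.

Let rho_der0 p q : derivable X (p, q, 0) -> rho p q = 0.
Proof.
move=> h; apply/eqP; rewrite eq_le rho_ge0 andbT.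
by rewrite -(rmorph0 (ratr : rat -> R)); exact: rho_der.
Qed.

Fact dist_sym p q : rho p q = rho q p.
Proof.
suff le a b : rho a b <= rho b a by apply/eqP; rewrite eq_le !le.
by apply: rho_le => t /rho_lt[r /derivable_sym h /ltW rt]; exists r.
Qed.

Fact dist_triangle q p r : rho p r <= rho p q + rho q r.
Proof.
apply: rho_le => t; rewrite -ltrBrDr => /rho_lt[a pq]; rewrite ltrBrDr -ltrBrDl.
move=> /rho_lt[b qr bt]; exists (a + b); first exact: derivable_trans pq qr.
by rewrite rmorphD/= -lerBrDl ltW.
Qed.

Fact dist_add p p' q q' : rho (SAdd p q) (SAdd p' q') <= rho p p' + rho q q'.
Proof.
apply: rho_le => t; rewrite -ltrBrDr => /rho_lt[a pq]; rewrite ltrBrDr -ltrBrDl.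
move=> /rho_lt[b qr bt]; exists (a + b); first exact: derivable_add pq qr.
by rewrite rmorphD/= -lerBrDl ltW.
Qed.

Fact dist_mull c p q : rho (SMul c p) (SMul c q) <= rho c (K 0) * rho p q.
Proof.
apply: le_mul_of_lt => // s t /rho_lt[a ca /ltW as_] /rho_lt[b pb /ltW bt].
apply: le_trans (rho_der (derivable_mull ca pb)) _.
by rewrite rmorphM/= ler_pM ?ler0q ?(der_ge0 ca) ?(der_ge0 pb).
Qed.

Fact dist_mulr c p q : rho (SMul p c) (SMul q c) <= rho p q * rho c (K 0).
Proof.
apply: le_mul_of_lt => // s t /rho_lt[b pb /ltW bt] /rho_lt[a ca /ltW as_].
apply: le_trans (rho_der (derivable_mulr pb ca)) _.
by rewrite rmorphM/= ler_pM ?ler0q ?(der_ge0 ca) ?(der_ge0 pb).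
Qed.

Fact dist_star p q : rho (SStar p) (SStar q) <= rho p q.
Proof.
by apply: rho_le => t /rho_lt[r /derivable_star h /ltW rt]; exists r.
Qed.

Fact dist_cstar p : rho p (K 0) ^+ 2 <= rho (SMul (SStar p) p) (K 0).
Proof.
set b := rho (SMul _ _) _.
have b0 : 0 <= b by exact: rho_ge0.
rewrite -[b]sqr_sqrtr// ler_pXn2r ?nnegrE ?rho_ge0 ?sqrtr_ge0//.
apply/ler_addgt0Pr => e e0; set s := _ + e.
have s0 : 0 < s by rewrite ltr_wpDl ?sqrtr_ge0.
have bs : b < s ^+ 2.
  by rewrite -[ltLHS]sqr_sqrtr// ltr_pXn2r ?nnegrE ?sqrtr_ge0 ?ltrDl// ltW.
have [r pr rs] := rho_lt bs.
have r0 : 0 <= ratr r :> R by rewrite ler0q (der_ge0 pr).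
have rs' : Num.sqrt (ratr r) < s.
  by rewrite -[ltRHS]gtr0_norm// -sqrtr_sqr ltr_sqrt// exprn_gt0.
have [t] := rat_in_itvoo rs'; rewrite in_itv/= => /andP[rt ts].
have t0 : 0 <= ratr t :> R by apply: le_trans (ltW rt); exact: sqrtr_ge0.
apply: le_trans (ltW ts); apply: rho_der; apply: derivable_cstar pr _ _.
  by rewrite -(@ler0q R).
rewrite -(@ler_rat R) rmorphM/= -expr2 -[leLHS]sqr_sqrtr//.
by rewrite ler_pXn2r ?nnegrE ?sqrtr_ge0// ltW.
Qed.

Fact dist_axiom i s : (i < size axiom_templates)%N ->
  let t := nth (K 0, K 0) axiom_templates i in
  rho (starpoly_subst s t.1) (starpoly_subst s t.2) = 0.
Proof. by move=> i13 /=; apply: rho_der0; exact: derivable_axiom. Qed.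

Fact dist_central c p : rho (SMul (K c) p) (SMul p (K c)) = 0.
Proof. by apply: rho_der0; exact: derivable_central. Qed.

Fact dist_const a b c d :
  rho (SAdd (SMul (SStar (K a)) (K b)) (K c)) (K d) <=
  Normc.normc (ratc R (conjc a * b + c - d)).
Proof.
apply: rho_le => t zt; have [r] := rat_in_itvoo zt.
rewrite in_itv/= => /andP[zr rt]; exists r; last exact: ltW.
apply: derivable_const; apply: (@const_condition_complete R); last exact: ltW.
by rewrite -(@ler0q R); exact: le_trans (normc_ge0 (ratc R _)) (ltW zr).
Qed.

Let rho_sound p q : nrm (peval (pad x) p - peval (pad x) q) <= rho p q.
Proof.
apply/ler_addgt0Pr => e e0; have [|r pqr /ltW rt] := @rho_lt p q (rho p q + e).
  by rewrite ltrDl.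
by apply: le_trans rt; exact: derivable_sound xX _ pqr.
Qed.

Fact dist_one : 1 <= rho (K 1) (K 0).
Proof.
by apply: le_trans (rho_sound _ _); rewrite /= ratc0 ratc1 scale0r subr0 scale1r nrm_one.
Qed.

Definition derivable_pseudometric : cstar_pseudometric R :=
  CstarPseudometric dist_sym dist_triangle dist_add dist_mull dist_mulr
    dist_star dist_cstar dist_axiom dist_central dist_const dist_one.

Lemma derivable_distE p : rho p (K 0) = nrm (peval (pad x) p).
Proof.
apply/eqP; rewrite eq_le; apply/andP; split; last first.
  by have := rho_sound p (K 0); rewrite /= ratc0 scale0r subr0.
pose P := derivable_pseudometric; pose D := completion P.
pose g n : D := dconst P (SVar n).
have gE p' : peval g p' = dconst P p' by exact: peval_completion.
have gn p' : nrm (dconst P p' : D) = rho p' (K 0).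
  by apply: (@complexI R); rewrite nrmE norm_completion.
pose z (k : 'I_(fp_ngen X)) : D := g k.
have z0 : approx_rep 0 z.
  split.
  - apply/subr0_eq/nrm_eq0.
    have -> : z (fp_unit X) - cone =
        peval g (SAdd (SVar (fp_unit X : nat)) (SMul (K (-1)) (K 1))).
      by rewrite /= ratcN ratc1 scale1r cmulx1 scaleN1r.
    rewrite gE gn; apply: rho_der0.
    have h : derivable X (SAdd (SVar (fp_unit X : nat)) (SMul (K (-1)) (K 1)),
        SAdd (K 1) (SMul (K (-1)) (K 1)), 0 + 0).
      apply: derivable_add; first exact: derivable_unit.
      have := @derivable_axiom X 7 (fun=> SMul (K (-1)) (K 1)) isT => h7.
      have := derivable_trans (derivable_sym h7) h7.
      by rewrite addr0.
    have := derivable_trans h (@derivable_axiom X 3 (fun=> K 1) isT).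
    by rewrite !addr0.
  - move=> i.
    have -> : peval z (fp_rel i) = dconst P (lift_poly (fp_rel i)).
      by rewrite -gE /lift_poly peval_subst.
    rewrite norm_completion lecR; rewrite -[leRHS](rmorph0 (ratr : rat -> R)).
    exact: rho_der (derivable_rel i).
  - move=> k; rewrite norm_completion lecR addr0.
    exact: rho_der (derivable_bound k).
have [phi phi_hom phix] := (let: And3 _ _ u := ux in u) D z z0.
have phia n : phi (pad x n) = g n.
  rewrite /pad; case: insubP => [k kn kE|jn]; first by rewrite phix /z kE.
  rewrite (star_hom0 phi_hom); apply/esym/nrm_eq0; rewrite gn; apply: rho_der0.
  by apply: derivable_pad; rewrite leqNgt.
have <- : nrm (phi (peval (pad x) p)) = rho p (K 0).
  rewrite (star_hom_peval phi_hom) -gn -gE; congr nrm.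
  exact: peval_ext.
exact: star_hom_contractive.
Qed.

Lemma derivable_norm p t : nrm (peval (pad x) p) < t ->
  exists2 r, derivable X (p, K 0, r) & ratr r < t.
Proof. by rewrite -derivable_distE; exact: rho_lt. Qed.

End UpperBounds.

(** * Approximate representations in B *)

Section Ultrapower.
Variables (R : realType) (B : cstarType R) (U : ultrafilterN).

Let U_ultra : UltraFilter U := ufilter_ultra U.
#[local] Existing Instance U_ultra.
Let U_proper : ProperFilter U := @ultra_proper _ _ U_ultra.
#[local] Existing Instance U_proper.

Lemma ulim_norm_cvg (b : Defs.bseq B) :
  nrm (b n) @[n --> ufilter U] --> ulim_norm U b.
Proof.
suff : cvg (nrm (b n) @[n --> ufilter U]) by [].
have [M bM] := bseq_bounded b.
have bU : (nrm (b n) @[n --> ufilter U]) `[0, M]%classic.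
  by apply: nearW => n /=; rewrite in_itv/= nrm_ge0/= -lecR nrmE.
have [p [_ pcl]] := segment_compact _ bU.
apply/cvg_ex; exists p; apply/cvgrPdist_lt => e e0.
have [//|nU] := in_ultra_setVsetC [set n | `|p - nrm (b n)| < e] U_ultra.
have [|_ [[n /= nn <-] pn]] :=
    pcl ((fun n => nrm (b n)) @` ~` [set n | `|p - nrm (b n)| < e]) (ball p e) _
      (nbhsx_ballx _ _ e0).
  by apply: filterS nU => n nn; exists n.
by exfalso; apply: nn.
Qed.

Lemma norm_uclass (b : Defs.bseq B) : nrm (uclass U b) = ulim_norm U b.
Proof. by apply: (@complexI R); rewrite nrmE; exact: unormE. Qed.

Lemma peval_uclass V (y : V -> Defs.bseq B) p : exists2 b : Defs.bseq B,
  (forall n, b n = peval (fun v => y v n) p) &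
  peval (fun v => uclass U (y v) : ultrapower B U) p = uclass U b.
Proof.
elim: p => [c|v|p [a aE pE] q [b bE qE]|p [a aE pE] q [b bE qE]|p [a aE pE]] /=.
- by exists (bseq_scale (ratc R c) (bseq_const cone)) => //; exact: uscaleE.
- by exists (y v).
- exists (bseq_add a b) => [n /=|]; first by rewrite aE bE.
  by rewrite pE qE; exact: uaddE.
- exists (bseq_mul a b) => [n /=|]; first by rewrite aE bE.
  by rewrite pE qE; exact: umulE.
- exists (bseq_star a) => [n /=|]; first by rewrite aE.
  by rewrite pE; exact: ustarE.
Qed.

Lemma peval_uclass_lt V (y : V -> Defs.bseq B) p e :
  nrm (peval (fun v => uclass U (y v) : ultrapower B U) p) < e ->
  \forall n \near ufilter U, nrm (peval (fun v => y v n) p) < e.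
Proof.
have [b bE ->] := peval_uclass y p; rewrite norm_uclass => be.
have H : \forall n \near ufilter U, nrm (b n) < e.
  by apply: cvgr_lt be; exact: ulim_norm_cvg.
by apply: filterS H => n; rewrite /= bE.
Qed.

Lemma peval_uclass_gt V (y : V -> Defs.bseq B) p e :
  e < nrm (peval (fun v => uclass U (y v) : ultrapower B U) p) ->
  \forall n \near ufilter U, e < nrm (peval (fun v => y v n) p).
Proof.
have [b bE ->] := peval_uclass y p; rewrite norm_uclass => be.
have H : \forall n \near ufilter U, e < nrm (b n).
  by apply: cvgr_gt be; exact: ulim_norm_cvg.
by apply: filterS H => n; rewrite /= bE.
Qed.

End Ultrapower.

Section LowerBounds.
Variables (R : realType) (B : cstarType R).
Hypothesis B_universal : locally_universal B.
Variables (X : finite_relations) (A : cstarType R).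
Variable x : 'I_(fp_ngen X) -> A.
Hypothesis gx : generates x.
Hypothesis xX : approx_rep 0 x.

Lemma approximate_representation p (e : R) : 0 < e ->
  exists w : nat -> B, [/\ w (fp_unit X) = cone,
    forall n, (fp_ngen X <= n)%N -> w n = 0,
    forall i : 'I_(fp_nrel X), nrm (peval w (lift_poly (fp_rel i))) < e,
    forall k : 'I_(fp_ngen X), nrm (w k) < ratr (fp_bound k) + e &
    nrm (peval (pad x) p) - e < nrm (peval w p)].
Proof.
move=> e0; have [xu xr xb] := xX.
have [U [phi [phi_hom phi_iso]]] := B_universal (presentation_separable (generates_pad gx)).
have U_ultra : UltraFilter U := ufilter_ultra U.
have U_proper : ProperFilter U := @ultra_proper _ _ U_ultra.
pose y n : Defs.bseq B := if n == fp_unit X :> nat then bseq_const cone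
  else if (n < fp_ngen X)%N then urep (phi (pad x n)) else bseq_const 0.
have yE n : uclass U (y n) = phi (pad x n).
  rewrite /y; case: eqP => [->|_].
    by have [_ _ phi1 _] := phi_hom; rewrite /pad valK xu phi1.
  case: ltnP => nj; first by rewrite urepK.
  by rewrite /pad insubF ?(star_hom0 phi_hom)// ltnNge nj.
have pevalE q : nrm (peval (fun n => uclass U (y n) : ultrapower B U) q) = nrm (peval (pad x) q).
  rewrite (peval_ext (z := phi \o pad x) q yE) -star_hom_peval//.
  by apply: (@complexI R); rewrite !nrmE phi_iso.
have Hr : \forall n \near ufilter U, forall i : 'I_(fp_nrel X),
    nrm (peval (y^~ n) (lift_poly (fp_rel i))) < e.
  apply: filter_forall => i; apply: peval_uclass_lt; rewrite pevalE peval_lift.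
  by apply: le_lt_trans e0; rewrite -lecR nrmE; exact: xr.
have Hb : \forall n \near ufilter U, forall k : 'I_(fp_ngen X), nrm (y k n) < ratr (fp_bound k) + e.
  apply: filter_forall => k; apply: (@peval_uclass_lt _ _ U _ y (SVar (k : nat))).
  rewrite pevalE /= /pad valK; apply: (@le_lt_trans _ _ (ratr (fp_bound k))).
    by rewrite -lecR nrmE; have := xb k; rewrite addr0.
  by rewrite ltrDl.
have Hp : \forall n \near ufilter U, nrm (peval (pad x) p) - e < nrm (peval (y^~ n) p).
  by apply: peval_uclass_gt; rewrite pevalE ltrBlDr ltrDl.
have [n [[nr nb] np]] := filter_ex (filterI (filterI Hr Hb) Hp).
exists (y^~ n); split => //; first by rewrite /y eqxx.
move=> m jm; rewrite /y ltnNge jm /=; case: eqP => // mu.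
by move: jm; rewrite mu leqNgt ltn_ord.
Qed.

Lemma approximate_rational_representation (Bd : nat -> B) p (e : R) :
  generates Bd -> 0 < e ->
  exists q : nat -> starpoly nat, let w n := peval Bd (q n) in
    [/\ q (fp_unit X) = SConst 1,
    forall n, (fp_ngen X <= n)%N -> q n = SConst 0,
    forall i : 'I_(fp_nrel X), nrm (peval w (lift_poly (fp_rel i))) < e,
    forall k : 'I_(fp_ngen X), nrm (w k) < ratr (fp_bound k) + e &
    nrm (peval (pad x) p) - e < nrm (peval w p)].
Proof.
move=> gB e0; have e2 : 0 < e / 2 by rewrite divr_gt0.
have [w [wu w0 wr wb wp]] := approximate_representation p e2.
pose K := (\max_(k < fp_ngen X) Num.bound (nrm (w k)))%N.
have wK n : nrm (w n) <= K%:R.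
  case: (ltnP n (fp_ngen X)) => nj; last by rewrite w0// nrm0.
  apply: (@le_trans _ _ (Num.bound (nrm (w n)))%:R).
    by apply/ltW/archi_boundP; exact: nrm_ge0.
  by rewrite ler_nat (leq_bigmax (Ordinal nj)).
pose L := (\sum_(i < fp_nrel X) lipschitz_bound K (lift_poly (fp_rel i)) + lipschitz_bound K p)%N.
pose d : R := Num.min 1 (e / 2 / L.+1%:R).
have L0 : 0 < L.+1%:R :> R by rewrite ltr0n.
have d0 : 0 < d by rewrite lt_min ltr01 divr_gt0.
have d1 : d <= 1 by rewrite ge_min lexx.
have dL : L.+1%:R * d <= e / 2.
  by rewrite mulrC -ler_pdivlMr// ge_min lexx orbT.
have de : d <= e / 2.
  by apply: le_trans dL; rewrite ler_peMl ?(ltW d0)// ler1n.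
have /choice[r rw] n : exists q, nrm (peval Bd q - w n) < d.
  exact: rational_points_dense.
pose q n := if n == fp_unit X :> nat then SConst 1
  else if (n < fp_ngen X)%N then r n else SConst 0.
have qw n : nrm (peval Bd (q n) - w n) <= d.
  rewrite /q; case: eqP => [->|_].
    by rewrite /= ratc1 scale1r wu subrr nrm0 ltW.
  case: ltnP => nj; first exact: ltW.
  by rewrite w0//= ratc0 scale0r subrr nrm0 ltW.
have lip p' : (lipschitz_bound K p' <= L)%N ->
    nrm (peval (fun n => peval Bd (q n)) p' - peval w p') <= e / 2.
  move=> pL; have [|||_ _ h] := @peval_lipschitz R B _ (fun n => peval Bd (q n)) w K d p' (ltW d0).
  - move=> n; rewrite -[peval Bd (q n)](subrK (w n)); apply: le_trans (nrmD _ _) _.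
    by rewrite -addn1 natrD addrC lerD// (le_trans (qw n)).
  - by move=> n; apply: le_trans (wK n) _; rewrite ler_nat.
  - exact: qw.
  apply: le_trans h _; apply: le_trans dL; rewrite ler_wpM2r ?ltW//.
  by rewrite ltr_nat ltnS.
exists q; split.
- by rewrite /q eqxx.
- move=> n jn; rewrite /q ltnNge jn /=; case: eqP => // nu.
  by move: jn; rewrite nu leqNgt ltn_ord.
- move=> i; rewrite -[peval _ _](subrK (peval w (lift_poly (fp_rel i)))).
  apply: le_lt_trans (nrmD _ _) _; rewrite [e]splitr; apply: ler_ltD => //.
  by apply: lip; rewrite /L (bigD1 i)//= -addnA leq_addr.
- move=> k; rewrite -[peval _ _](subrK (w k)).
  apply: le_lt_trans (nrmD _ _) _; have := wb k; have := qw k; lra.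
- have := lip p (leq_addl _ _).
  have := nrmD (peval w p - peval (fun n => peval Bd (q n)) p)
    (peval (fun n => peval Bd (q n)) p).
  rewrite subrK nrmB; lra.
Qed.

End LowerBounds.

(** * The search *)

Lemma computable_lipschitz_bound E (cE : coded E) K (f : E -> starpoly nat) :
  computable f -> computable (fun e => lipschitz_bound K (f e)).
Proof.
move=> cf.
apply: (@computable_fold _ _ _ _ 0%N gauss_bound (fun _ _ => K.+1) addn
  (fun a b => 2 * (a * b))%N id) => //.
- rewrite /gauss_bound; computability; apply: computable_absz; apply: computable_numq.
    exact: computable_Re (@computable_id _ _).
  exact: computable_Im (@computable_id _ _).
- by computability.
- by computability.
- by computability.
- by computability.
Qed.

Lemma ratr_expV (R : realType) m : ratr ((2 ^ m)%N%:R^-1) = 2 ^- m :> R.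
Proof. by rewrite fmorphV/= ratr_nat natrX. Qed.

Lemma half_expV (R : realType) m : 2 ^- m = 2 ^- m.+1 + 2 ^- m.+1 :> R.
Proof. by rewrite exprS invfM; lra. Qed.

Lemma nrm_approx (R : realType) (D : cstarType R) (y : D) q k :
  (`| `|y| - ratr q | < 2 ^- k) = (`|nrm y - ratr q| < 2 ^- k).
Proof.
rewrite -nrmE -(fmorph_rat (real_complex R)) -rmorphB.
rewrite -[2 ^- k](_ : (2 ^- k)%:C%C = _); last by rewrite fmorphV rmorphXn rmorph_nat.
by rewrite -ltcR; congr (_ < _); rewrite -normcE normc_real.
Qed.

Section Search.
Variables (R : realType) (B : cstarType R) (Bd : presentation B).
Hypothesis B_universal : locally_universal B.
Variable nB : starpoly nat -> nat -> rat.
Hypothesis nB_computable : computable (fun y => nB y.1 y.2).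
Hypothesis nB_approx : forall p k, `|nrm (peval Bd p) - ratr (nB p k)| < 2 ^- k.

Variables (X : finite_relations) (A : cstarType R) (x : 'I_(fp_ngen X) -> A).
Hypothesis ux : is_universal x.
Variable stab : nat -> nat.
Hypothesis stab_recursive : recursive1 stab.
Hypothesis stabP : forall (n : nat) (D : cstarType R) (z : 'I_(fp_ngen X) -> D),
  approx_rep (2 ^- stab n) z ->
  exists2 phi : A -> D, star_hom phi & forall k, `|phi (x k) - z k| < 2 ^- n.

Variable enum_der : nat -> judgement.
Hypothesis enum_computable : computable enum_der.
Hypothesis enum_sound : forall n, derivable X (enum_der n).
Hypothesis enum_complete : forall J, derivable X J -> exists n, enum_der n = J.

Definition generator_bound := (\max_(k < fp_ngen X) `|numq (fp_bound k)|)%N.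

(* A Lipschitz constant [L] satisfies [L <= 2 ^ L], so tuples at distance
   [2 ^- (k.+3 + L)] change the norm of [p] by at most [2 ^- k.+3]. *)
Definition stage (p : starpoly nat) k := stab (k.+3 + lipschitz_bound generator_bound p).

Definition tuple_point t n := if (n < fp_ngen X)%N then tget t n else SConst 0.

Definition is_representation t m :=
  [&& poly_code (tuple_point t (fp_unit X)) == poly_code (SConst 1 : starpoly nat),
      all (fun i : 'I_(fp_nrel X) =>
        nB (starpoly_subst (tuple_point t) (lift_poly (fp_rel i))) m.+2 <=
        (2 ^ m.+1)%N%:R^-1) (enum 'I_(fp_nrel X)) &
      all (fun k : 'I_(fp_ngen X) =>
        nB (tuple_point t k) m.+2 <= fp_bound k + (2 ^ m.+1)%N%:R^-1)
        (enum 'I_(fp_ngen X))].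

Definition lower_bound t p k := nB (starpoly_subst (tuple_point t) p) k.+3.

(* [s] codes a derivation and a tuple of rational points of [B]. The computed
   norm may be off by [2 ^- k.+3], and so may the norm at the tuple and the
   derived bound. *)
Definition is_witness s p k :=
  [&& poly_code (enum_der (pfst s)).1.1 == poly_code p,
      poly_code (enum_der (pfst s)).1.2 == poly_code (SConst 0 : starpoly nat),
      (enum_der (pfst s)).2 <=
        lower_bound (psnd s) p k + 3%:R * (2 ^ k.+3)%N%:R^-1 &
      is_representation (psnd s) (stage p k)].

Let a := pad x.
Let point t n : B := peval Bd (tuple_point t n).

Let xX : approx_rep 0 x. Proof. by case: ux. Qed.

Lemma bound_le (k : 'I_(fp_ngen X)) : ratr (fp_bound k) <= generator_bound%:R :> R.
Proof.
apply: le_trans (ler_norm _) _; apply: le_trans (normr_ratr_le _ _) _.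
by rewrite ler_nat (leq_bigmax k).
Qed.

Lemma lower_bound_le t p k : is_representation t (stage p k) ->
  ratr (lower_bound t p k) <= nrm (peval a p) + 2 ^- k.+3 + 2 ^- k.+3.
Proof.
set m := stage p k => /and3P[/eqP tu /allP tr /allP tb].
have [xu xr xb] := xX.
have {}tu : tuple_point t (fp_unit X) = SConst 1 by exact: can_inj poly_codeK _ _ tu.
have m2 := half_expV R m; have m1 := half_expV R m.+1.
have m0 : 0 < 2 ^- m.+2 :> R by rewrite invr_gt0 exprn_gt0.
have m0' : 2 ^- m <= 1 :> R by rewrite invf_le1 ?exprn_gt0// exprn_ege1// ler1n.
have tb' k' : nrm (point t (k' : 'I_(fp_ngen X))) <= ratr (fp_bound k') + 2 ^- m.
  have := tb k'; rewrite mem_enum => /(_ isT); rewrite -(@ler_rat R) rmorphD/= ratr_expV.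
  have := nB_approx (tuple_point t k') m.+2; rewrite ltr_norml -/(point _ _); lra.
pose z (k : 'I_(fp_ngen X)) : B := point t k.
have zX : approx_rep (2 ^- m) z.
  split.
  - by rewrite /z /point tu /= ratc1 scale1r.
  - move=> i; rewrite -nrmE lecR.
    have -> : peval z (fp_rel i) = peval Bd (starpoly_subst (tuple_point t) (lift_poly (fp_rel i))).
      by rewrite /lift_poly !peval_subst.
    have := tr i; rewrite mem_enum => /(_ isT); rewrite -(@ler_rat R) ratr_expV.
    have := nB_approx (starpoly_subst (tuple_point t) (lift_poly (fp_rel i))) m.+2.
    rewrite ltr_norml; lra.
  - by move=> k'; rewrite -nrmE lecR; exact: tb'.
have [phi phi_hom phiz] := stabP zX.
set n := (k.+3 + _)%N in phiz.
have n0 : 0 < 2 ^- n :> R by rewrite invr_gt0 exprn_gt0.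
have K0 : 0 <= generator_bound%:R :> R by rewrite ler0n.
have K1 : generator_bound.+1%:R = generator_bound%:R + 1 :> R by rewrite -addn1 natrD.
have pt_out i : (fp_ngen X <= i)%N -> point t i = 0.
  by move=> ji; rewrite /point /tuple_point ltnNge ji /= ratc0 scale0r.
have [|||_ _ lip] := @peval_lipschitz R B _ (point t) (phi \o a) generator_bound
  (2 ^- n) p (ltW n0).
- move=> i; rewrite K1; case: (ltnP i (fp_ngen X)) => ij.
    by have := tb' (Ordinal ij); have := bound_le (Ordinal ij); rewrite /=; lra.
  by rewrite pt_out// nrm0; lra.
- move=> i; rewrite K1; apply: le_trans (star_hom_contractive phi_hom _) _.
  rewrite /a /pad; case: insubP => [k' _ _|_]; last by rewrite nrm0; lra.
  have := xb k'; rewrite -nrmE lecR; have := bound_le k'; lra.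
- move=> i /=; case: (ltnP i (fp_ngen X)) => ij.
    have := phiz (Ordinal ij); rewrite -nrmE nrmB.
    rewrite -[2 ^- n](_ : (2 ^- n)%:C%C = _); last by rewrite fmorphV rmorphXn rmorph_nat.
    rewrite ltcR /z /= => /ltW; apply: le_trans; rewrite /a /pad insubT//=.
  by rewrite pt_out// /a /pad insubF ?(star_hom0 phi_hom) ?subrr ?nrm0 ?ltW// ltnNge ij.
have lip' : nrm (peval (point t) p) <= nrm (peval a p) + 2 ^- k.+3.
  rewrite -[peval (point t) p](subrK (peval (phi \o a) p)).
  apply: le_trans (nrmD _ _) _; rewrite addrC; apply: lerD.
    by rewrite -star_hom_peval//; exact: star_hom_contractive.
  apply: le_trans lip _; rewrite /n exprD invfM mulrCA ler_piMr ?invr_ge0 ?exprn_ge0//.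
  by rewrite ler_pdivrMr ?exprn_gt0// mul1r -natrX ler_nat ltnW// ltn_expl.
have := nB_approx (starpoly_subst (tuple_point t) p) k.+3.
rewrite peval_subst -/(lower_bound _ _ _) -/(point t) ltr_norml; lra.
Qed.

Lemma witness_approx s p k : is_witness s p k ->
  `|nrm (peval a p) - ratr (lower_bound (psnd s) p k)| < 2 ^- k.
Proof.
case/and4P => /eqP e1 /eqP e2 e3 /lower_bound_le lb.
have := enum_sound (pfst s); case: (enum_der _) e1 e2 e3 => -[p' q'] r e1 e2 e3.
have {e1}-> : p' = p by exact: can_inj poly_codeK _ _ e1.
have {e2}-> : q' = SConst 0 by exact: can_inj poly_codeK _ _ e2.
move: e3; rewrite [(_, r).2]/= => e3.
move=> /(derivable_sound xX); rewrite /sound /= ratc0 scale0r subr0 => pr.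
move: e3; rewrite -(@ler_rat R) rmorphD rmorphM/= ratr_expV ratr_nat => e3.
have k0 : 0 < 2 ^- k.+3 :> R by rewrite invr_gt0 exprn_gt0.
have := half_expV R k; have := half_expV R k.+1; have := half_expV R k.+2.
rewrite ltr_norml; move: pr lb; rewrite -/a; lra.
Qed.

Lemma witness_ex p k : exists s, is_witness s p k.
Proof.
set m := stage p k; pose e : R := Num.min (2 ^- k.+3) (2 ^- m.+2).
have k0 : 0 < 2 ^- k.+3 :> R by rewrite invr_gt0 exprn_gt0.
have m0 : 0 < 2 ^- m.+2 :> R by rewrite invr_gt0 exprn_gt0.
have e0 : 0 < e by rewrite lt_min k0.
have ek : e <= 2 ^- k.+3 by rewrite ge_min lexx.
have em : e <= 2 ^- m.+2 by rewrite ge_min lexx orbT.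
have [_ gx _] := ux.
have [q [qu q0 qr qb qp]] := approximate_rational_representation B_universal gx xX p
  (@special_pointP _ _ Bd) e0.
have [t tq] := tget_ex q (fp_ngen X).
have tE n : tuple_point t n = q n.
  by rewrite /tuple_point; case: ltnP => nj; [exact: tq|rewrite q0].
have pE p' : peval Bd (starpoly_subst (tuple_point t) p') = peval (fun n => peval Bd (q n)) p'.
  by rewrite peval_subst; apply: peval_ext => n; rewrite tE.
have [r pr rt] : exists2 r, derivable X (p, SConst 0, r) & ratr r < nrm (peval a p) + 2 ^- k.+3.
  by apply: (derivable_norm ux); rewrite ltrDl.
have [i iE] := enum_complete pr.
have m1 := half_expV R m.+1.
exists (pair_code i t); rewrite /is_witness pair_codeKfst pair_codeKsnd iE.
apply/and4P; split; [exact: eqxx|exact: eqxx| |apply/and3P; split].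
- rewrite -(@ler_rat R) rmorphD rmorphM/= ratr_expV ratr_nat /lower_bound.
  have := nB_approx (starpoly_subst (tuple_point t) p) k.+3.
  rewrite pE ltr_norml; move: qp; rewrite -/a; lra.
- by rewrite tE qu.
- apply/allP => l _; rewrite -(@ler_rat R) ratr_expV.
  have := nB_approx (starpoly_subst (tuple_point t) (lift_poly (fp_rel l))) m.+2.
  by rewrite pE ltr_norml; have := qr l; lra.
- apply/allP => l _; rewrite -(@ler_rat R) rmorphD/= ratr_expV tE.
  have := nB_approx (q l) m.+2.
  by rewrite ltr_norml; have := qb l; lra.
Qed.

Lemma computable_tuple_point E (cE : coded E) (t n : E -> nat) :
  computable t -> computable n -> computable (fun e => tuple_point (t e) (n e)).
Proof. by move=> ct cn; rewrite /tuple_point; computability. Qed.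

Lemma computable_subst_tuple E (cE : coded E) (t : E -> nat) (p : E -> starpoly nat) :
  computable t -> computable p ->
  computable (fun e => starpoly_subst (tuple_point (t e)) (p e)).
Proof.
move=> ct cp; apply: (computable_subst (s := fun e => tuple_point (t e))) => //.
apply: computable_tuple_point; last by computability.
by apply: (computable_comp ct); computability.
Qed.

Lemma computable_lower_bound E (cE : coded E) (t k : E -> nat) (p : E -> starpoly nat) :
  computable t -> computable p -> computable k ->
  computable (fun e => lower_bound (t e) (p e) (k e)).
Proof.
move=> ct cp ck; apply: (computable_comp2 (h := nB)) => //.
  exact: computable_subst_tuple.
by computability.
Qed.

Lemma computable_is_representation E (cE : coded E) (t m : E -> nat) :
  computable t -> computable m ->
  computable (fun e => is_representation (t e) (m e)).
Proof.
move=> ct cm; rewrite /is_representation; computability => //.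
- by apply: computable_tuple_point => //; computability.
- apply: (@computable_all _ _ _ _ (fun (i : 'I_(fp_nrel X)) e =>
    nB (starpoly_subst (tuple_point (t e)) (lift_poly (fp_rel i))) (m e).+2 <=
    (2 ^ (m e).+1)%N%:R^-1)) => i; computability => //.
  apply: (computable_comp2 (h := nB)) => //; last by computability.
  by apply: computable_subst_tuple => //; computability.
- apply: (@computable_all _ _ _ _ (fun (k : 'I_(fp_ngen X)) e =>
    nB (tuple_point (t e) k) (m e).+2 <= fp_bound k + (2 ^ (m e).+1)%N%:R^-1)) => k;
    computability => //.
  apply: (computable_comp2 (h := nB)) => //; last by computability.
  by apply: computable_tuple_point => //; computability.
Qed.

Lemma computable_is_witness E (cE : coded E) (s k : E -> nat) (p : E -> starpoly nat) :
  computable s -> computable p -> computable k ->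
  computable (fun e => is_witness (s e) (p e) (k e)).
Proof.
move=> cs cp ck; rewrite /is_witness; computability => //;
  do ?by [apply: (computable_comp enum_computable); computability].
  by apply: computable_lower_bound; computability.
apply: computable_is_representation; first by computability.
apply: (computable_nat1 stab_recursive); computability => //.
exact: computable_lipschitz_bound.
Qed.

Lemma standard_computable : computable_presentation (standard_presentation ux).
Proof.
have ex n : exists s, is_witness s (starpoly_decode (pfst n)) (psnd n).
  exact: witness_ex.
pose v n := lower_bound (psnd (ex_minn (ex n))) (starpoly_decode (pfst n)) (psnd n).
have [g rg gE] : computable v.
  apply: computable_lower_bound; do ?by computability.
  apply: computable_psnd.
  have := @computable_mu _ _ id _ ex (@computable_id _ _) (fun=> erefl); apply.
  by apply: computable_is_witness; computability.
exists (fun c k => g (pair_code c k)); first exact: recursive2_uncurry.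
move=> p k; exists (v (pair_code (poly_code p) k)); first exact: gE.
have vP n : `|nrm (peval a (starpoly_decode (pfst n))) - ratr (v n)| < 2 ^- psnd n.
  by apply: witness_approx; case: ex_minnP.
have := vP (pair_code (poly_code p) k).
by rewrite pair_codeKsnd pair_codeKfst poly_codeK nrm_approx.
Qed.

End Search.

Theorem theorem2p13 (R : realType) :
  (exists (B : cstarType R) (Bd : presentation B),
     locally_universal B /\ computable_presentation Bd) ->
  forall (X : finite_relations) (A : cstarType R)
         (x : 'I_(fp_ngen X) -> A) (ux : is_universal x),
    computably_weakly_stable x ->
    computable_presentation (standard_presentation ux).
Proof.
move=> [B [Bd [B_universal [f rf fP]]]] X A x ux [stab stab_rec stabP].
have nB_ex (y : starpoly nat * nat) : exists q, f (poly_code y.1) y.2 = rat_code q /\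
    `|nrm (peval Bd y.1) - ratr q| < 2 ^- y.2.
  by have [q qE qP] := fP y.1 y.2; exists q; rewrite -nrm_approx.
have [nB nBP] := choice nB_ex.
have nB_computable : computable (fun y : starpoly nat * nat => nB (y.1, y.2)).
  exists (fun n => f (pfst n) (psnd n)); first exact: recursive1_curry.
  move=> [p k]; rewrite pair_codeKfst pair_codeKsnd.
  by have [] := nBP (p, k).
have [e [ce e_sound e_complete]] := derivable_enum X.
apply: (@standard_computable _ _ _ B_universal (fun p k => nB (p, k)) nB_computable
  _ _ _ _ ux _ stab_rec stabP _ ce e_sound e_complete).
by move=> p k; exact: (nBP (p, k)).2.
Qed.
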